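(* Let $\Lambda\in P^+$, $\beta\in Q_n^+$. Let $p\in\mathbb N$, $\mathbf b=(b_1,\dots,b_p)\in\mathbb N^p$ with $\sum_{i=1}^pb_i=n$, and let $\nu^1,\dots,\nu^p\in I$ be pairwise distinct, such that $$\widetilde\nu:=\bigl(\underbrace{\nu^1,\dots,\nu^1}_{b_1\text{ copies}},\dots,\underbrace{\nu^p,\dots,\nu^p}_{b_p\text{ copies}}\bigr)\in I^\beta.$$ Let $\mu\in I^\beta$. Then $e(\widetilde\nu)\mathcal R^\Lambda(\beta)e(\mu)\neq 0$ if and only if $N^\Lambda(\mu,k)>0$ for every $1\le k\le n$. In that case, if for each $w\in\mathfrak S(\mu,\widetilde\nu)$ one fixes any reduced expression $w=s_{i_1}\cdots s_{i_t}$ and sets $\psi_w=\psi_{i_1}\cdots\psi_{i_t}$, then $$\Bigl\{\psi_{w}\prod_{k=1}^{n}x_{k}^{r_{k}}e(\mu)\Bigm| w\in\mathfrak S(\mu,\widetilde\nu),\ 0\le r_{k}<N^\Lambda(\mu,k)\ \ \forall\,1\le k\le n\Bigr\}$$ is a $K$-basis of $e(\widetilde\nu)\mathcal R^\Lambda(\beta)e(\mu)$.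
   Context: Setting. $A=(a_{ij})_{i,j\in I}$ is a symmetrizable generalized Cartan matrix and $d_i\in\mathbb{Z}_{>0}$ ($i\in I$) are such that $(d_ia_{ij})$ is symmetric. $(P,\Pi,\Pi^\vee)$ is a realization of $A$: $P$ is a free abelian group, $\Pi=\{\alpha_i\mid i\in I\}\subset P$ and $\Pi^\vee=\{h_i\mid i\in I\}\subset \mathrm{Hom}_{\mathbb Z}(P,\mathbb Z)$ are linearly independent sets and $\langle\alpha_j,h_i\rangle=a_{ij}$. There is a symmetric bilinear pairing $(-|-)$ on $P$ with $(\alpha_j|\alpha_i)=d_ia_{ij}$ and $(\Lambda|\alpha_i)=d_i\langle\Lambda,h_i\rangle$ for $\Lambda\in P$. $P^+=\{\Lambda\in P\mid\langle\Lambda,h_i\rangle\ge 0\ \forall i\in I\}$, $Q^+=\bigoplus_{i\in I}\mathbb{N}\alpha_i$ with $\mathbb N=\{0,1,2,\dots\}$; for $\beta=\sum k_i\alpha_i\in Q^+$ put $|\beta|=\sum k_i$; $Q_n^+=\{\beta\in Q^+\mid|\beta|=n\}$. For $\beta\in Q^+_n$, $I^\beta=\{\nu\in I^n\mid\sum_{i=1}^n\alpha_{\nu_i}=\beta\}$. $\mathfrak S_n$ is the symmetric group (products are compositions of maps), $s_r=(r,r+1)$, and it acts on $I^n$ by $w\nu=(\nu_{w^{-1}(1)},\dots,\nu_{w^{-1}(n)})$. Let $K$ be a field. For $i,j\in I$ let $Q_{i,j}(u,v)\in K[u,v]$ with $Q_{i,i}=0$, and for $i\ne j$, $Q_{i,j}(u,v)=\sum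 t_{i,j;p,q}u^pv^q$, summed over $p,q\in\mathbb N$ with $p(\alpha_i|\alpha_i)+q(\alpha_j|\alpha_j)+2(\alpha_i|\alpha_j)=0$, where $t_{i,j;p,q}\in K$, $t_{i,j;-a_{ij},0}\in K^\times$ and $Q_{i,j}(u,v)=Q_{j,i}(v,u)$. The quiver Hecke algebra $\mathcal R(\beta)$, $\beta\in Q_n^+$, is the unital associative $K$-algebra with generators $\psi_1,\dots,\psi_{n-1},x_1,\dots,x_n,e(\nu)$ ($\nu\in I^\beta$) and relations: $e(\nu)e(\nu')=\delta_{\nu\nu'}e(\nu)$; $\sum_{\nu\in I^\beta}e(\nu)=1$; $x_re(\nu)=e(\nu)x_r$; $\psi_re(\nu)=e(s_r\nu)\psi_r$; $x_rx_s=x_sx_r$; $\psi_rx_{r+1}e(\nu)=(x_r\psi_r+\delta_{\nu_r\nu_{r+1}})e(\nu)$; $x_{r+1}\psi_re(\nu)=(\psi_rx_r+\delta_{\nu_r\nu_{r+1}})e(\nu)$; $\psi_rx_s=x_s\psi_r$ if $s\ne r,r+1$; $\psi_r\psi_s=\psi_s\psi_r$ if $|r-s|>1$; $\psi_r^2e(\nu)=Q_{\nu_r,\nu_{r+1}}(x_r,x_{r+1})e(\nu)$; $(\psi_{r+1}\psi_r\psi_{r+1}-\psi_r\psi_{r+1}\psi_r)e(\nu)=\delta_{\nu_r\nu_{r+2}}\frac{Q_{\nu_r,\nu_{r+1}}(x_r,x_{r+1})-Q_{\nu_r,\nu_{r+1}}(x_{r+2},x_{r+1})}{x_r-x_{r+2}}e(\nu)$.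 For $\Lambda\in P^+$, the cyclotomic quiver Hecke algebra $\mathcal R^\Lambda(\beta)$ is the quotient of $\mathcal R(\beta)$ by the two-sided ideal generated by $x_1^{\langle\Lambda,h_{\nu_1}\rangle}e(\nu)$, $\nu\in I^\beta$. Notation. $\mathfrak S(\nu,\nu')=\{w\in\mathfrak S_n\mid w\nu=\nu'\}$. For $w\in\mathfrak S_n$, $1\le t\le n$: $J_w^{<t}=\{1\le j<t\mid w(j)<w(t)\}$ and $N^\Lambda(w,\nu,t)=\bigl\langle\Lambda-\sum_{j\in J_w^{<t}}\alpha_{\nu_j},h_{\nu_t}\bigr\rangle\in\mathbb Z$. Put $c_0=0$, $c_t=\sum_{i\le t}b_i$, and let $\mathfrak S_{\mathbf b}=\mathfrak S_{\{1,\dots,c_1\}}\times\cdots\times\mathfrak S_{\{c_{p-1}+1,\dots,n\}}$ be the stabilizer of $\widetilde\nu$. For $\mu\in I^\beta$, $d_\mu\in\mathfrak S_n$ is the unique minimal length representative of its right coset $\mathfrak S_{\mathbf b}d_\mu$ such that $d_\mu\mu=\widetilde\nu$ (so $\mathfrak S(\mu,\widetilde\nu)=\mathfrak S_{\mathbf b}d_\mu$). Define, for $1\le k\le n$, $$N^\Lambda(\mu,k)=N^\Lambda(d_\mu,\mu,k)+|\{1\le j<k\mid\mu_j=\mu_k\}|.$$ *)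

(* Defs.v *)
From HB Require Import structures.
From mathcomp Require Import all_boot all_order all_fingroup all_algebra.
From mathcomp Require Import finmap monalg.
From mathcomp Require Import boolp classical_sets functions cardinality fsbigop.

Set Implicit Arguments.
Unset Strict Implicit.
Unset Printing Implicit Defensive.

Import Order.TTheory GRing.Theory Num.Theory.

Local Open Scope classical_set_scope.
Local Open Scope ring_scope.

Section Bases.
Variables (R : pzRingType) (V : lmodType R) (J : choiceType).

Definition lin_indep (D : set J) (v : J -> V) : Prop :=
  forall (s : seq J) (c : J -> R), uniq s -> [set` s] `<=` D ->
    \sum_(j <- s) c j *: v j = 0 -> forall j, j \in s -> c j = 0.

(* A family (v j) indexed by D, hence without repetitions, is a basis of U. *)
Definition is_basis (U : set V) (D : set J) (v : J -> V) : Prop :=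
  [/\ forall j, D j -> U (v j),
      lin_indep D v &
      forall u, U u -> exists (s : seq J) (c : J -> R),
        [set` s] `<=` D /\ u = \sum_(j <- s) c j *: v j].

End Bases.

(* The library only has quotients of commutative rings by proper ideals; here
   the ring need not be commutative and the quotient may be the zero ring. *)

Definition two_sided_ideal (A : pzRingType) (J : set A) : Prop :=
  [/\ J 0, forall x y, J x -> J y -> J (x + y) &
      forall a x b, J x -> J (a * x * b)].

Section RingQuotient.
Variables (A : pzRingType) (S : set A).

Definition gen_ideal : set A := smallest (@two_sided_ideal A) S.

Lemma gen_idealP : two_sided_ideal gen_ideal.
Proof.
split.
- by move=> J [[J0 _ _] _].
- by move=> x y Ix Iy J JP; case: (JP) => -[_ JD _] _; apply: JD; [apply: Ix|apply: Iy].
- by move=> a x b Ix J JP; case: (JP) => -[_ _ JM] _; apply: JM; apply: Ix.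
Qed.

Let I0 : gen_ideal 0. Proof. by case: gen_idealP. Qed.
Let ID x y : gen_ideal x -> gen_ideal y -> gen_ideal (x + y).
Proof. by case: gen_idealP => _ + _; apply. Qed.
Let IMl a x : gen_ideal x -> gen_ideal (a * x).
Proof. by move=> Ix; rewrite -[a * x]mulr1; case: gen_idealP => _ _; apply. Qed.
Let IMr a x : gen_ideal x -> gen_ideal (x * a).
Proof. by move=> Ix; rewrite -[x]mul1r; case: gen_idealP => _ _; apply. Qed.
Let IN x : gen_ideal x -> gen_ideal (- x).
Proof. by move=> Ix; rewrite -mulN1r; apply: IMl. Qed.

Definition ideal_equiv (x y : A) : bool := `[< gen_ideal (x - y) >].

Lemma ideal_equiv_is_equiv : equiv_class_of ideal_equiv.
Proof.
split=> [x|x y|y x z]; rewrite /ideal_equiv.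
- by apply/asboolP; rewrite subrr.
- by apply/asboolP/asboolP => /IN; rewrite opprB.
- move=> /asboolP xy /asboolP yz; apply/asboolP.
  by rewrite -[x](addrNK y) -addrA; apply: ID.
Qed.

Canonical ideal_equiv_equiv := EquivRelPack ideal_equiv_is_equiv.
Canonical ideal_equiv_encModRel := defaultEncModRel ideal_equiv.

Definition ring_quot := {eq_quot ideal_equiv}%qT.

HB.instance Definition _ : EqQuotient A ideal_equiv ring_quot :=
  EqQuotient.on ring_quot.
HB.instance Definition _ := Choice.on ring_quot.

Local Notation repr := generic_quotient.repr.

Definition quo (x : A) : ring_quot := (\pi_ring_quot x)%qT.

Lemma quo_eqP x y : quo x = quo y <-> gen_ideal (x - y).
Proof.
split=> [/eqP|xy]; first by rewrite /quo eqmodE => /asboolP.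
by apply/eqP; rewrite /quo eqmodE; apply/asboolP.
Qed.

Let quo_repr (x : ring_quot) : quo (repr x) = x. Proof. exact: reprK. Qed.

Let quo_elim (p : ring_quot -> Prop) : (forall x, p (quo x)) -> forall x, p x.
Proof. by move=> px x; rewrite -(quo_repr x). Qed.

Definition rq_add (x y : ring_quot) := quo (repr x + repr y).
Definition rq_opp (x : ring_quot) := quo (- repr x).
Definition rq_mul (x y : ring_quot) := quo (repr x * repr y).

Let reprI x : gen_ideal (repr (quo x) - x).
Proof. by apply/quo_eqP; rewrite quo_repr. Qed.

Let quoD x y : rq_add (quo x) (quo y) = quo (x + y).
Proof. by apply/quo_eqP; rewrite opprD addrACA; apply: ID. Qed.
Let quoN x : rq_opp (quo x) = quo (- x).
Proof. by apply/quo_eqP; rewrite -opprD; apply: IN. Qed.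
Let quoM x y : rq_mul (quo x) (quo y) = quo (x * y).
Proof.
apply/quo_eqP.
rewrite -[_ * _](addrNK (x * repr (quo y))) -mulrBl -addrA -mulrBr.
by apply: ID; [apply: IMr | apply: IMl].
Qed.

Let rq_addA : associative rq_add.
Proof.
elim/quo_elim=> x; elim/quo_elim=> y; elim/quo_elim=> z.
by rewrite !quoD addrA.
Qed.
Let rq_addC : commutative rq_add.
Proof. by elim/quo_elim=> x; elim/quo_elim=> y; rewrite !quoD addrC. Qed.
Let rq_add0 : left_id (quo 0) rq_add.
Proof. by elim/quo_elim=> x; rewrite quoD add0r. Qed.
Let rq_addN : left_inverse (quo 0) rq_opp rq_add.
Proof. by elim/quo_elim=> x; rewrite quoN quoD addNr. Qed.

HB.instance Definition _ :=
  GRing.isZmodule.Build ring_quot rq_addA rq_addC rq_add0 rq_addN.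

Let rq_mulA : associative rq_mul.
Proof.
elim/quo_elim=> x; elim/quo_elim=> y; elim/quo_elim=> z.
by rewrite !quoM mulrA.
Qed.
Let rq_mul1 : left_id (quo 1) rq_mul.
Proof. by elim/quo_elim=> x; rewrite quoM mul1r. Qed.
Let rq_mulr1 : right_id (quo 1) rq_mul.
Proof. by elim/quo_elim=> x; rewrite quoM mulr1. Qed.
Let rq_mulDl : left_distributive rq_mul +%R.
Proof.
elim/quo_elim=> x; elim/quo_elim=> y; elim/quo_elim=> z.
by rewrite [_ + _]quoD !quoM mulrDl [RHS]quoD.
Qed.
Let rq_mulDr : right_distributive rq_mul +%R.
Proof.
elim/quo_elim=> x; elim/quo_elim=> y; elim/quo_elim=> z.
by rewrite [_ + _]quoD !quoM mulrDr [RHS]quoD.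
Qed.

HB.instance Definition _ := GRing.Zmodule_isPzRing.Build ring_quot
  rq_mulA rq_mul1 rq_mulr1 rq_mulDl rq_mulDr.

Let quo_is_additive : zmod_morphism quo.
Proof. by move=> x y; rewrite -quoD -quoN. Qed.
HB.instance Definition _ := GRing.isZmodMorphism.Build A ring_quot quo
  quo_is_additive.

Let quo_is_multiplicative : monoid_morphism quo.
Proof. by split=> // x y; rewrite -quoM. Qed.
HB.instance Definition _ := GRing.isMonoidMorphism.Build A ring_quot quo
  quo_is_multiplicative.

End RingQuotient.

Section ScalarsThroughMorphism.
Variables (K : pzRingType) (B : pzRingType) (f : {rmorphism K -> B}).

Definition scale_via (c : K) (x : B) : B := f c * x.

Lemma scale_viaA a b v : scale_via a (scale_via b v) = scale_via (a * b) v.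
Proof. by rewrite /scale_via rmorphM mulrA. Qed.
Lemma scale_via1 : left_id 1 scale_via.
Proof. by move=> v; rewrite /scale_via rmorph1 mul1r. Qed.
Lemma scale_viaDr : right_distributive scale_via +%R.
Proof. by move=> c x y; rewrite /scale_via mulrDr. Qed.
Lemma scale_viaDl v : {morph scale_via^~ v : a b / a + b}.
Proof. by move=> a b; rewrite /scale_via rmorphD mulrDl. Qed.

End ScalarsThroughMorphism.

Section CartanDatum.
Variable I : choiceType.

Definition is_gcm (a : I -> I -> int) : Prop :=
  [/\ forall i, a i i = 2,
      forall i j, i != j -> a i j <= 0 &
      forall i j, a i j = 0 -> a j i = 0].

Definition symmetrizes (d : I -> nat) (a : I -> I -> int) : Prop :=
  (forall i, (0 < d i)%N) /\
  (forall i j, (d i)%:Z * a i j = (d j)%:Z * a j i).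

Definition free_abelian (P : zmodType) : Prop :=
  exists B : set P, is_basis (V := zmodule P) setT B id.

Definition is_realization (a : I -> I -> int) (P : zmodType) (alpha : I -> P)
    (h : I -> {additive P -> int}) : Prop :=
  [/\ free_abelian P,
      lin_indep (V := zmodule P) setT alpha,
      lin_indep (V := zmodule (P -> int)) setT (fun i => h i : P -> int) &
      forall i j, h i (alpha j) = a i j].

(* The pairing is allowed to take rational values. *)
Definition is_pairing (a : I -> I -> int) (d : I -> nat) (P : zmodType)
    (alpha : I -> P) (h : I -> {additive P -> int}) (form : P -> P -> rat) :
    Prop :=
  [/\ forall x y, form x y = form y x,
      forall x y z, form (x + y) z = form x z + form y z,
      forall i j, form (alpha j) (alpha i) = ((d i)%:Z * a i j)%:~R &
      forall L i, form L (alpha i) = ((d i)%:Z * h i L)%:~R].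

Definition Pplus (P : zmodType) (h : I -> {additive P -> int}) : set P :=
  [set L | forall i, 0 <= h i L].

Definition Qplus (P : zmodType) (alpha : I -> P) (n : nat) : set P :=
  [set beta | exists k : {fsfun I -> nat with 0%N},
    beta = \sum_(i <- finsupp k) alpha i *+ k i /\
    (\sum_(i <- finsupp k) k i)%N = n].

(* Elements of {poly {poly K}} are polynomials in u := 'X and v := 'Y, so that
   the coefficient of u^p v^q in Q i j is (Q i j)`_p`_q, and swapXY exchanges u
   and v. *)
Definition is_qpolys (K : fieldType) (a : I -> I -> int) (P : zmodType)
    (alpha : I -> P) (form : P -> P -> rat) (Q : I -> I -> {poly {poly K}}) :
    Prop :=
  [/\ forall i, Q i i = 0,
      forall i j p q, i != j -> (Q i j)`_p`_q != 0 ->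
        p%:R * form (alpha i) (alpha i) + q%:R * form (alpha j) (alpha j)
          + 2%:R * form (alpha i) (alpha j) = 0,
      forall i j, i != j -> (Q i j)`_(absz (- a i j))`_0 != 0 &
      forall i j, Q i j = swapXY (Q j i)].

End CartanDatum.

Section Evaluation.
Variables (K : fieldType) (A : lalgType K).

Definition eval2 (q : {poly {poly K}}) (x y : A) : A :=
  \sum_(i < size q) \sum_(j < size q`_i) q`_i`_j *: (x ^+ i * y ^+ j).

(* (q(x, y) - q(z, y)) / (x - z), where
   (x^i - z^i) / (x - z) = \sum_(k < i) x^k z^(i - 1 - k). *)
Definition divdiff (q : {poly {poly K}}) (x y z : A) : A :=
  \sum_(i < size q) \sum_(j < size q`_i)
    q`_i`_j *: ((\sum_(k < i) x ^+ k * z ^+ (i.-1 - k)%N) * y ^+ j).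

End Evaluation.

Lemma divdiffE (K : fieldType) (A : comAlgType K) (q : {poly {poly K}})
    (x y z : A) :
  (x - z) * divdiff q x y z = eval2 q x y - eval2 q z y.
Proof.
rewrite /divdiff /eval2 -sumrB mulr_sumr; apply: eq_bigr => i _.
rewrite -sumrB mulr_sumr; apply: eq_bigr => j _.
rewrite -scalerBr -scalerAr mulrA -mulrBl subrXX; congr (_ *: (_ * _ * _)).
under eq_bigr do rewrite mulrC.
move: (nat_of_ord i) => m; rewrite (reindex_inj rev_ord_inj) /=.
apply: eq_bigr => k _;
have -> : (m - k.+1 = m.-1 - k)%N by rewrite -subn1 -subnDA add1n.
rewrite subKn 1?mulrC // -ltnS prednK ?ltn_ord //.
by apply: leq_ltn_trans (ltn_ord k).
Qed.

Section SymmetricGroup.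
Variable n : nat.

(* Positions are numbered from 0, so r : 'I_n.-1 stands for s_{r+1}, which
   exchanges the positions lo r = r and hi r = r + 1. *)
Lemma hi_subproof (r : 'I_n.-1) : (r.+1 < n)%N.
Proof. by rewrite -ltn_predRL. Qed.
Definition lo (r : 'I_n.-1) : 'I_n := widen_ord (leq_pred n) r.
Definition hi (r : 'I_n.-1) : 'I_n := Ordinal (hi_subproof r).

Definition sref (r : 'I_n.-1) : 'S_n := tperm (lo r) (hi r).

(* MathComp multiplies permutations from left to right, (s * t) k = t (s k),
   so the composition w \o w' is (w' * w)%g; see word_perm_cons. *)
Definition word_perm (s : seq 'I_n.-1) : 'S_n :=
  (\prod_(r <- rev s) sref r)%g.

Lemma word_perm_cons r s k : word_perm (r :: s) k = sref r (word_perm s k).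
Proof. by rewrite /word_perm rev_cons big_rcons permM. Qed.

Definition has_word (w : 'S_n) (m : nat) : bool :=
  [exists t : m.-tuple 'I_n.-1, word_perm t == w].

Lemma word_permV s : word_perm (rev s) = (word_perm s)^-1%g.
Proof.
rewrite /word_perm; elim: s => [|r s IH]; first by rewrite !big_nil invg1.
rewrite [rev (r :: s)]rev_cons rev_rcons big_cons big_rcons /= invMg IH.
by rewrite tpermV.
Qed.

Lemma word_perm_cat s t : word_perm (s ++ t) = (word_perm t * word_perm s)%g.
Proof. by rewrite /word_perm rev_cat big_cat. Qed.

Lemma word_perm_tperm m (i j : 'I_n) :
  (j = i + m :> nat)%N -> exists s, word_perm s = tperm i j.
Proof.
elim: m j => [|m IH] j jE.
  exists [::]; have -> : j = i by apply: val_inj; rewrite /= jE addn0.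
  by rewrite tperm1 /word_perm big_nil.
have lt_im : (i + m < n.-1)%N by rewrite ltn_predRL -addnS -jE.
pose r := Ordinal lt_im.
have hir : hi r = j by apply: val_inj; rewrite /= jE addnS.
have [s sE] := IH (lo r) erefl.
case: m => [|m] in lt_im r hir jE s sE IH *.
  exists [:: r]; rewrite /word_perm big_seq1 /sref hir; congr tperm.
  by apply: val_inj; rewrite /= addn0.
have ne (x y : 'I_n) : (x != y :> nat) -> x != y by apply: contra => /eqP->.
exists ([:: r] ++ s ++ [:: r]).
have wr : word_perm [:: r] = tperm (lo r) j.
  by rewrite /word_perm big_seq1 /sref hir.
rewrite !word_perm_cat wr sE -{1}[tperm (lo r) j]tpermV -mulgA.
rewrite -conjgE tpermJ tpermL tpermD //; apply: ne.
  by rewrite /= gtn_eqF // addnS ltnS leq_addr.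
by rewrite jE gtn_eqF // addnS ltnS leq_addr.
Qed.

Lemma has_wordP (w : 'S_n) : exists m, has_word w m.
Proof.
suff [s sE] : exists s, word_perm s = w.
  by exists (size s); apply/existsP; exists (in_tuple s); rewrite sE.
have [ts -> _] := prod_tpermP w.
elim: ts => [|[i j] ts [s IH]].
  by exists [::]; rewrite big_nil /word_perm big_nil.
suff [t tE] : exists t, word_perm t = tperm i j.
  by exists (s ++ t); rewrite word_perm_cat IH tE big_cons.
case/orP: (leq_total i j) => le_ij.
  by apply: (@word_perm_tperm (j - i)); rewrite subnKC.
by rewrite tpermC; apply: (@word_perm_tperm (i - j)); rewrite subnKC.
Qed.

Definition perm_len (w : 'S_n) : nat := ex_minn (has_wordP w).

Definition reduced_expr (w : 'S_n) (s : seq 'I_n.-1) : Prop :=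
  word_perm s = w /\ size s = perm_len w.

Definition pact (T : Type) (w : 'S_n) (nu : n.-tuple T) : n.-tuple T :=
  [tuple tnth nu (w^-1%g k) | k < n].

(* The Young subgroup of the blocks {c_i, ..., c_{i+1} - 1}. *)
Definition psum p (b : 'I_p -> nat) (t : nat) : nat :=
  (\sum_(i < p | (i < t)%N) b i)%N.

Definition young p (b : 'I_p -> nat) : {set 'S_n} :=
  [set w : 'S_n | [forall i : 'I_p, forall k : 'I_n,
     (psum b i <= k < psum b i.+1)%N ==> (psum b i <= w k < psum b i.+1)%N]].

(* The pick is over elements d of minimal length in the coset
   {w \o d | w in young b} with d mu = nut; such an element is unique, and it
   exists when mu is a permutation of nut. *)
Definition d_min p (b : 'I_p -> nat) (T : eqType) (nut mu : n.-tuple T) : 'S_n :=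
  odflt 1%g [pick d : 'S_n | (pact d mu == nut) &&
    [forall w in young b, perm_len d <= perm_len (d * w)%g]%N].

End SymmetricGroup.

Section Counting.
Variables (I : choiceType) (P : zmodType) (alpha : I -> P).
Variables (h : I -> {additive P -> int}) (Lambda : P) (n : nat).

Definition Nw (w : 'S_n) (nu : n.-tuple I) (t : 'I_n) : int :=
  h (tnth nu t)
    (Lambda - \sum_(j < n | (j < t)%N && (w j < w t)%N) alpha (tnth nu j)).

Definition Nmu p (b : 'I_p -> nat) (nut mu : n.-tuple I) (k : 'I_n) : int :=
  Nw (d_min b nut mu) mu k
    + #|[set j : 'I_n | (j < k)%N && (tnth mu j == tnth mu k)]|%:Z.

End Counting.

Section QuiverHecke.
Variables (K : fieldType) (I : choiceType) (P : zmodType) (alpha : I -> P).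
Variables (Q : I -> I -> {poly {poly K}}) (n : nat) (beta : P).

Definition Iseq : choiceType :=
  {nu : n.-tuple I | \sum_(k < n) alpha (tnth nu k) == beta}.

Lemma pact_subproof (w : 'S_n) (nu : Iseq) :
  \sum_(k < n) alpha (tnth (pact w (val nu)) k) == beta.
Proof.
rewrite -[X in _ == X](eqP (valP nu)); apply/eqP.
rewrite [RHS](reindex_inj (@perm_inj _ w^-1%g)).
by apply: eq_bigr => k _; rewrite tnth_mktuple.
Qed.

Definition Iact (w : 'S_n) (nu : Iseq) : Iseq :=
  exist _ (pact w (val nu)) (pact_subproof w nu).

Let qgen : choiceType := ('I_n.-1 + 'I_n + Iseq)%type.

Definition free_qh : lalgType K := {malg K[{fmonom qgen}]}.

Definition fpsi (r : 'I_n.-1) : free_qh := << fmu (inl (inl r) : qgen) >>.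
Definition fx (k : 'I_n) : free_qh := << fmu (inl (inr k) : qgen) >>.
Definition fe (nu : Iseq) : free_qh := << fmu (inr nu : qgen) >>.

Local Notation "nu @ k" := (tnth (val nu) k) (at level 9).
Local Notation delta b := ((b : bool)%:R : free_qh).

(* qh_rel y z stands for the defining relation y = z.  In the unit relation,
   Iseq is finite as soon as alpha is linearly independent. *)
Inductive qh_rel : free_qh -> free_qh -> Prop :=
| qh_idem nu nu' : qh_rel (fe nu * fe nu') (delta (nu == nu') * fe nu)
| qh_unit : qh_rel (\sum_(nu \in [set: Iseq]) fe nu) 1
| qh_xe k nu : qh_rel (fx k * fe nu) (fe nu * fx k)
| qh_psie r nu : qh_rel (fpsi r * fe nu) (fe (Iact (sref r) nu) * fpsi r)
| qh_xx k l : qh_rel (fx k * fx l) (fx l * fx k)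
| qh_psix_hi r nu :
    qh_rel (fpsi r * fx (hi r) * fe nu)
           ((fx (lo r) * fpsi r + delta (nu @ (lo r) == nu @ (hi r))) * fe nu)
| qh_xpsi_hi r nu :
    qh_rel (fx (hi r) * fpsi r * fe nu)
           ((fpsi r * fx (lo r) + delta (nu @ (lo r) == nu @ (hi r))) * fe nu)
| qh_psix r k : k != lo r -> k != hi r ->
    qh_rel (fpsi r * fx k) (fx k * fpsi r)
| qh_psipsi (r s : 'I_n.-1) : (r.+1 < s)%N || (s.+1 < r)%N ->
    qh_rel (fpsi r * fpsi s) (fpsi s * fpsi r)
| qh_psi2 r nu :
    qh_rel (fpsi r ^+ 2 * fe nu)
           (eval2 (Q (nu @ (lo r)) (nu @ (hi r))) (fx (lo r)) (fx (hi r))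
              * fe nu)
| qh_braid (r r' : 'I_n.-1) nu : (r' = r.+1 :> nat)%N ->
    qh_rel ((fpsi r' * fpsi r * fpsi r' - fpsi r * fpsi r' * fpsi r) * fe nu)
           (delta (nu @ (lo r) == nu @ (hi r'))
              * divdiff (Q (nu @ (lo r)) (nu @ (hi r)))
                  (fx (lo r)) (fx (hi r)) (fx (hi r'))
              * fe nu).

Definition qhecke : Type :=
  ring_quot [set z : free_qh | exists y y', qh_rel y y' /\ z = y - y'].
HB.instance Definition _ := GRing.PzRing.on qhecke.

Definition qh_of : {rmorphism free_qh -> qhecke} :=
  @quo free_qh [set z : free_qh | exists y y', qh_rel y y' /\ z = y - y'].
Definition qh_scalar : {rmorphism K -> qhecke} := qh_of \o in_alg free_qh.

HB.instance Definition _ := GRing.Zmodule_isLmodule.Build K qhecke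
  (@scale_viaA _ _ qh_scalar) (@scale_via1 _ _ qh_scalar)
  (@scale_viaDr _ _ qh_scalar) (@scale_viaDl _ _ qh_scalar).

Variables (h : I -> {additive P -> int}) (Lambda : P).

(* For Lambda dominant, absz is the identity here; if n = 0 there is no k. *)
Definition cyc_gens : set qhecke :=
  [set z | exists (k : 'I_n) (nu : Iseq), k = 0%N :> nat /\
    z = qh_of (fx k) ^+ absz (h (nu @ k) Lambda) * qh_of (fe nu)].

Definition cqhecke : Type := ring_quot cyc_gens.
HB.instance Definition _ := GRing.PzRing.on cqhecke.

Definition cqh_of : {rmorphism qhecke -> cqhecke} := @quo qhecke cyc_gens.
Definition cqh_scalar : {rmorphism K -> cqhecke} := cqh_of \o qh_scalar.

HB.instance Definition _ := GRing.Zmodule_isLmodule.Build K cqhecke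
  (@scale_viaA _ _ cqh_scalar) (@scale_via1 _ _ cqh_scalar)
  (@scale_viaDr _ _ cqh_scalar) (@scale_viaDl _ _ cqh_scalar).

Definition cpsi (r : 'I_n.-1) : cqhecke := cqh_of (qh_of (fpsi r)).
Definition cx (k : 'I_n) : cqhecke := cqh_of (qh_of (fx k)).
Definition ce (nu : Iseq) : cqhecke := cqh_of (qh_of (fe nu)).

Definition corner (nu mu : Iseq) : set cqhecke :=
  [set ce nu * y * ce mu | y in [set: cqhecke]].

Definition cpsi_word (s : seq 'I_n.-1) : cqhecke := \prod_(r <- s) cpsi r.

End QuiverHecke.

Arguments ce {K I P alpha} Q {n beta} h Lambda nu.
Arguments corner {K I P alpha} Q {n beta} h Lambda nu mu.
Arguments cx {K I P} alpha Q {n} beta h Lambda k.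
Arguments cpsi_word {K I P} alpha Q {n} beta h Lambda s.

(* Main.v *)
Require Import Defs.
From HB Require Import structures.
From mathcomp Require Import all_boot all_order all_fingroup all_algebra.
From mathcomp Require Import finmap monalg.
From mathcomp Require Import boolp classical_sets functions cardinality fsbigop.
From mathcomp Require Import mpoly.
From mathcomp Require Import ring zify.

Set Implicit Arguments.
Unset Strict Implicit.
Unset Printing Implicit Defensive.

Import Order.TTheory GRing.Theory Num.Theory.

Local Open Scope classical_set_scope.
Local Open Scope ring_scope.

(** Let [nut] be the sorted sequence, [A] the cyclotomic algebra, [S] the ring of
    polynomials in [x_1, ..., x_n], and let the rank of a colour be the number of its
    block in [nut].

    If [w mu = nut], then all reduced words of [w] have the same product with [e(mu)].
    The correction term of the braid relation occurs only when the outer two of three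
    strands that cross pairwise have equal colours; these end in the same block of
    [nut], hence so does the middle one, and then the term is zero
    ([psi_word_reduced]). So the elements [psi_w e(mu)] are defined, and with
    coefficients in [S] on the right they span the corner [e(nut) A e(mu)]
    ([corner_span]). It remains to find the relations, that is, the ideals [W_mu] of
    the polynomials [f] with [e(nut) A f e(mu) = 0] ([annih]).

    The crossings make these ideals closed under three operations ([annih_divdiff1],
    [annih_up], [annih_down]). At two neighbouring equal colours, [W_mu] is stable
    under the divided difference; at two colours of increasing rank, the reflection
    maps [W_mu] to the ideal of the exchanged sequence; for decreasing rank this
    holds after multiplication by [Q]. Moving a strand to the right, one position at a
    time, one obtains from the cyclotomic relation at the first position an element of
    [W_mu] for every position [k]: the divided difference of
    [u^<Lambda, h> * prod_j Q(u, x_j)], the product over the [j < k] of smaller rank,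
    at the nodes [x_j] with [j < k] of the same colour and at [u = x_k] ([gen],
    [gen_in_family]). It is a polynomial in [x_1, ..., x_k] whose leading term in [x_k]
    is a nonzero scalar times [x_k^N(mu,k)] ([unit_lead_gen], [corner_degree]).

    Conversely, the sum of the rings [S] over all colour sequences is a right module
    over the quiver Hecke algebra, on which crossings act by divided differences and
    reflections ([act_rel]). Newton's interpolation shows that the ideals [genid]
    spanned by the above elements are closed under the same three operations, so they
    form a submodule, and the cyclotomic algebra acts on the quotient
    ([cqh_zero_act]). The longest [w] with [w mu = nut] maps a suitable monomial to a
    sign ([word_fam_test]), so a polynomial [f] with [psi_w f e(mu) = 0] lies in
    [genid]. Crossings of equal colours, multiplied on the left, push every relation
    between the [psi_w e(mu)] to this longest word ([annih_of_relation]). Hence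
    [W_mu = genid], and the corner is the direct sum of the [psi_w (S / genid) e(mu)].

    If all [N(mu,k)] are positive, division with remainder by the generators, from the
    last variable to the first, gives the monomials with exponents below [N(mu,k)] as
    a basis of [S / genid] ([normal_form], [genid_normal]). Otherwise consider the
    first position of a colour at which [N] is not positive: from one position of that
    colour to the next [N] drops by at most one, so it is zero there, the generator is
    a nonzero scalar, and the corner vanishes ([unit_gen], [corner_eq0]). *)

(** * Lengths and reduced words in the symmetric group *)

Section Length.
Variable n : nat.
Implicit Types (w : 'S_n) (r : 'I_n.-1) (s : seq 'I_n.-1).

Definition inversions w : {set 'I_n * 'I_n} :=
  [set q : 'I_n * 'I_n | (q.1 < q.2)%N && (w q.2 < w q.1)%N].

Definition descent w r := (w (hi r) < w (lo r))%N.

Lemma lo_hi_neq r : lo r != hi r.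
Proof. by rewrite -val_eqE /= neq_ltn ltnSn. Qed.

Lemma sref_lo r : sref r (lo r) = hi r. Proof. exact: tpermL. Qed.
Lemma sref_hi r : sref r (hi r) = lo r. Proof. exact: tpermR. Qed.
Lemma sref_neq r (k : 'I_n) : k != lo r -> k != hi r -> sref r k = k.
Proof. by move=> kl kh; rewrite /sref tpermD // eq_sym. Qed.
Lemma srefK r : involutive (sref r). Proof. exact: tpermK. Qed.
Lemma sref2 r : (sref r * sref r = 1)%g. Proof. exact: tperm2. Qed.
Lemma srefV r : ((sref r)^-1 = sref r)%g. Proof. exact: tpermV. Qed.

Lemma ord_eqP m (i j : 'I_m) : i = j <-> i = j :> nat.
Proof. by split=> [->|/val_inj]. Qed.

Lemma sref_lt r (i j : 'I_n) :
  (i < j)%N -> (i, j) != (lo r, hi r) -> (sref r i < sref r j)%N.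
Proof.
move=> ij; rewrite xpair_eqE negb_and.
by rewrite /sref; case: (tpermP (lo r) (hi r) i) ij => [->|->|/eqP il /eqP ih];
  case: (tpermP (lo r) (hi r) j) => [->|->|/eqP jl /eqP jh] //=;
  rewrite ?eqxx //=; move=> *; repeat match goal with
    H : is_true (_ != _) |- _ => move: H end; rewrite -!val_eqE /=; lia.
Qed.

Lemma sref_far (r s : 'I_n.-1) : (r.+1 < s)%N || (s.+1 < r)%N ->
  (sref r * sref s = sref s * sref r)%g.
Proof.
move=> far; have ne (a b : 'I_n) : (a != b :> nat) -> a != b by apply: contra => /eqP->.
have m1 : lo s != lo r by apply: ne => /=; lia.
have m2 : lo s != hi r by apply: ne => /=; lia.
have m3 : hi s != lo r by apply: ne => /=; lia.
have m4 : hi s != hi r by apply: ne => /=; lia.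
apply/permP => k; rewrite !permM.
have [->|k1] := eqVneq k (lo r).
  by rewrite (@sref_neq s (lo r)) ?sref_lo ?sref_neq // eq_sym.
have [->|k2] := eqVneq k (hi r).
  by rewrite (@sref_neq s (hi r)) ?sref_hi ?sref_neq // eq_sym.
rewrite (@sref_neq r k) //; have [->|k3] := eqVneq k (lo s).
  by rewrite sref_lo sref_neq.
have [->|k4] := eqVneq k (hi s); first by rewrite sref_hi sref_neq.
by rewrite !sref_neq.
Qed.

Section Adjacent.
Variables r s : 'I_n.-1.
Hypothesis sE : s = r.+1 :> nat.

Lemma hi_lo_adjacent : hi r = lo s. Proof. by apply/ord_eqP; rewrite /= sE. Qed.

Lemma sref_lo_adjacent : sref s (lo r) = lo r.
Proof. by apply: sref_neq; rewrite -val_eqE /= sE; lia. Qed.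

Lemma sref_hi_adjacent : sref r (hi s) = hi s.
Proof. by apply: sref_neq; rewrite -val_eqE /= sE; lia. Qed.

Lemma sref_braid : (sref r * (sref s * sref r) = sref s * (sref r * sref s))%g.
Proof.
have hl := hi_lo_adjacent; have s1 := sref_lo_adjacent; have s2 := sref_hi_adjacent.
apply/permP => k; rewrite !permM.
have [->|k1] := eqVneq k (lo r); first by rewrite s1 sref_lo hl sref_lo s2.
have [->|k2] := eqVneq k (hi r); first by rewrite sref_hi s1 sref_lo hl sref_lo s2 sref_hi.
have [->|k3] := eqVneq k (hi s); first by rewrite s2 sref_hi -hl sref_hi s1.
have k4 : k != lo s by rewrite -hl.
by rewrite !(sref_neq k1 k2, sref_neq k4 k3).
Qed.

End Adjacent.

Lemma descent_srefM w r : descent (sref r * w)%g r = ~~ descent w r.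
Proof.
rewrite /descent !permM sref_lo sref_hi -leqNgt [RHS]leq_eqVlt.
by rewrite (inj_eq (@ord_inj _)) (inj_eq perm_inj) (negPf (lo_hi_neq r)).
Qed.

(** Relabelling positions by [sref r] matches the inversions of the two
    permutations, apart from the pair of positions that [r] exchanges. *)
Lemma card_inversions_srefM w r : ~~ descent w r ->
  #|inversions (sref r * w)%g| = #|inversions w|.+1.
Proof.
move=> asc; rewrite (cardsD1 (lo r, hi r)) [in RHS](cardsD1 (lo r, hi r)).
have -> : (lo r, hi r) \in inversions (sref r * w)%g.
  by move: (descent_srefM w r); rewrite asc inE /= ltnSn.
have -> : (lo r, hi r) \in inversions w = false.
  by move: asc; rewrite inE /= ltnSn /= => /negPf.
rewrite add0n add1n; congr _.+1.
pose f (q : 'I_n * 'I_n) := (sref r q.1, sref r q.2).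
have fK : involutive f by case=> i j; rewrite /f /= !srefK.
rewrite -(card_imset _ (inv_inj fK)); apply: eq_card => -[i j].
apply/imsetP/idP => [[[k l] + ->]|ijP].
  rewrite !inE /= !permM => /andP[kl /andP[klt wlt]].
  rewrite sref_lt // wlt /f /= andbT xpair_eqE; apply/negP => /andP[/eqP e1 /eqP e2].
  move: klt; rewrite -[k](srefK r) -[l](srefK r) e1 e2 sref_lo sref_hi /=.
  by rewrite ltnNge ltnW.
exists (f (i, j)); last by rewrite fK.
move: ijP; rewrite !inE /= !permM !srefK => /andP[ij /andP[ilt wlt]].
rewrite sref_lt // wlt /f /= andbT xpair_eqE; apply/negP => /andP[/eqP e1 /eqP e2].
by move: ilt; rewrite -[i](srefK r) -[j](srefK r) e1 e2 sref_lo sref_hi /= ltnNge ltnW.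
Qed.

Lemma ascending_perm1 w : (forall r, ~~ descent w r) -> w = 1%g.
Proof.
move=> asc.
have mono (i j : 'I_n) : (i < j)%N -> (w i < w j)%N.
  have [m] := ubnP (j - i); elim: m j => // m IH j; rewrite ltnS => jm ij.
  have jn := ltn_ord j.
  have lt : (j.-1 < n.-1)%N by lia.
  have hE : hi (Ordinal lt) = j by apply/ord_eqP => /=; lia.
  have neq : lo (Ordinal lt) != j by rewrite -val_eqE /=; lia.
  have := asc (Ordinal lt); rewrite /descent hE -leqNgt leq_eqVlt.
  rewrite (inj_eq (@ord_inj _)) (inj_eq perm_inj) (negPf neq) /= => lt2.
  have [e|ne] := eqVneq (i : nat) j.-1.
    by have -> : i = lo (Ordinal lt) by apply/ord_eqP.
  by apply: ltn_trans lt2; apply: IH => /=; lia.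
have geq (u : 'S_n) : (forall i j : 'I_n, (i < j)%N -> (u i < u j)%N) ->
    forall i : 'I_n, (i <= u i)%N.
  move=> um [i]; elim: i => // i IH lt.
  have lt' : (i < n)%N by lia.
  by apply: leq_ltn_trans (IH lt') _; apply: um.
apply/permP => i; apply/val_inj/eqP; rewrite perm1 eqn_leq geq // andbT.
rewrite -{2}[i](permK w); apply: geq => a b ab.
rewrite ltnNge leq_eqVlt negb_or (inj_eq (@ord_inj _)) (inj_eq perm_inj) -val_eqE.
rewrite gtn_eqF //=; apply/negP => /mono; rewrite !permKV; lia.
Qed.

Lemma word_perm_rcons s r : word_perm (rcons s r) = (sref r * word_perm s)%g.
Proof. by rewrite /word_perm rev_rcons big_cons. Qed.

Lemma word_perm_consM r s : word_perm (r :: s) = (word_perm s * sref r)%g.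
Proof. by rewrite /word_perm rev_cons big_rcons. Qed.

Lemma word_perm_nil : word_perm [::] = 1%g :> 'S_n.
Proof. by rewrite /word_perm big_nil. Qed.

(** A permutation with a descent loses exactly one inversion when the descent is
    undone, and one without descents is the identity; so a word needs as many
    letters as there are inversions, and that many suffice. *)
Lemma perm_lenE w : perm_len w = #|inversions w|.
Proof.
rewrite /perm_len; case: ex_minnP => m /existsP[t /eqP tw] mmin.
apply/eqP; rewrite eqn_leq; apply/andP; split.
  apply: mmin; move: {2}#|_| (erefl #|inversions w|) => l.
  elim: l w {tw} => [|l IH] w lE.
    suff w1 : w = 1%g.
      by rewrite lE w1; apply/existsP; exists [tuple]; rewrite word_perm_nil.
    apply: ascending_perm1 => r; apply: contraT; rewrite negbK => dr.
    move/eqP: lE; rewrite cards_eq0 => /eqP/setP/(_ (lo r, hi r)).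
    by rewrite !inE /= ltnSn -/(descent w r) dr.
  have [r dr] : exists r, descent w r.
    apply: contrapT => /forallNP asc.
    have w1 : w = 1%g by apply: ascending_perm1 => r; apply/negP/asc.
    move: lE; rewrite w1 (_ : inversions 1%g = finset.set0) ?cards0 //.
    by apply/setP => -[i j]; rewrite !inE !perm1 /=; lia.
  have := card_inversions_srefM (w := (sref r * w)%g) (r := r).
  rewrite descent_srefM dr mulgA sref2 mul1g lE => /(_ erefl) [e].
  have := IH _ (esym e); rewrite -e => /existsP[u /eqP tE].
  apply/existsP; exists [tuple of rcons u r].
  by rewrite word_perm_rcons tE mulgA sref2 mul1g.
rewrite -(size_tuple t) -tw; elim/last_ind: (tval t) => [|s r IH].
  rewrite word_perm_nil (_ : inversions 1%g = finset.set0) ?cards0 //.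
  by apply/setP => -[i j]; rewrite !inE !perm1 /=; lia.
rewrite word_perm_rcons size_rcons.
have [dr|asc] := boolP (descent (word_perm s) r); last first.
  by rewrite card_inversions_srefM.
have := card_inversions_srefM (w := (sref r * word_perm s)%g) (r := r).
by rewrite descent_srefM dr mulgA sref2 mul1g => /(_ erefl); lia.
Qed.

Lemma perm_len_max w : (perm_len w <= n ^ 2)%N.
Proof.
rewrite perm_lenE; apply: leq_trans (max_card _) _.
by rewrite card_prod !card_ord mulnn.
Qed.

Lemma perm_len_asc w r : ~~ descent w r ->
  perm_len (sref r * w)%g = (perm_len w).+1.
Proof. by move=> asc; rewrite !perm_lenE card_inversions_srefM. Qed.

Lemma perm_len_desc w r : descent w r ->
  perm_len w = (perm_len (sref r * w)%g).+1.
Proof.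
move=> dr; have := @perm_len_asc (sref r * w)%g r.
by rewrite descent_srefM dr mulgA sref2 mul1g => ->.
Qed.

Lemma perm_lenV w : perm_len w^-1%g = perm_len w.
Proof.
rewrite !perm_lenE; pose f (q : 'I_n * 'I_n) := (w q.2, w q.1).
have fI : injective f by move=> [i j] [k l] [/perm_inj-> /perm_inj->].
rewrite -[RHS](card_imset _ fI); apply: eq_card => -[i j].
apply/idP/imsetP => [|[[k l]]].
  rewrite inE /= => /andP[ij lt]; exists ((w^-1)%g j, (w^-1)%g i).
    by rewrite inE /= !permKV lt.
  by rewrite /f /= !permKV.
by rewrite !inE /= => /andP[kl lt] [-> ->]; rewrite !permK kl lt.
Qed.

Lemma reduced_expr_rcons w s r : reduced_expr w (rcons s r) ->
  descent w r /\ reduced_expr (sref r * w)%g s.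
Proof.
rewrite /reduced_expr word_perm_rcons size_rcons => -[wE sz].
have sE : word_perm s = (sref r * w)%g by rewrite -wE mulgA sref2 mul1g.
have le : (perm_len (sref r * w)%g <= size s)%N.
  rewrite /perm_len; case: ex_minnP => m _; apply; apply/existsP.
  by exists (in_tuple s); rewrite sE.
have dr : descent w r.
  by apply: contraT => asc; move: le; rewrite perm_len_asc //; lia.
by split=> //; split=> //; move: (perm_len_desc dr); lia.
Qed.

Lemma reduced_expr_asc w s r : ~~ descent w r -> reduced_expr w s ->
  reduced_expr (sref r * w)%g (rcons s r).
Proof.
move=> asc [wE sz]; split; first by rewrite word_perm_rcons wE.
by rewrite size_rcons perm_len_asc // sz.
Qed.

Lemma reduced_expr_desc w s r : descent w r -> reduced_expr (sref r * w)%g s ->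
  reduced_expr w (rcons s r).
Proof.
move=> dr [wE sz]; split; last by rewrite size_rcons sz -perm_len_desc.
by rewrite word_perm_rcons wE mulgA sref2 mul1g.
Qed.

Lemma reduced_expr_exists w : exists s, reduced_expr w s.
Proof.
rewrite /reduced_expr /perm_len; case: ex_minnP => m /existsP[t /eqP tw] _.
by exists t; rewrite size_tuple.
Qed.

End Length.

(** * Polynomials and divided differences *)

Section Polynomials.
Variables (K : fieldType) (n : nat).
Local Notation S := (mpoly n K).
Implicit Types (f g : S) (r : 'I_n.-1).

Definition X (k : 'I_n) : S := mpolyX K (mnm1 k).

Lemma mpoly_gen_ind (Pr : S -> Prop) :
  (forall c, Pr (mpolyC n c)) -> (forall k, Pr (X k)) ->
  (forall f g, Pr f -> Pr g -> Pr (f + g)) ->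
  (forall f g, Pr f -> Pr g -> Pr (f * g)) -> forall f, Pr f.
Proof.
move=> PC PX PD PM f; elim/mpolyind: f => [|c m f _ _ Pf].
  by rewrite -(mpolyC0 n K); apply: PC.
apply: (PD) => //; rewrite -mul_mpolyC; apply: (PM); first exact: PC.
rewrite mpolyXE_id; apply: big_ind => [||i _]; first by rewrite -(mpolyC1 n K).
  exact: PM.
elim: (m i) => [|j IH]; first by rewrite expr0 -(mpolyC1 n K).
by rewrite exprS; apply: (PM) => //; apply: PX.
Qed.

Lemma mpoly_rmorph_ext (B : pzRingType) (u v : {rmorphism S -> B}) :
  (forall c, u (mpolyC n c) = v (mpolyC n c)) -> (forall k, u (X k) = v (X k)) ->
  u =1 v.
Proof.
move=> uvC uvX; elim/mpoly_gen_ind => // f g uf ug.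
  by rewrite !rmorphD /= uf ug.
by rewrite !rmorphM /= uf ug.
Qed.

Lemma X_inj : injective X.
Proof.
move=> i j /(congr1 (mcoeff (mnm1 j))); rewrite /X !mcoeffXU eqxx.
by case: eqP => // _ /eqP; rewrite eq_sym oner_eq0.
Qed.

Lemma msymC (w : 'S_n) (c : K) : msym w (mpolyC n c) = mpolyC n c.
Proof. by rewrite /msym mmapC. Qed.

Lemma msym_X (w : 'S_n) k : msym w (X k) = X (w k).
Proof. by rewrite /msym mmapX mmap1U. Qed.

Lemma msym_srefK r : involutive (msym (sref r) : S -> S).
Proof. by move=> f; rewrite -msymMm sref2 msym1m. Qed.

Definition root_diff r : S := X (lo r) - X (hi r).

Lemma root_diff_neq0 r : root_diff r != 0.
Proof. by rewrite subr_eq0 (inj_eq X_inj) lo_hi_neq. Qed.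

Lemma msym_root_diff r : msym (sref r) (root_diff r) = - root_diff r.
Proof. by rewrite /root_diff msymB !msym_X sref_lo sref_hi opprB. Qed.

Lemma divided_difference_exists r f :
  exists g, root_diff r * g = f - msym (sref r) f.
Proof.
elim/mpoly_gen_ind: f => [c|k|f g [f' fE] [g' gE]|f g [f' fE] [g' gE]].
- by exists 0; rewrite msymC mulr0 subrr.
- rewrite msym_X; have [->|kl] := eqVneq k (lo r).
    by exists 1; rewrite sref_lo mulr1.
  have [->|kh] := eqVneq k (hi r); last by exists 0; rewrite sref_neq // mulr0 subrr.
  by exists (-1); rewrite sref_hi mulrN1 opprB.
- by exists (f' + g'); rewrite mulrDr fE gE msymD; ring.
- exists (f' * g + msym (sref r) f * g').
  by rewrite mulrDr mulrA fE mulrCA gE msymM; ring.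
Qed.

(** The Demazure operator. *)
Definition divdiff1 r f : S := xget 0 [set g | root_diff r * g = f - msym (sref r) f].

Local Notation dd := divdiff1.

Lemma divdiff1P r f : root_diff r * dd r f = f - msym (sref r) f.
Proof.
rewrite /dd; case: xgetP => [g _ //|no].
by have [g /no] := divided_difference_exists r f.
Qed.

Lemma divdiff1_unique r f g : root_diff r * g = f - msym (sref r) f -> dd r f = g.
Proof. by rewrite -divdiff1P => /(mulfI (root_diff_neq0 r)). Qed.

Lemma divdiff1D r f g : dd r (f + g) = dd r f + dd r g.
Proof. by apply: divdiff1_unique; rewrite mulrDr !divdiff1P msymD; ring. Qed.

Lemma divdiff1N r f : dd r (- f) = - dd r f.
Proof. by apply: divdiff1_unique; rewrite mulrN divdiff1P msymN; ring. Qed.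

Lemma divdiff1M r f g : dd r (f * g) = dd r f * g + msym (sref r) f * dd r g.
Proof.
apply: divdiff1_unique.
by rewrite mulrDr mulrA divdiff1P mulrCA divdiff1P msymM; ring.
Qed.

Lemma divdiff1_sym r f : msym (sref r) f = f -> dd r f = 0.
Proof. by move=> fE; apply: divdiff1_unique; rewrite mulr0 fE subrr. Qed.

Lemma msym_divdiff1 r f : msym (sref r) (dd r f) = dd r f.
Proof.
apply: (mulfI (root_diff_neq0 r)); rewrite divdiff1P.
apply: oppr_inj; rewrite -mulNr -msym_root_diff -msymM divdiff1P msymB.
by rewrite msym_srefK opprB.
Qed.

Lemma divdiff1_msym r f : dd r (msym (sref r) f) = - dd r f.
Proof. by apply: divdiff1_unique; rewrite mulrN divdiff1P msym_srefK opprB. Qed.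

End Polynomials.

(** * Words in the crossings ending at a sorted sequence *)

Section Sequences.
Variables (I : choiceType) (P : zmodType) (alpha : I -> P) (n : nat) (beta : P).
Local Notation Iseq := (Iseq alpha n beta).
Implicit Types (ka : Iseq) (w : 'S_n).

Lemma tnth_Iact w ka k : tnth (val (Iact w ka)) (w k) = tnth (val ka) k.
Proof. by rewrite tnth_mktuple permK. Qed.

Lemma tnth_sref r ka k :
  tnth (val (Iact (sref r) ka)) k = tnth (val ka) (sref r k).
Proof. by rewrite tnth_mktuple srefV. Qed.

Lemma Iact_eqP w ka ka' :
  Iact w ka = ka' <-> forall k, tnth (val ka') (w k) = tnth (val ka) k.
Proof.
split=> [<- k|wk]; first exact: tnth_Iact.
by apply/val_inj/eq_from_tnth => k; rewrite -(permKV w k) tnth_Iact wk.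
Qed.

Lemma IactM w v ka : Iact w (Iact v ka) = Iact (v * w)%g ka.
Proof. by apply/esym/Iact_eqP => k; rewrite permM !tnth_Iact. Qed.

Lemma Iact1 ka : Iact 1%g ka = ka.
Proof. by apply/Iact_eqP => k; rewrite perm1. Qed.

Lemma Iact_srefK r ka : Iact (sref r) (Iact (sref r) ka) = ka.
Proof. by rewrite IactM sref2 Iact1. Qed.

Lemma Iact_srefM w r ka :
  Iact (sref r * w)%g (Iact (sref r) ka) = Iact w ka.
Proof. by rewrite IactM mulgA sref2 mul1g. Qed.

Lemma Iact_sref_id r ka :
  tnth (val ka) (lo r) = tnth (val ka) (hi r) -> Iact (sref r) ka = ka.
Proof.
move=> eq_ka; apply/Iact_eqP => k; rewrite /sref.
by case: tpermP => [->|->|].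
Qed.

End Sequences.

Section Crossings.
Variables (K : fieldType) (I : choiceType) (P : zmodType) (alpha : I -> P).
Variables (n : nat) (beta : P).
Local Notation Iseq := (Iseq alpha n beta).
Local Notation S := (mpoly n K).
Local Notation "ka @ k" := (tnth (val ka) k) (at level 9).
Variables (A : pzRingType) (ev : {rmorphism S -> A}).
Variables (e : Iseq -> A) (psi : 'I_n.-1 -> A) (Qp : 'I_n.-1 -> Iseq -> S).
Implicit Types (ka mu : Iseq) (w : 'S_n) (r s : 'I_n.-1) (f : S).

Definition psi_word (u : seq 'I_n.-1) : A := \prod_(r <- u) psi r.

(** The relations of the quiver Hecke algebra, in the form used below. The braid
    relation appears in the cases without correction term, which are the ones that
    occur in words ending at a sequence with contiguous colours. *)
Hypothesis e_orth : forall ka ka', e ka * e ka' = (ka == ka')%:R * e ka.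
Hypothesis ev_e : forall f ka, ev f * e ka = e ka * ev f.
Hypothesis psi_e : forall r ka, psi r * e ka = e (Iact (sref r) ka) * psi r.
Hypothesis ev_psi : forall f r ka,
  ev f * psi r * e ka = (psi r * ev (msym (sref r) f)
     - (ka @ (lo r) == ka @ (hi r))%:R * ev (divdiff1 r f)) * e ka.
Hypothesis psi_far : forall r s, (r.+1 < s)%N || (s.+1 < r)%N ->
  psi r * psi s = psi s * psi r.
Hypothesis psi_sq : forall r ka, psi r * psi r * e ka = ev (Qp r ka) * e ka.
Hypothesis Qp_eq0 : forall r ka, ka @ (lo r) = ka @ (hi r) -> Qp r ka = 0.
Hypothesis psi_braid : forall r s ka, (s = r.+1 :> nat)%N ->
  ka @ (lo r) != ka @ (hi s) \/ ka @ (lo r) = ka @ (hi r) ->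
  psi s * psi r * psi s * e ka = psi r * psi s * psi r * e ka.

Variable nut : Iseq.
Variable rk : I -> nat.
Hypothesis nut_sorted : forall i j : 'I_n,
  (i <= j)%N -> (rk (nut @ i) <= rk (nut @ j))%N.
Hypothesis rk_inj : forall i j : 'I_n,
  rk (nut @ i) = rk (nut @ j) -> nut @ i = nut @ j.

Lemma nut_convex (i j k : 'I_n) :
  (i <= j <= k)%N -> nut @ i = nut @ k -> nut @ j = nut @ i.
Proof.
move=> /andP[ij jk] ik; apply: rk_inj; apply/eqP.
by rewrite eqn_leq {1}ik !nut_sorted.
Qed.

Lemma psi_word_rcons u r ka :
  psi_word (rcons u r) * e ka = psi_word u * e (Iact (sref r) ka) * psi r.
Proof. by rewrite /psi_word big_rcons /= -!mulrA psi_e. Qed.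

(** Matsumoto's induction on the last letters of two reduced words.  A braid
    relation can only fail to be homogeneous when the outer two of three strands
    that all cross each other have the same colour; then these colours also agree
    at the top, where equal colours are contiguous, so the third strand has the
    same colour and the correction involves the zero polynomial. *)
Lemma psi_word_reduced w mu u v : Iact w mu = nut ->
  reduced_expr w u -> reduced_expr w v -> psi_word u * e mu = psi_word v * e mu.
Proof.
have [m] := ubnP (perm_len w); elim: m => // m IH in w mu u v *.
rewrite ltnS => len wmu.
case/lastP: u => [|u r] ru; case/lastP: v => [|v s] rv //.
- by case: ru rv => _ /= sz [_]; rewrite size_rcons -sz.
- by case: rv ru => _ /= sz [_]; rewrite size_rcons -sz.
wlog : r s u v ru rv / (r <= s)%N.
  by move=> wl; case: (leqP r s) => [|/ltnW] rs; [|apply/esym]; apply: wl.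
rewrite leq_eqVlt => /orP[/eqP/ord_inj rs|].
  rewrite -rs in rv *; have [dr ru'] := reduced_expr_rcons ru.
  have [_ rv'] := reduced_expr_rcons rv.
  rewrite !psi_word_rcons (IH (sref r * w)%g _ u v) ?Iact_srefM //.
  by have := perm_len_desc dr; lia.
move=> lt_rs.
have [dr ru'] := reduced_expr_rcons ru; have [ds rv'] := reduced_expr_rcons rv.
have lens t : descent w t -> (perm_len (sref t * w)%g < m)%N.
  by move=> /perm_len_desc; lia.
have ne (a b : 'I_n) : (a != b :> nat) -> a != b by apply: contra => /eqP->.
have [far|near] := boolP (r.+1 < s)%N.
  have srs : (sref s * (sref r * w) = sref r * (sref s * w))%g.
    by rewrite !mulgA sref_far // far orbT.
  have [z rz] := reduced_expr_exists (sref s * (sref r * w))%g.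
  have ds' : descent (sref r * w)%g s.
    rewrite /descent !permM !sref_neq //; apply: ne => /=; lia.
  have dr' : descent (sref s * w)%g r.
    rewrite /descent !permM !sref_neq //; apply: ne => /=; lia.
  rewrite !psi_word_rcons.
  rewrite (IH _ _ u (rcons z s) (lens _ dr)) ?Iact_srefM //; last first.
    exact: reduced_expr_desc.
  rewrite (IH _ _ v (rcons z r) (lens _ ds)) ?Iact_srefM //; last first.
    by apply: reduced_expr_desc => //; rewrite -srs.
  rewrite -!psi_word_rcons /psi_word !big_rcons /= -[_ * psi s * psi r]mulrA.
  by rewrite (@psi_far s r) ?mulrA // far orbT.
have {near lt_rs} sE : s = r.+1 :> nat by lia.
have hl : hi r = lo s by apply/ord_eqP; rewrite /= sE.
have n1 : lo r != hi s by apply: ne => /=; lia.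
have n2 : hi s != lo r by rewrite eq_sym.
have n3 : lo s != lo r by apply: ne => /=; lia.
have n4 : hi s != hi r by apply: ne => /=; lia.
have n5 : lo r != lo s by rewrite eq_sym.
have n6 : hi r != hi s by rewrite eq_sym.
have brd : (sref r * (sref s * (sref r * w)) = sref s * (sref r * (sref s * w)))%g.
  by rewrite !mulgA -(mulgA (sref r) (sref s)) (sref_braid sE) mulgA.
have wlt : (w (hi s) < w (lo s) < w (lo r))%N.
  by move: dr ds; rewrite /descent hl => -> ->.
have ds' : descent (sref r * w)%g s.
  rewrite /descent !permM -hl sref_hi (sref_neq n2 n4); case/andP: wlt; lia.
have dr' : descent (sref s * w)%g r.
  rewrite /descent !permM hl sref_lo (sref_neq n5 n1); case/andP: wlt; lia.
have dr'' : descent (sref s * (sref r * w))%g r.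
  rewrite /descent !permM hl sref_lo (sref_neq n5 n1) (sref_neq n2 n4) sref_lo hl.
  by case/andP: wlt.
have ds'' : descent (sref r * (sref s * w))%g s.
  rewrite /descent !permM -hl sref_hi (sref_neq n2 n4) (sref_neq n5 n1) sref_hi -hl.
  by rewrite hl; case/andP: wlt.
have [z rz] := reduced_expr_exists (sref r * (sref s * (sref r * w)))%g.
rewrite !psi_word_rcons.
rewrite (IH _ _ u (rcons (rcons z r) s) (lens _ dr)) ?Iact_srefM //; last first.
  by do 2!apply: reduced_expr_desc => //.
rewrite (IH _ _ v (rcons (rcons z s) r) (lens _ ds)) ?Iact_srefM //; last first.
  by do 2!apply: reduced_expr_desc => //; rewrite -brd.
rewrite -!psi_word_rcons /psi_word !big_rcons /= -!mulrA.
congr (_ * _); rewrite !mulrA; apply/esym/psi_braid => //.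
have [eq_mu|] := eqVneq (mu @ (lo r)) (mu @ (hi s)); [right|by left].
have nutw k : nut @ (w k) = mu @ k by rewrite -wmu tnth_Iact.
rewrite -!nutw in eq_mu *; rewrite hl.
rewrite (nut_convex (i := w (hi s)) (k := w (lo r)) (j := w (lo s))) //.
by case/andP: wlt => /ltnW-> /ltnW->.
Qed.

Definition rword w : seq 'I_n.-1 := projT1 (cid (reduced_expr_exists w)).

Lemma rwordP w : reduced_expr w (rword w).
Proof. by rewrite /rword; case: cid. Qed.

Definition Psi w : A := psi_word (rword w).

Lemma PsiE w mu u : Iact w mu = nut -> reduced_expr w u ->
  psi_word u * e mu = Psi w * e mu.
Proof. by move=> wmu ru; apply: psi_word_reduced (rwordP w). Qed.

Lemma psi_word_e u mu : psi_word u * e mu = e (Iact (word_perm u) mu) * psi_word u.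
Proof.
elim: u => [|r u IH].
  by rewrite /psi_word big_nil mul1r mulr1 word_perm_nil Iact1.
rewrite /psi_word big_cons -mulrA [X in _ * X]IH mulrA psi_e -mulrA.
by rewrite word_perm_consM -IactM.
Qed.

Lemma Psi_e w mu : Iact w mu = nut -> Psi w * e mu = e nut * Psi w.
Proof. by move=> <-; rewrite /Psi psi_word_e; case: (rwordP w) => ->. Qed.

Lemma Psi1 mu : Psi 1%g * e mu = e mu.
Proof.
have [_] := rwordP 1%g; rewrite perm_lenE (_ : inversions _ = finset.set0).
  by rewrite cards0 => /size0nil e1; rewrite /Psi e1 /psi_word big_nil mul1r.
by apply/setP => -[i j]; rewrite !inE !perm1 /=; lia.
Qed.

Lemma Psi_asc w r mu : Iact w mu = nut -> ~~ descent w r ->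
  Psi w * psi r * e (Iact (sref r) mu)
  = Psi (sref r * w)%g * e (Iact (sref r) mu).
Proof.
move=> wmu asc; rewrite -(@PsiE _ _ (rcons (rword w) r)) ?Iact_srefM //.
  by rewrite /psi_word big_rcons.
by apply: reduced_expr_asc => //; apply: rwordP.
Qed.

Lemma Psi_desc w r mu : Iact w mu = nut -> descent w r ->
  Psi w * e mu = Psi (sref r * w)%g * psi r * e mu.
Proof.
move=> wmu dr; have := @Psi_asc (sref r * w)%g r (Iact (sref r) mu).
rewrite Iact_srefM Iact_srefK mulgA sref2 mul1g => -> //.
by rewrite descent_srefM dr.
Qed.

(** ** The corner is spanned by the words of minimal length *)

Lemma e_psi r ka : e ka * psi r = psi r * e (Iact (sref r) ka).
Proof. by rewrite psi_e Iact_srefK. Qed.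

(** The span of the normal words that end at [nut], over all sequences at the
    bottom, so that it is stable under right multiplication by the generators. *)
Inductive nut_span : A -> Prop :=
| nut_span0 : nut_span 0
| nut_spanD y z : nut_span y -> nut_span z -> nut_span (y + z)
| nut_spanP w f ka : Iact w ka = nut -> nut_span (Psi w * ev f * e ka).

Lemma Psi_psi w r ka : Iact w ka = nut -> exists w' g,
  Iact w' (Iact (sref r) ka) = nut /\
  Psi w * psi r * e (Iact (sref r) ka) = Psi w' * ev g * e (Iact (sref r) ka).
Proof.
move=> wka; exists (sref r * w)%g.
have [dr|asc] := boolP (descent w r); last first.
  by exists 1; rewrite Iact_srefM rmorph1 mulr1 Psi_asc.
exists (Qp r (Iact (sref r) ka)); rewrite Iact_srefM; split=> //.
rewrite -[LHS]mulrA -e_psi mulrA (Psi_desc wka dr) -!mulrA e_psi -psi_sq.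
by rewrite !mulrA.
Qed.

Lemma nut_span_ev z f : nut_span z -> nut_span (z * ev f).
Proof.
elim=> [|x y _ Px _ Py|w g ka wka]; first by rewrite mul0r; apply: nut_span0.
  by rewrite mulrDl; apply: nut_spanD.
by rewrite -mulrA -ev_e mulrA -(mulrA (Psi w)) -rmorphM; apply: nut_spanP.
Qed.

Lemma nut_span_e z ka : nut_span z -> nut_span (z * e ka).
Proof.
elim=> [|x y _ Px _ Py|w g ka' wka]; first by rewrite mul0r; apply: nut_span0.
  by rewrite mulrDl; apply: nut_spanD.
rewrite -mulrA e_orth; case: eqP => _; first by rewrite mul1r; apply: nut_spanP.
by rewrite mul0r mulr0; apply: nut_span0.
Qed.

Lemma nut_span_psi z r : nut_span z -> nut_span (z * psi r).
Proof.
elim=> [|x y _ Px _ Py|w f ka wka]; first by rewrite mul0r; apply: nut_span0.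
  by rewrite mulrDl; apply: nut_spanD.
set ka' := Iact (sref r) ka.
have -> : Psi w * ev f * e ka * psi r =
    Psi w * psi r * e ka' * ev (msym (sref r) f)
    - (ka' @ (lo r) == ka' @ (hi r))%:R * (Psi w * ev (divdiff1 r f) * e ka').
  rewrite -mulrA e_psi -mulrA (mulrA (ev f)) ev_psi mulrBl mulrBr.
  by rewrite -!mulrA ev_e; case: (_ == _); rewrite ?mul1r ?mul0r ?mulr0.
apply: nut_spanD.
  have [w' [g [w'ka ->]]] := Psi_psi r wka.
  by apply: nut_span_ev; apply: nut_spanP.
case: eqP => [eq_ka|_]; last by rewrite mul0r oppr0; apply: nut_span0.
rewrite mul1r -mulNr -mulrN -rmorphN; apply: nut_spanP.
by rewrite -wka -[in RHS](Iact_srefK r ka) -/ka' (Iact_sref_id eq_ka).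
Qed.

Hypothesis A_ind : forall T : A -> Prop, T 1 ->
  (forall y z, T y -> T z -> T (y + z)) ->
  (forall z f, T z -> T (z * ev f)) -> (forall z r, T z -> T (z * psi r)) ->
  (forall z ka, T z -> T (z * e ka)) -> forall z, T z.

Lemma nut_span_top z : nut_span (e nut * z).
Proof.
elim/A_ind: z => [|y z Ty Tz|z f Tz|z r Tz|z ka Tz].
- rewrite mulr1 -Psi1 -[Psi _]mulr1 -(rmorph1 ev); apply: nut_spanP.
  exact: Iact1.
- by rewrite mulrDr; apply: nut_spanD.
- by rewrite mulrA; apply: nut_span_ev.
- by rewrite mulrA; apply: nut_span_psi.
- by rewrite mulrA; apply: nut_span_e.
Qed.

Lemma corner_span mu z : exists p : 'S_n -> S,
  e nut * z * e mu = \sum_(w | Iact w mu == nut) Psi w * ev (p w) * e mu.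
Proof.
elim: (nut_span_top z) => [|x y _ [p pE] _ [q qE]|w f ka wka].
- exists (fun=> 0); rewrite mul0r big1 // => w _.
  by rewrite rmorph0 mulr0 mul0r.
- exists (fun w => p w + q w); rewrite mulrDl pE qE -big_split /=.
  by apply: eq_bigr => w _; rewrite rmorphD mulrDr mulrDl.
rewrite -mulrA e_orth; have [eq_ka|_] := eqVneq ka mu; last first.
  exists (fun=> 0); rewrite mul0r mulr0 big1 // => w' _.
  by rewrite rmorph0 mulr0 mul0r.
exists (fun w' => if w' == w then f else 0).
rewrite (bigD1 w) ?big1 /=; last by rewrite -eq_ka wka.
  by rewrite eqxx addr0 mul1r eq_ka.
by move=> w' /andP[_ /negPf->]; rewrite rmorph0 mulr0 mul0r.
Qed.

(** ** The annihilator of the corner *)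

(** As polynomials commute with the idempotents, this is the annihilator of the
    corner for the right action of the polynomials. *)
Definition annih mu f := forall z, e nut * z * (ev f * e mu) = 0.

Lemma e_id ka : e ka * e ka = e ka.
Proof. by rewrite e_orth eqxx mul1r. Qed.

Lemma ev_comm f g (y z : A) : y * ev f * ev g * z = y * ev g * ev f * z.
Proof. by rewrite -!(mulrA y) -!rmorphM mulrC. Qed.

Lemma annihP mu f :
  annih mu f <-> forall w, Iact w mu = nut -> Psi w * ev f * e mu = 0.
Proof.
split=> [Wf w wmu|Wf z].
  have := Wf (Psi w); rewrite -(Psi_e wmu) -mulrA ev_e (mulrA (e mu)) e_id.
  by rewrite -ev_e mulrA.
have [p pE] := corner_span mu z.
rewrite ev_e mulrA pE mulr_suml big1 // => w /eqP wmu.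
by rewrite -mulrA -ev_e mulrA ev_comm -mulrA ev_e mulrA Wf // mul0r.
Qed.

Lemma annihD mu f g : annih mu f -> annih mu g -> annih mu (f + g).
Proof. by move=> Wf Wg z; rewrite rmorphD mulrDl mulrDr Wf Wg addr0. Qed.

Lemma annihM mu f g : annih mu g -> annih mu (f * g).
Proof.
by move=> Wg z; rewrite rmorphM -(mulrA (ev f)) mulrA -(mulrA (e nut)) Wg.
Qed.

(** If [g] denotes the divided difference of [f], then multiplying the relations
    satisfied by [f] and by its reflection by the crossing gives [y g = - y D g psi]
    for every [y] of the corner, where [D] is the difference of the two variables.
    As the crossing squares to zero, [y g psi = 0] for all [y], hence [y g = 0]. *)
Lemma annih_divdiff1 r mu f :
  mu @ (lo r) = mu @ (hi r) -> annih mu f -> annih mu (divdiff1 r f).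
Proof.
move=> eq_mu Wf; set g := divdiff1 r f; have [D DE] : exists D, D = root_diff K r by eexists.
have rmu := Iact_sref_id eq_mu.
have ee : e mu * psi r = psi r * e mu by rewrite e_psi rmu.
have psi0 : psi r * psi r * e mu = 0 by rewrite psi_sq Qp_eq0 // rmorph0 mul0r.
have evpsi h : ev h * psi r * e mu
    = psi r * ev (msym (sref r) h) * e mu - ev (divdiff1 r h) * e mu.
  by rewrite ev_psi eq_mu eqxx mul1r mulrBl.
have gpsi : ev g * psi r * e mu = psi r * ev g * e mu.
  have sg : msym (sref r) g = g by apply: msym_divdiff1.
  by rewrite evpsi sg (divdiff1_sym sg) rmorph0 mul0r subr0.
have key z : e nut * z * (ev g * e mu)
    = - (e nut * z * ev D * (ev g * psi r * e mu)).
  have := evpsi (msym (sref r) f); rewrite msym_srefK divdiff1_msym rmorphN mulNr opprK.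
  move/(congr1 ( *%R (e nut * z))); rewrite mulrDr -(mulrA (psi r)).
  rewrite (mulrA (e nut * z) (psi r)) -(mulrA (e nut) z (psi r)) Wf add0r => <-.
  have -> : msym (sref r) f = f - D * g by rewrite DE divdiff1P; ring.
  rewrite rmorphB !mulrBl mulrBr. rewrite rmorphM !mulrA.
  suff -> : e nut * z * ev f * psi r * e mu = 0 by rewrite sub0r.
  by rewrite -(mulrA _ (psi r)) -ee !mulrA -(mulrA _ (ev f) (e mu)) Wf mul0r.
have gpsi0 z : e nut * z * (ev g * psi r * e mu) = 0.
  rewrite -(mulrA (ev g)) -ee (mulrA (ev g)) (mulrA (e nut * z)) key mulNr.
  by rewrite -!mulrA ee (mulrA (psi r)) psi0 !mulr0 oppr0.
by move=> z; rewrite key -(mulrA (e nut)) gpsi0 oppr0.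
Qed.

(** In this order a word ending at the exchanged sequence factors through the
    crossing, and polynomials pass that crossing by the reflection. *)
Lemma annih_up r mu f : (rk (mu @ (lo r)) < rk (mu @ (hi r)))%N ->
  annih mu f -> annih (Iact (sref r) mu) (msym (sref r) f).
Proof.
move=> lt_mu /annihP Wf; apply/annihP => w wmu.
have ne_mu : mu @ (lo r) == mu @ (hi r) = false.
  by apply/negbTE/eqP => eq_mu; rewrite eq_mu ltnn in lt_mu.
have dr : descent w r.
  rewrite /descent ltnNge; apply/negP => /nut_sorted.
  by rewrite -wmu !tnth_Iact !tnth_sref sref_lo sref_hi leqNgt lt_mu.
rewrite -mulrA ev_e mulrA (Psi_desc wmu dr) -!mulrA -ev_e (mulrA (psi r)).
have -> : psi r * ev (msym (sref r) f) * e (Iact (sref r) mu)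
    = ev f * e mu * psi r.
  rewrite -(mulrA (ev f)) e_psi mulrA ev_psi !tnth_sref sref_lo sref_hi eq_sym ne_mu.
  by rewrite mul0r subr0.
rewrite !mulrA Wf ?mul0r // -wmu.
by rewrite -{1}(Iact_srefK r mu) Iact_srefM.
Qed.

(** The factor [Qp] is a double crossing, and one of the two crossings turns the
    reflected polynomial back into [f]. *)
Lemma annih_down r mu f : mu @ (lo r) != mu @ (hi r) -> annih mu f ->
  annih (Iact (sref r) mu) (Qp r (Iact (sref r) mu) * msym (sref r) f).
Proof.
move=> /negPf ne_mu Wf z; rewrite mulrC rmorphM -(mulrA (ev _)) -psi_sq.
have E : ev (msym (sref r) f) * psi r * e mu = psi r * ev f * e mu.
  by rewrite ev_psi msym_srefK ne_mu mul0r subr0.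
rewrite -(mulrA (psi r)) psi_e Iact_srefK (mulrA (psi r)) (mulrA (ev _)).
rewrite (mulrA (ev _)) E !mulrA -(mulrA (e nut)).
by rewrite -(mulrA _ (ev f) (e mu)) Wf mul0r.
Qed.

(** ** Independence reduces to the longest word *)

(** The strands of each colour cross pairwise; this determines the longest
    permutation with the given effect on the colours. *)
Definition top_perm w :=
  forall t, nut @ (lo t) = nut @ (hi t) -> descent w^-1%g t.

Lemma Psi_left t w mu : Iact w mu = nut -> nut @ (lo t) = nut @ (hi t) ->
  psi t * Psi w * e mu
  = (~~ descent w^-1%g t)%:R * Psi (w * sref t)%g * e mu.
Proof.
move=> wmu eqt; have tnut := Iact_sref_id eqt.
have wtmu : Iact (w * sref t)%g mu = nut by rewrite -IactM wmu.
have asc v : Iact v mu = nut -> ~~ descent v^-1%g t ->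
    psi t * Psi v * e mu = Psi (v * sref t)%g * e mu.
  move=> vmu asc; rewrite -(@PsiE _ _ (t :: rword v)) -?IactM ?vmu //.
    by rewrite /psi_word big_cons.
  have [vE sz] := rwordP v; split; first by rewrite word_perm_consM vE.
  by rewrite /= sz -(perm_lenV (v * _)%g) invMg srefV perm_len_asc // perm_lenV.
have [dt|nt] := boolP (descent w^-1%g t); last by rewrite mul1r asc.
rewrite !mul0r -{1}[w]mulg1 -(sref2 t) mulgA -mulrA.
rewrite -asc // ?invMg ?srefV ?descent_srefM ?dt //.
by rewrite -mulrA Psi_e // !mulrA psi_sq Qp_eq0 // rmorph0 !mul0r.
Qed.

(** Equal colours are contiguous in [nut], so it is enough to compare neighbours. *)
Lemma block_mono (R : rel nat) (g : 'I_n -> nat) : transitive R ->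
  (forall t, nut @ (lo t) = nut @ (hi t) -> R (g (lo t)) (g (hi t))) ->
  forall i j : 'I_n, (i < j)%N -> nut @ i = nut @ j -> R (g i) (g j).
Proof.
move=> trR step i j; have [m] := ubnP (j - i).
elim: m j => // m IH j; rewrite ltnS => jm ij eq_ij.
have lt : (j.-1 < n.-1)%N by have := ltn_ord j; lia.
have hE : hi (Ordinal lt) = j by apply/ord_eqP => /=; lia.
have eq_lo : nut @ (lo (Ordinal lt)) = nut @ i.
  by apply: (@nut_convex i _ j) => //=; apply/andP; split; lia.
have := step (Ordinal lt); rewrite hE eq_lo -eq_ij => /(_ erefl) Rj.
have [eq_i|ne] := eqVneq (i : nat) j.-1.
  by have -> : i = lo (Ordinal lt) by apply/ord_eqP.
by apply: trR Rj; apply: IH => //=; lia.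
Qed.

Lemma card_perm_lt w (k : 'I_n) : #|[set j : 'I_n | (w j < k)%N]%SET| = k.
Proof.
have -> : [set j : 'I_n | (w j < k)%N]%SET = (w^-1)%g @: [set i : 'I_n | (i < k)%N]%SET.
  apply/setP => j; rewrite inE; apply/idP/imsetP => [wj|[i + ->]].
    by exists (w j); rewrite ?inE ?permK.
  by rewrite inE permKV.
rewrite card_imset; last exact: perm_inj.
rewrite -sum1_card (eq_bigl (fun i : 'I_n => (i < k)%N)) => [|i]; last by rewrite inE.
by rewrite (big_ord_narrow (ltnW (ltn_ord k))) sum1_card card_ord.
Qed.

Lemma top_perm_lt w mu j k : Iact w mu = nut -> top_perm w ->
  (w j < w k)%N = (rk (mu @ j) < rk (mu @ k))%N || (mu @ j == mu @ k) && (k < j)%N.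
Proof.
move=> wmu top.
have nutw i : nut @ (w i) = mu @ i by rewrite -wmu tnth_Iact.
have anti (a b : 'I_n) : (a < b)%N -> nut @ a = nut @ b ->
    ((w^-1)%g b < (w^-1)%g a)%N.
  apply: (@block_mono (fun x y => y < x)%N (fun a => (w^-1)%g a)) => // a' b' c' lt1 lt2.
  exact: ltn_trans lt2 lt1.
have [lt|le] := ltnP (w j) (w k).
  have := nut_sorted (ltnW lt); rewrite !nutw leq_eqVlt => /orP[/eqP eq_rk|->//].
  have eq_mu : mu @ j = mu @ k by rewrite -!nutw; apply: rk_inj; rewrite !nutw.
  by have := anti _ _ lt; rewrite !nutw !permK eq_mu eqxx ltnn => /(_ erefl) ->.
apply/esym/negbTE; rewrite negb_or -leqNgt negb_and -!nutw nut_sorted //=.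
rewrite -implybE; apply/implyP => /eqP eq_nut; move: le; rewrite leq_eqVlt.
case/orP => [/eqP/ord_inj/perm_inj->|lt]; first by rewrite ltnn.
by have := anti _ _ lt (esym eq_nut); rewrite !permK -leqNgt => /ltnW.
Qed.

Lemma top_perm_unique w v mu : Iact w mu = nut -> Iact v mu = nut ->
  top_perm w -> top_perm v -> w = v.
Proof.
move=> wmu vmu topw topv; apply/permP => k; apply/val_inj => /=.
rewrite -[LHS](card_perm_lt w) -[RHS](card_perm_lt v).
by apply: eq_card => j; rewrite !inE (top_perm_lt _ _ wmu) // (top_perm_lt _ _ vmu).
Qed.

Lemma top_perm_max w v mu : Iact w mu = nut -> top_perm w -> Iact v mu = nut ->
  v != w -> (perm_len v < perm_len w)%N.
Proof.
move=> wmu topw; have [m] := ubnP (n ^ 2 - perm_len v)%N.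
elim: m v => // m IH v len vmu vw.
have [topv|] := pselect (top_perm v).
  by rewrite (top_perm_unique vmu wmu topv topw) eqxx in vw.
move=> /existsNP[t /not_implyP[eqt /negP asc]].
have lenS : perm_len (v * sref t)%g = (perm_len v).+1.
  by rewrite -perm_lenV invMg srefV perm_len_asc // perm_lenV.
have bound := @perm_len_max n.
have [<-|ne] := eqVneq (v * sref t)%g w; first by rewrite lenS.
rewrite -ltnS -lenS ltnS ltnW // IH // -?IactM ?vmu ?Iact_sref_id //.
by have := bound (v * sref t)%g; move: len; rewrite lenS; lia.
Qed.

(** A relation between the words is pushed up to the longest word: multiplying it on
    the left by the crossing of two equal colours lengthens or kills each word. The
    coefficients are treated in order of increasing length, so that for the longest
    word no other term is left. *)
Lemma annih_of_relation mu :
  (forall w f, Iact w mu = nut -> top_perm w -> Psi w * ev f * e mu = 0 ->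
     annih mu f) ->
  forall p : 'S_n -> S,
  \sum_(w | Iact w mu == nut) Psi w * ev (p w) * e mu = 0 ->
  forall w, Iact w mu = nut -> annih mu (p w).
Proof.
move=> annih_top.
suff claim m (p : 'S_n -> S) :
    \sum_(w | Iact w mu == nut) Psi w * ev (p w) * e mu = 0 ->
    (forall w, Iact w mu = nut -> (m <= n ^ 2 - perm_len w)%N -> annih mu (p w)) ->
    forall w, Iact w mu = nut -> annih mu (p w).
  move=> p rel w wmu; apply: (claim (n ^ 2).+1 p) => // v _; lia.
elim: m p => [|m IH] p rel short w wmu; first exact: short.
apply: (IH p) => // {w wmu} w wmu; rewrite leq_eqVlt => /orP[/eqP lenw|]; last first.
  exact: short.
have bound := @perm_len_max n.
have [topw|] := pselect (top_perm w).
  apply: (annih_top w) => //; move: rel; rewrite (bigD1 w) /=; last exact/eqP.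
  rewrite big1 ?addr0 // => v /andP[/eqP vmu vw].
  have lt := top_perm_max wmu topw vmu vw.
  suff /annihP -> : annih mu (p v) by [].
  by apply: short => //; have := bound w; lia.
move=> /existsNP[t /not_implyP[eqt /negP asc]].
pose p' v := if descent v^-1%g t then p (v * sref t)%g else 0.
have tmu v : Iact (v * sref t)%g mu = nut <-> Iact v mu = nut.
  rewrite -IactM; split=> [|->]; last exact: Iact_sref_id.
  by move/(congr1 (Iact (sref t))); rewrite Iact_srefK Iact_sref_id.
have wE : (w * sref t * sref t = w)%g by rewrite -mulgA sref2 mulg1.
suff : annih mu (p' (w * sref t)%g).
  by rewrite /p' invMg srefV descent_srefM asc wE.
apply: (IH p'); last exact/tmu.
  have := congr1 ( *%R (psi t)) rel; rewrite mulr0 mulr_sumr => {2}<-.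
  rewrite (reindex_inj (mulIg (sref t))) /=.
  apply: eq_big => [v|v /eqP vmu]; first by apply/eqP/eqP => /tmu.
  have {}vmu := (tmu v).1 vmu.
  rewrite -[Psi v * _ * _]mulrA ev_e !mulrA Psi_left //.
  rewrite /p' invMg srefV descent_srefM.
  case: (descent v^-1%g t); first by rewrite rmorph0 mulr0 !mul0r.
  by rewrite -mulgA sref2 mulg1 mul1r -!mulrA ev_e.
move=> v vmu lenv; rewrite /p'; case: ifP => [dv|_].
  apply: short; first exact/tmu.
  have lenS : perm_len v = (perm_len (v * sref t)%g).+1.
    by rewrite -perm_lenV (perm_len_desc dv) -(perm_lenV (v * _)%g) invMg srefV.
  by rewrite -subnSK -lenS // ltnS.
by move=> z; rewrite rmorph0 mul0r mulr0.
Qed.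

End Crossings.

(** * Division by monic polynomials modulo an ideal *)

Section MonicDivision.
Variable R : comNzRingType.
Implicit Types (p q d : {poly R}) (J : R -> Prop).

Import Pdiv.CommonRing Pdiv.RingMonic.

Lemma rdivpD d p q : d \is monic -> rdivp (p + q) d = rdivp p d + rdivp q d.
Proof.
move=> md; rewrite {1}(rdivp_eq md p) {1}(rdivp_eq md q) addrACA -mulrDl.
apply: rdivp_addl_mul_small => //; apply: leq_ltn_trans (size_polyD _ _) _.
by rewrite gtn_max !ltn_rmodpN0 ?monic_neq0.
Qed.

Lemma rdivpZ d c p : d \is monic -> rdivp (c *: p) d = c *: rdivp p d.
Proof.
move=> md; rewrite {1}(rdivp_eq md p) scalerDr scalerAl.
apply: rdivp_addl_mul_small => //; apply: leq_ltn_trans (size_scale_leq _ _) _.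
by rewrite ltn_rmodpN0 ?monic_neq0.
Qed.

Lemma rdivp_sum d (T : Type) (s : seq T) (F : T -> {poly R}) : d \is monic ->
  rdivp (\sum_(i <- s) F i) d = \sum_(i <- s) rdivp (F i) d.
Proof.
move=> md; elim: s => [|i s IH]; first by rewrite !big_nil rdiv0p.
by rewrite !big_cons rdivpD // IH.
Qed.

Lemma map_rdivp (R' : comNzRingType) (u : {rmorphism R -> R'}) d p :
  d \is monic -> map_poly u (rdivp p d) = rdivp (map_poly u p) (map_poly u d).
Proof.
move=> md; have sz : size (map_poly u d) = size d.
  by rewrite size_map_poly_id0 // (monicP md) rmorph1 oner_neq0.
rewrite [in RHS](rdivp_eq md p) rmorphD rmorphM /=.
rewrite rdivp_addl_mul_small ?monic_map // sz.
by apply: leq_ltn_trans (size_poly _ _) _; rewrite ltn_rmodpN0 ?monic_neq0.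
Qed.

Definition is_ideal J : Prop :=
  [/\ J 0, forall f g, J f -> J g -> J (f + g) & forall f g, J g -> J (f * g)].

Definition coef_in J p := forall i, J p`_i.

Section ModuloIdeal.
Variable J : R -> Prop.
Hypothesis idJ : is_ideal J.

Let J0 : J 0. Proof. by case: idJ. Qed.
Let JD f g : J f -> J g -> J (f + g). Proof. by case: idJ => _ + _; apply. Qed.
Let JM f g : J g -> J (f * g). Proof. by case: idJ => _ _; apply. Qed.

Lemma is_ideal_sum (T : Type) (s : seq T) (Pr : pred T) (F : T -> R) :
  (forall i, Pr i -> J (F i)) -> J (\sum_(i <- s | Pr i) F i).
Proof. by move=> JF; apply: big_ind. Qed.

Lemma coef_inD p q : coef_in J p -> coef_in J q -> coef_in J (p + q).
Proof. by move=> Jp Jq i; rewrite coefD; apply: JD. Qed.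

Lemma coef_inM p q : coef_in J q -> coef_in J (p * q).
Proof. by move=> Jq i; rewrite coefM; apply: is_ideal_sum => j _; apply: JM. Qed.

Lemma coef_in_horner p x : coef_in J p -> J p.[x].
Proof.
by move=> Jp; rewrite horner_coef; apply: is_ideal_sum => i _; rewrite mulrC; apply: JM.
Qed.

Lemma coef_in_rdivp d p : d \is monic -> coef_in J p -> coef_in J (rdivp p d).
Proof.
move=> md Jp i; rewrite -[p]coefK poly_def rdivp_sum // coef_sum.
by apply: is_ideal_sum => j _; rewrite rdivpZ // coefZ mulrC; apply: JM.
Qed.

(** Divisibility by [d] over the quotient ring by [J], written as an equation so
    that [J] may be the whole ring. *)
Definition dvd_mod d p := exists q r, coef_in J r /\ p = q * d + r.

Lemma dvd_mod1 p : dvd_mod 1 p.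
Proof. by exists p, 0; rewrite mulr1 addr0; split=> // i; rewrite coef0. Qed.

Lemma dvd_modM d p q : dvd_mod d p -> dvd_mod d (p * q).
Proof.
move=> [a [r [Jr ->]]]; exists (a * q), (q * r); split; first exact: coef_inM.
by rewrite mulrDl mulrAC (mulrC r).
Qed.

(** Newton's interpolation step: [(rdivp p d).[x]] is the divided difference
    of [p] at the roots of [d] and at [x]. *)
Lemma dvd_mod_horner d p x : d \is monic -> dvd_mod (d * ('X - x%:P)) p ->
  J (rdivp p d).[x].
Proof.
move=> md [a [r [Jr ->]]]; rewrite (mulrC d) mulrA rdivp_addl_mul //.
rewrite hornerD hornerM hornerXsubC subrr mulr0 add0r.
exact/coef_in_horner/coef_in_rdivp.
Qed.

Lemma dvd_mod_rmodp d p : d \is monic -> dvd_mod d p -> coef_in J (rmodp p d).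
Proof.
move=> md [a [r [Jr pE]]].
have dE : rdivp p d = a + rdivp r d by rewrite pE rdivp_addl_mul.
have -> : rmodp p d = r + (- d) * rdivp r d.
  by apply: (addrI (rdivp p d * d)); rewrite -rdivp_eq // dE {1}pE; ring.
by apply: coef_inD => //; apply: coef_inM; apply: coef_in_rdivp.
Qed.

(** Converse step of the interpolation: if the divided difference at one more
    point vanishes modulo [J], then that point is a further root modulo [J]. *)
Lemma dvd_mod_next d p x : d \is monic -> dvd_mod d p -> J (rdivp p d).[x] ->
  dvd_mod (d * ('X - x%:P)) p.
Proof.
move=> md dp Jx; set g := rdivp p d in Jx *.
have : rdvdp ('X - x%:P) (g - g.[x]%:P).
  by rewrite Pdiv.Ring.rdvdp_XsubCl; apply/rootP; rewrite !hornerE subrr.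
move/(rdvdpP (monicXsubC x)) => [a aE].
exists a, (g.[x]%:P * d + rmodp p d); split.
  apply: coef_inD; last exact: dvd_mod_rmodp.
  rewrite mulrC; apply: coef_inM => -[|i]; by rewrite coefC.
by rewrite mulrCA -aE {1}(rdivp_eq md p) -/g; ring.
Qed.

End ModuloIdeal.
End MonicDivision.

(** * Substitution into the polynomials in two variables *)

Section TwoVariables.
Variables (K : fieldType) (n : nat).
Local Notation S := (mpoly n K).
Local Notation C := (@mpolyC n K).
Implicit Types (q : {poly {poly K}}) (x y : S).

(** [q] as a polynomial in its first variable, after substituting [y] for the
    second one. *)
Definition spec2 q y : {poly S} := map_poly (horner_eval y \o map_poly C) q.

Lemma spec2_horner q x y : (spec2 q y).[x] = eval2 q x y.
Proof.
rewrite /eval2 (horner_coef_wide _ (size_poly _ _)); apply: eq_bigr => i _.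
rewrite coef_map /= /horner_eval (horner_coef_wide _ (size_poly _ _)) mulr_suml.
by apply: eq_bigr => j _; rewrite coef_map /= mul_mpolyC -!scalerAl mulrC.
Qed.

Lemma spec2_swap q x y : eval2 (swapXY q) x y = eval2 q y x.
Proof.
have E p u v : eval2 p u v = (map_poly (map_poly C) p).[u, v].
  rewrite -spec2_horner /spec2 map_poly_comp -[RHS]/(horner_eval v _).
  by rewrite -horner_map /= [horner_eval v _%:P]hornerC.
by rewrite !E -swapXY_map horner2_swapXY.
Qed.

Lemma map_spec2 (w : 'S_n) q y :
  map_poly (msym w) (spec2 q y) = spec2 q (msym w y).
Proof.
rewrite /spec2 -map_poly_comp; apply: eq_map_poly => c /=.
rewrite /horner_eval -horner_map -map_poly_comp /=; congr _.[_].
by apply: eq_map_poly => t /=; rewrite msymC.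
Qed.

Lemma size_spec2 q y m : size q = m.+1 -> q`_m`_0 != 0 -> (forall j, (0 < j)%N -> q`_m`_j = 0) ->
  size (spec2 q y) = m.+1 /\ lead_coef (spec2 q y) = C q`_m`_0.
Proof.
move=> szq q0 qj.
have lead : (spec2 q y)`_m = C q`_m`_0.
  have qE : q`_m = (q`_m`_0)%:P by apply/polyP => -[|j]; rewrite coefC //= qj.
  by rewrite coef_map /= {1}qE /horner_eval map_polyC hornerC.
have sz : size (spec2 q y) = m.+1.
  apply/eqP; rewrite eqn_leq -{1}szq size_poly /=.
  by rewrite ltnNge; apply/negP => /leq_sizeP/(_ m (leqnn m))/eqP; rewrite lead mpolyC_eq0 (negPf q0).
by rewrite lead_coefE sz.
Qed.

End TwoVariables.

(** * The generators of the annihilators *)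

Section Generators.
Variables (K : fieldType) (I : choiceType) (P : zmodType) (alpha : I -> P).
Variables (n : nat) (beta : P).
Variables (Q : I -> I -> {poly {poly K}}) (rk lam : I -> nat).
Local Notation Iseq := (Iseq alpha n beta).
Local Notation S := (mpoly n K).
Local Notation X := (X K).
Local Notation "ka @ k" := (tnth (val ka) k) (at level 9).
Implicit Types (ka : Iseq) (c : I) (m : nat) (r : 'I_n.-1) (J : S -> Prop).
Import Pdiv.CommonRing Pdiv.RingMonic.

(** The relation satisfied at position [m] by a strand of colour [c] pulled to the
    left of all strands: it meets the cyclotomic relation, and it crosses twice the
    strands that the sorted order keeps on its left. *)
Definition step_poly ka c m : {poly S} :=
  'X ^+ lam c * \prod_(j < n | (j < m)%N && (rk (ka @ j) < rk c)%N)
    spec2 (Q c (ka @ j)) (X j).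

(** The strands of colour [c] on the left act by divided differences, which turn
    their variables into interpolation nodes. *)
Definition node_poly ka c m : {poly S} :=
  \prod_(j < n | (j < m)%N && (ka @ j == c)) ('X - (X j)%:P).

(** Evaluated at [X k], this is the divided difference of [step_poly] at the nodes
    and at [X k]. It is kept as a polynomial in one more variable, because its degree
    in that variable is the bound on the exponents of [x_k]. *)
Definition gen_quot ka k : {poly S} :=
  rdivp (step_poly ka (ka @ k) k) (node_poly ka (ka @ k) k).

Definition gen ka k : S := (gen_quot ka k).[X k].

Lemma node_poly_monic ka c m : node_poly ka c m \is monic.
Proof. by apply: monic_prod => j _; apply: monicXsubC. Qed.

Lemma prod_ordS (R : comNzRingType) (Pr : pred 'I_n) (F : 'I_n -> R) (k : 'I_n) :
  \prod_(j < n | (j < k.+1)%N && Pr j) F j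
  = (if Pr k then F k else 1) * \prod_(j < n | (j < k)%N && Pr j) F j.
Proof.
case: ifP => Pk.
  rewrite (bigD1 k) /= ?ltnSn //; congr (_ * _); apply: eq_bigl => j.
  by rewrite ltnS andbC ltn_neqAle -val_eqE andbA.
rewrite mul1r; apply: eq_bigl => j; rewrite ltnS leq_eqVlt.
by case: eqP => //= /ord_inj ->; rewrite Pk andbF.
Qed.

Lemma step_polyS ka c (k : 'I_n) : step_poly ka c k.+1 =
  step_poly ka c k *
  (if (rk (ka @ k) < rk c)%N then spec2 (Q c (ka @ k)) (X k) else 1).
Proof.
by rewrite /step_poly (prod_ordS (fun j => rk (ka @ j) < rk c)%N) mulrCA mulrC.
Qed.

Lemma node_polyS ka c (k : 'I_n) : node_poly ka c k.+1 =
  node_poly ka c k * (if ka @ k == c then 'X - (X k)%:P else 1).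
Proof. by rewrite /node_poly (prod_ordS (fun j => ka @ j == c)) mulrC. Qed.

(** By Newton's interpolation the generators at the positions of colour [c] are the
    divided differences of [step_poly] at the successive nodes. Where they vanish,
    every node is a root; the nodes are adjoined one at a time. *)
Lemma dvd_mod_step J ka c m : is_ideal J -> (m <= n)%N ->
  (forall j : 'I_n, (j < m)%N -> ka @ j = c -> J (gen ka j)) ->
  dvd_mod J (node_poly ka c m) (step_poly ka c m).
Proof.
move=> idJ; elim: m => [_ _|m IH lt_mn Jgen].
  rewrite /node_poly big_pred0 //; exact: dvd_mod1.
pose k := Ordinal lt_mn.
have {}IH : dvd_mod J (node_poly ka c m) (step_poly ka c m).
  by apply: IH => [|j jm]; [apply: ltnW | apply: Jgen; apply: ltnW].
have -> : m.+1 = k.+1 by []; rewrite step_polyS node_polyS.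
have [eq_c|ne_c] := eqVneq (ka @ k) c; last first.
  by rewrite mulr1; apply: dvd_modM.
rewrite eq_c ltnn mulr1; apply: dvd_mod_next => //; first exact: node_poly_monic.
by have := Jgen k (ltnSn _) eq_c; rewrite /gen /gen_quot eq_c.
Qed.

(** ** Exchanging two neighbouring positions *)

Lemma ltn_sref r m (j : 'I_n) : m != r.+1 -> (sref r j < m)%N = (j < m)%N.
Proof.
by rewrite /sref => mr; case: tpermP => [->|->|//]; rewrite /=; lia.
Qed.

Lemma map_step_poly r ka c m : m != r.+1 ->
  map_poly (msym (sref r)) (step_poly ka c m) = step_poly (Iact (sref r) ka) c m.
Proof.
move=> mr; rewrite /step_poly rmorphM /= rmorphXn /= map_polyX rmorph_prod /=.
congr (_ * _); rewrite [RHS](reindex_inj (@perm_inj _ (sref r))) /=.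
apply: eq_big => [j|j _]; first by rewrite ltn_sref // tnth_sref srefK.
by rewrite map_spec2 msym_X tnth_sref srefK.
Qed.

Lemma map_node_poly r ka c m : m != r.+1 ->
  map_poly (msym (sref r)) (node_poly ka c m) = node_poly (Iact (sref r) ka) c m.
Proof.
move=> mr; rewrite /node_poly rmorph_prod /=.
rewrite [RHS](reindex_inj (@perm_inj _ (sref r))) /=.
apply: eq_big => [j|j _]; first by rewrite ltn_sref // tnth_sref srefK.
by rewrite rmorphB /= map_polyX map_polyC /= msym_X.
Qed.

Lemma msym_quot_horner r ka c m x : m != r.+1 ->
  msym (sref r) (rdivp (step_poly ka c m) (node_poly ka c m)).[x] =
  (rdivp (step_poly (Iact (sref r) ka) c m)
         (node_poly (Iact (sref r) ka) c m)).[msym (sref r) x].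
Proof.
move=> mr; rewrite -horner_map map_rdivp ?node_poly_monic //=.
by rewrite map_step_poly // map_node_poly.
Qed.

Lemma msym_gen r ka k : k != lo r -> k != hi r ->
  msym (sref r) (gen ka k) = gen (Iact (sref r) ka) k.
Proof.
move=> kl kh; rewrite /gen /gen_quot msym_quot_horner; last by rewrite -val_eqE in kh.
by rewrite msym_X tnth_sref !sref_neq.
Qed.

Lemma step_poly_hi ka c r : step_poly ka c (hi r) =
  step_poly ka c (lo r) *
  (if (rk (ka @ (lo r)) < rk c)%N then spec2 (Q c (ka @ (lo r))) (X (lo r)) else 1).
Proof. exact: (step_polyS ka c (lo r)). Qed.

Lemma node_poly_hi ka c r : node_poly ka c (hi r) =
  node_poly ka c (lo r) * (if ka @ (lo r) == c then 'X - (X (lo r))%:P else 1).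
Proof. exact: (node_polyS ka c (lo r)). Qed.

Lemma lo_neqS r : lo r != r.+1 :> nat. Proof. by rewrite /=; lia. Qed.

Lemma msym_gen_lo r ka : msym (sref r) (gen ka (lo r)) =
  (rdivp (step_poly (Iact (sref r) ka) (ka @ (lo r)) (lo r))
         (node_poly (Iact (sref r) ka) (ka @ (lo r)) (lo r))).[X (hi r)].
Proof. by rewrite /gen /gen_quot msym_quot_horner ?lo_neqS // msym_X sref_lo. Qed.

Lemma gen_up r ka : (rk (ka @ (lo r)) < rk (ka @ (hi r)))%N ->
  gen (Iact (sref r) ka) (hi r) = msym (sref r) (gen ka (lo r)).
Proof.
move=> lt_rk; rewrite msym_gen_lo /gen /gen_quot tnth_sref sref_hi.
rewrite step_poly_hi node_poly_hi tnth_sref sref_lo ltnNge ltnW //=.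
by case: eqP lt_rk => [->|_]; rewrite ?ltnn // !mulr1.
Qed.

(** Adding one node to a divided difference is a divided difference in that node. *)
Lemma gen_same r ka : ka @ (lo r) = ka @ (hi r) ->
  gen ka (hi r) = divdiff1 r (gen ka (lo r)).
Proof.
move=> eq_ka; apply/esym/divdiff1_unique; rewrite msym_gen_lo (Iact_sref_id eq_ka).
rewrite /gen /gen_quot -eq_ka step_poly_hi node_poly_hi ltnn eqxx mulr1.
set F := step_poly _ _ _; set D := node_poly _ _ _.
have mD : D \is monic by apply: node_poly_monic.
have mDX : D * ('X - (X (lo r))%:P) \is monic by rewrite monicMl ?monicXsubC.
have : rdvdp ('X - (X (lo r))%:P) (rdivp F D - (rdivp F D).[X (lo r)]%:P).
  by rewrite Pdiv.Ring.rdvdp_XsubCl; apply/rootP; rewrite !hornerE subrr.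
move/(rdvdpP (monicXsubC _)) => [a aE].
have -> : rdivp F (D * ('X - (X (lo r))%:P)) = a.
  have -> : F = a * (D * ('X - (X (lo r))%:P))
              + ((rdivp F D).[X (lo r)]%:P * D + rmodp F D).
    by rewrite mulrCA -aE {1}(rdivp_eq mD F); ring.
  apply: rdivp_addl_mul_small => //.
  rewrite size_Mmonic ?monic_neq0 ?monicXsubC // size_XsubC addn2 /= ltnS.
  apply: leq_trans (size_polyD _ _) _; rewrite geq_max; apply/andP; split.
    by rewrite mul_polyC size_scale_leq.
  by rewrite ltnW // ltn_rmodpN0 ?monic_neq0.
have := congr1 (horner^~ (X (hi r))) aE.
by rewrite !hornerE /= /root_diff => e; rewrite -[LHS]opprK -mulNr opprB mulrC -e opprB.
Qed.

(** In the exchanged sequence the strand of colour [c] at [lo r] is one more node.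
    The generators up to [r] make it a root of the interpolated polynomial. *)
Lemma msym_gen_hi_in r ka J : is_ideal J ->
  (rk (ka @ (lo r)) < rk (ka @ (hi r)))%N ->
  (forall j : 'I_n, (j <= r)%N -> J (gen (Iact (sref r) ka) j)) ->
  J (msym (sref r) (gen ka (hi r))).
Proof.
move=> idJ lt_rk Jgen; set ka' := Iact (sref r) ka; set c := ka @ (hi r).
have ka'lo : ka' @ (lo r) = c by rewrite tnth_sref sref_lo.
have neq_c : ka @ (lo r) == c = false.
  by apply/negbTE/eqP => e; move: lt_rk; rewrite -/c -e ltnn.
rewrite /gen /gen_quot -/c step_poly_hi node_poly_hi lt_rk neq_c mulr1.
rewrite -horner_map map_rdivp ?node_poly_monic //= rmorphM /= map_spec2.
rewrite map_step_poly ?lo_neqS // map_node_poly ?lo_neqS // !msym_X sref_hi sref_lo.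
apply: dvd_mod_horner => //; first exact: node_poly_monic.
apply: dvd_modM => //; have := @dvd_mod_step J ka' c (hi r) idJ (ltnW (ltn_ord _)).
rewrite step_poly_hi node_poly_hi ka'lo ltnn eqxx mulr1; apply.
by move=> j /= jr _; apply: Jgen.
Qed.

(** A crossing in this order creates the factor [Q] in [step_poly]. Dividing the
    product by the nodes differs from multiplying the quotient only through the
    remainder, which lies in the ideal of the generators on the left. *)
Lemma gen_down_in r ka J : is_ideal J -> (forall i j, Q i j = swapXY (Q j i)) ->
  (rk (ka @ (hi r)) < rk (ka @ (lo r)))%N ->
  (forall j : 'I_n, (j < r)%N -> J (gen (Iact (sref r) ka) j)) ->
  J (eval2 (Q (ka @ (hi r)) (ka @ (lo r))) (X (lo r)) (X (hi r))
       * msym (sref r) (gen ka (lo r)) - gen (Iact (sref r) ka) (hi r)).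
Proof.
move=> idJ Qsym lt_rk Jgen; set ka' := Iact (sref r) ka; set c := ka @ (lo r).
have ka'lo : ka' @ (lo r) = ka @ (hi r) by rewrite tnth_sref sref_lo.
have ka'hi : ka' @ (hi r) = c by rewrite tnth_sref sref_hi.
have neq_c : ka @ (hi r) == c = false.
  by apply/negbTE/eqP => e; move: lt_rk; rewrite -/c -e ltnn.
rewrite msym_gen_lo -/ka' /gen /gen_quot ka'hi step_poly_hi node_poly_hi.
rewrite ka'lo lt_rk neq_c mulr1 -/c Qsym spec2_swap -spec2_horner.
set q := spec2 _ _; set F := step_poly _ _ _; set D := node_poly _ _ _.
have mD : D \is monic by apply: node_poly_monic.
have dD : dvd_mod J D F.
  apply: dvd_mod_step => //; first exact: ltnW.
  by move=> j /= jr _; apply: Jgen.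
have Jm := dvd_mod_rmodp idJ mD dD.
have -> : F * q = (rdivp F D * q) * D + q * rmodp F D.
  by rewrite {1}(rdivp_eq mD F); ring.
rewrite rdivp_addl_mul // hornerD hornerM mulrC opprD addrA subrr sub0r.
rewrite -mulN1r; case: (idJ) => _ _; apply; apply: coef_in_horner => //.
by apply: coef_in_rdivp => //; apply: coef_inM.
Qed.

End Generators.

(** ** The ideals spanned by the generators *)

Section GeneratedIdeals.
Variables (K : fieldType) (I : choiceType) (P : zmodType) (alpha : I -> P).
Variables (n : nat) (beta : P).
Variables (Q : I -> I -> {poly {poly K}}) (rk lam : I -> nat).
Local Notation Iseq := (Iseq alpha n beta).
Local Notation S := (mpoly n K).
Local Notation X := (X K).
Local Notation "ka @ k" := (tnth (val ka) k) (at level 9).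
Implicit Types (ka : Iseq) (r : 'I_n.-1) (f g : S).
Local Notation gen := (gen Q rk lam).

Hypothesis Qsym : forall i j, Q i j = swapXY (Q j i).

Definition genid ka f := exists g : 'I_n -> S, f = \sum_k g k * gen ka k.

Lemma genid_ideal ka : is_ideal (genid ka).
Proof.
split.
- by exists (fun=> 0); rewrite big1 // => k _; rewrite mul0r.
- move=> _ _ [u ->] [v ->]; exists (fun k => u k + v k).
  by rewrite -big_split; apply: eq_bigr => k _; rewrite mulrDl.
- move=> f _ [u ->]; exists (fun k => f * u k).
  by rewrite mulr_sumr; apply: eq_bigr => k _; rewrite mulrA.
Qed.

Lemma genid_gen ka k : genid ka (gen ka k).
Proof.
exists (fun j => (j == k)%:R); rewrite (bigD1 k) //= eqxx mul1r big1 ?addr0 //.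
by move=> j /negPf->; rewrite mul0r.
Qed.

Lemma genidM ka f g : genid ka g -> genid ka (f * g).
Proof. by case: (genid_ideal ka) => _ _; apply. Qed.

Lemma genidD ka f g : genid ka f -> genid ka g -> genid ka (f + g).
Proof. by case: (genid_ideal ka) => _ + _; apply. Qed.

Lemma genid_sum ka (F : 'I_n -> S) : (forall k, genid ka (F k)) -> genid ka (\sum_k F k).
Proof. by move=> GF; apply: (is_ideal_sum (genid_ideal ka)). Qed.

(** The next three closure properties say that the sum of the ideals over all
    colour sequences is stable under the crossings. *)
Lemma genid_up r ka f : (rk (ka @ (lo r)) < rk (ka @ (hi r)))%N ->
  genid ka f -> genid (Iact (sref r) ka) (msym (sref r) f).
Proof.
move=> lt_rk [u ->]; rewrite rmorph_sum /=; apply: genid_sum => k.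
rewrite msymM; apply: genidM.
have [->|kl] := eqVneq k (lo r); first by rewrite -gen_up //; apply: genid_gen.
have [->|kh] := eqVneq k (hi r); last by rewrite msym_gen //; apply: genid_gen.
by apply: msym_gen_hi_in => // [|j _]; [apply: genid_ideal|apply: genid_gen].
Qed.

Lemma genid_down r ka f : (rk (ka @ (hi r)) < rk (ka @ (lo r)))%N -> genid ka f ->
  genid (Iact (sref r) ka)
    (eval2 (Q (ka @ (hi r)) (ka @ (lo r))) (X (lo r)) (X (hi r)) * msym (sref r) f).
Proof.
move=> lt_rk [u ->]; rewrite rmorph_sum mulr_sumr /=; apply: genid_sum => k.
rewrite msymM mulrCA; apply: genidM.
have [->|kl] := eqVneq k (lo r).
  have := @gen_down_in _ _ _ _ _ _ Q rk lam r ka _ (genid_ideal (Iact (sref r) ka)) Qsym lt_rk.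
  move=> /(_ (fun j _ => genid_gen _ j)) /genidD /(_ (genid_gen _ (hi r))).
  by rewrite subrK.
apply: genidM; have [->|kh] := eqVneq k (hi r); last first.
  by rewrite msym_gen //; apply: genid_gen.
have := @gen_up _ _ _ _ _ _ Q rk lam r (Iact (sref r) ka).
rewrite !tnth_sref sref_lo sref_hi Iact_srefK => /(_ lt_rk) ->.
by rewrite msym_srefK; apply: genid_gen.
Qed.

Lemma genid_divdiff1 r ka f : ka @ (lo r) = ka @ (hi r) ->
  genid ka f -> genid ka (divdiff1 r f).
Proof.
move=> eq_ka [u ->].
have -> : divdiff1 r (\sum_k u k * gen ka k) = \sum_k divdiff1 r (u k * gen ka k).
  apply: (big_morph _ (@divdiff1D _ _ r)); apply: divdiff1_sym; exact: msym0.
apply: genid_sum => k; rewrite divdiff1M; apply: genidD.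
  exact/genidM/genid_gen.
apply: genidM.
have [->|kl] := eqVneq k (lo r); first by rewrite -gen_same //; apply: genid_gen.
rewrite divdiff1_sym; first by case: (genid_ideal ka).
have [->|kh] := eqVneq k (hi r); first by rewrite gen_same // msym_divdiff1.
by rewrite msym_gen // Iact_sref_id.
Qed.

Lemma gen0 ka (k : 'I_n) : k = 0%N :> nat -> gen ka k = X k ^+ lam (ka @ k).
Proof.
move=> k0; rewrite /gen /gen_quot k0 /step_poly /node_poly !big_pred0 //.
by rewrite mulr1 Pdiv.Ring.rdivp1 hornerXn.
Qed.

(** Modulo the generators further to the left, the generator at a position arises
    from the generator at the previous position of the sequence in which its strand
    has been moved one step to the left. So the closure properties produce all
    generators from the cyclotomic relation at position 0. *)
Lemma gen_in_family (W : Iseq -> S -> Prop) :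
  (forall ka i j, rk (ka @ i) = rk (ka @ j) -> ka @ i = ka @ j) ->
  (forall ka, is_ideal (W ka)) ->
  (forall ka (k : 'I_n), k = 0%N :> nat -> W ka (X k ^+ lam (ka @ k))) ->
  (forall r ka f, ka @ (lo r) = ka @ (hi r) -> W ka f -> W ka (divdiff1 r f)) ->
  (forall r ka f, (rk (ka @ (lo r)) < rk (ka @ (hi r)))%N -> W ka f ->
     W (Iact (sref r) ka) (msym (sref r) f)) ->
  (forall r ka f, (rk (ka @ (hi r)) < rk (ka @ (lo r)))%N -> W ka f ->
     W (Iact (sref r) ka)
       (eval2 (Q (ka @ (hi r)) (ka @ (lo r))) (X (lo r)) (X (hi r)) * msym (sref r) f)) ->
  forall ka k, W ka (gen ka k).
Proof.
move=> rk_inj idW W0 Wsame Wup Wdown ka k.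
have [m] := ubnP k; elim: m => // m IH in ka k *; rewrite ltnS => km.
have [k0|k0] := posnP k; first by rewrite gen0 //; apply: W0.
have lt : (k.-1 < n.-1)%N by have := ltn_ord k; lia.
pose r := Ordinal lt; have kE : k = hi r by apply/ord_eqP => /=; lia.
have {}IH ka' (j : 'I_n) : (j <= r)%N -> W ka' (gen ka' j).
  by move=> /= jr; apply: IH; lia.
rewrite kE; set ka' := Iact (sref r) ka.
have kaE : ka = Iact (sref r) ka' by rewrite Iact_srefK.
have lo' : ka' @ (lo r) = ka @ (hi r) by rewrite tnth_sref sref_lo.
have hi' : ka' @ (hi r) = ka @ (lo r) by rewrite tnth_sref sref_hi.
case: (ltngtP (rk (ka @ (lo r))) (rk (ka @ (hi r)))) => [lt_rk|lt_rk|eq_rk].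
- have lt' : (rk (ka' @ (hi r)) < rk (ka' @ (lo r)))%N by rewrite lo' hi'.
  have := @gen_down_in _ _ _ _ _ _ Q rk lam r ka' (W ka) (idW ka) Qsym lt'.
  rewrite -kaE => /(_ (fun j jr => IH ka j (ltnW jr))) Wd.
  have := Wdown r ka' _ lt' (IH ka' (lo r) (leqnn _)); rewrite -kaE => Wm.
  case: (idW ka) => _ WD WM; have := WD _ _ Wm (WM (-1) _ Wd).
  by rewrite mulN1r opprB addrC subrK.
- have lt' : (rk (ka' @ (lo r)) < rk (ka' @ (hi r)))%N by rewrite lo' hi'.
  by rewrite kaE gen_up //; apply: Wup => //; apply: IH.
- by rewrite gen_same; [apply: Wsame => //; [apply: rk_inj|apply: IH]|apply: rk_inj].
Qed.

End GeneratedIdeals.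

(** ** Normal forms modulo the generators *)

Section UnitLead.
Variables (K : fieldType) (n : nat).
Local Notation S := (mpoly n K).
Local Notation C := (@mpolyC n K).
Implicit Types (p q d : {poly S}) (m : nat).
Import Pdiv.CommonRing Pdiv.RingMonic.

(** Division by the generators is possible because their leading coefficients are
    nonzero scalars; they need not be 1, since the leading coefficients of the
    polynomials [Q] are arbitrary. *)
Definition unit_lead m p := size p = m.+1 /\ exists2 t : K, t != 0 & lead_coef p = C t.

Lemma unit_lead_neq0 m p : unit_lead m p -> p != 0.
Proof. by case=> sz _; rewrite -size_poly_eq0 sz. Qed.

Lemma unit_leadM m1 m2 p q :
  unit_lead m1 p -> unit_lead m2 q -> unit_lead (m1 + m2) (p * q).
Proof.
move=> up uq; have := size_mul (unit_lead_neq0 up) (unit_lead_neq0 uq).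
case: up uq => sp [t t0 lp] [sq [u u0 lq]]; rewrite sp sq addnS /= /unit_lead => ->.
split=> //; exists (t * u); first by rewrite mulf_neq0.
by rewrite lead_coefM lp lq -mpolyCM.
Qed.

Lemma unit_lead_monic m p : p \is monic -> size p = m.+1 -> unit_lead m p.
Proof. by move=> mp sp; split=> //; exists 1; rewrite ?oner_neq0 // (monicP mp) mpolyC1. Qed.

Lemma unit_lead_prod (T : Type) (s : seq T) (Pr : pred T) (F : T -> {poly S}) (D : T -> nat) :
  (forall i, Pr i -> unit_lead (D i) (F i)) ->
  unit_lead (\sum_(i <- s | Pr i) D i) (\prod_(i <- s | Pr i) F i).
Proof.
move=> uF; elim/big_rec2: _ => [|i m p Pi up].
  by apply: unit_lead_monic; rewrite ?monic1 ?size_poly1.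
exact: unit_leadM (uF _ Pi) up.
Qed.

Lemma unit_lead_rdivp m k p d : d \is monic -> size d = k.+1 -> (k <= m)%N ->
  unit_lead m p -> unit_lead (m - k) (rdivp p d).
Proof.
move=> md sd km [sp [t t0 lp]]; set q := rdivp p d.
have sr : (size (rmodp p d) < size d)%N by rewrite ltn_rmodpN0 ?monic_neq0.
have q0 : q != 0.
  apply/eqP => qE; move: sp; rewrite (rdivp_eq md p) -/q qE mul0r add0r => szr.
  by move: sr; rewrite szr sd; lia.
have sqd : size (q * d) = (size q + k)%N by rewrite size_Mmonic // sd addnS.
have sq1 : (0 < size q)%N by rewrite size_poly_gt0.
have lt : (size (rmodp p d) < size (q * d)%R)%N by rewrite sqd; move: sr; rewrite sd; lia.
split.
  by move: sp; rewrite {1}(rdivp_eq md p) -/q size_polyDl // sqd -subSn // => <-; rewrite addnK.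
by exists t; rewrite // -lp [in RHS](rdivp_eq md p) lead_coefDl // lead_coef_Mmonic.
Qed.

End UnitLead.

Section NormalForms.
Variables (K : fieldType) (I : choiceType) (P : zmodType) (alpha : I -> P).
Variables (n : nat) (beta : P).
Variables (Q : I -> I -> {poly {poly K}}) (rk lam : I -> nat) (deg : I -> I -> nat).
Local Notation Iseq := (Iseq alpha n beta).
Local Notation S := (mpoly n K).
Local Notation X := (X K).
Local Notation C := (@mpolyC n K).
Local Notation "ka @ k" := (tnth (val ka) k) (at level 9).
Implicit Types (ka : Iseq) (c : I) (m : nat) (k : 'I_n) (f g : S).
Import Pdiv.CommonRing Pdiv.RingMonic.

Hypothesis Qdeg : forall i j, i != j -> size (Q i j) = (deg i j).+1 /\
  (Q i j)`_(deg i j)`_0 != 0.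
Hypothesis Qlead : forall i j l, i != j -> (0 < l)%N -> (Q i j)`_(deg i j)`_l = 0.

Definition step_deg ka c m :=
  (lam c + \sum_(j < n | (j < m)%N && (rk (ka @ j) < rk c)%N) deg c (ka @ j))%N.

Definition node_count ka c m := #|[set j : 'I_n | (j < m)%N && (ka @ j == c)]%SET|.

Lemma unit_lead_step ka c m : unit_lead (step_deg ka c m) (step_poly Q rk lam ka c m).
Proof.
apply: unit_leadM; first by apply: unit_lead_monic; rewrite ?monicXn ?size_polyXn.
apply: unit_lead_prod => j /andP[_ lt_rk].
have ne : c != ka @ j by apply: contraTneq lt_rk => <-; rewrite ltnn.
have [sz q0] := Qdeg ne; have := @size_spec2 K n _ (X j) _ sz q0 (fun l => Qlead ne).
by move=> [szs lead]; split=> //; exists (Q c (ka @ j))`_(deg c (ka @ j))`_0.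
Qed.

Lemma size_node_poly ka c m : size (node_poly K ka c m) = (node_count ka c m).+1.
Proof.
have -> : node_count ka c m = (\sum_(j < n | (j < m)%N && (ka @ j == c)) 1)%N.
  by rewrite /node_count -sum1_card; apply: eq_bigl => j; rewrite inE.
suff [] : unit_lead (\sum_(j < n | (j < m)%N && (ka @ j == c)) 1) (node_poly K ka c m) by [].
apply: unit_lead_prod => j _.
by apply: unit_lead_monic; rewrite ?monicXsubC ?size_XsubC.
Qed.

Definition gen_deg ka k := (step_deg ka (ka @ k) k - node_count ka (ka @ k) k)%N.

Lemma unit_lead_gen ka k : (node_count ka (ka @ k) k <= step_deg ka (ka @ k) k)%N ->
  unit_lead (gen_deg ka k) (gen_quot Q rk lam ka k).
Proof.
move=> le; apply: unit_lead_rdivp => //; first exact: node_poly_monic.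
  exact: size_node_poly.
exact: unit_lead_step.
Qed.

(** Polynomials in [X k] over the ring of all variables, rather than over the ring
    of the other ones: the type stays the same for all [k]. *)
Definition isolate k : {rmorphism S -> {poly S}} :=
  mmap (polyC \o C) (fun j => if j == k then 'X else (X j)%:P).

Lemma isolateC k (t : K) : isolate k (C t) = (C t)%:P.
Proof. exact: mmapC. Qed.

Lemma isolateX k j : isolate k (X j) = if j == k then 'X else (X j)%:P.
Proof. by apply: etrans (mmapX _ _ _) _; rewrite mmap1U. Qed.

Lemma isolate_horner k f : (isolate k f).[X k] = f.
Proof.
have := @mpoly_rmorph_ext K n S (horner_eval (X k) \o isolate k) idfun.
apply=> [t|j] /=; first by rewrite isolateC /horner_eval hornerC.
by rewrite isolateX /horner_eval; case: eqP => [->|_]; rewrite ?hornerX ?hornerC.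
Qed.

Lemma isolate_step ka c m k : (m <= k)%N ->
  map_poly (isolate k) (step_poly Q rk lam ka c m) = map_poly polyC (step_poly Q rk lam ka c m).
Proof.
move=> mk; rewrite /step_poly !rmorphM /= !rmorphXn /= !map_polyX !rmorph_prod /=.
congr (_ * _); apply: eq_bigr => j /andP[jm _].
have Xj : isolate k (X j) = (X j)%:P.
  by rewrite isolateX -val_eqE /= ltn_eqF // (leq_trans jm).
rewrite /spec2 -!map_poly_comp; apply: eq_map_poly => q /=.
rewrite /horner_eval -!horner_map Xj -!map_poly_comp; congr _.[_].
by apply: eq_map_poly => t /=; rewrite isolateC.
Qed.

Lemma isolate_node ka c m k : (m <= k)%N ->
  map_poly (isolate k) (node_poly K ka c m) = map_poly polyC (node_poly K ka c m).
Proof.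
move=> mk; rewrite /node_poly !rmorph_prod /=; apply: eq_bigr => j /andP[jm _].
rewrite !rmorphB /= !map_polyX !map_polyC /=.
by rewrite isolateX -val_eqE /= ltn_eqF // (leq_trans jm).
Qed.

Lemma isolate_quot ka (j k : 'I_n) : (j <= k)%N -> map_poly (isolate k) (gen_quot Q rk lam ka j) =
  map_poly polyC (gen_quot Q rk lam ka j).
Proof.
by move=> jk; rewrite !map_rdivp ?node_poly_monic // isolate_step // isolate_node.
Qed.

Lemma isolate_gen_lt ka (j k : 'I_n) : (j < k)%N ->
  isolate k (gen Q rk lam ka j) = (gen Q rk lam ka j)%:P.
Proof.
move=> jk; rewrite -horner_map isolate_quot ?(ltnW jk) //= isolateX -val_eqE /= ltn_eqF //.
by rewrite horner_map.
Qed.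

Lemma isolate_gen ka k : isolate k (gen Q rk lam ka k) = gen_quot Q rk lam ka k.
Proof.
by rewrite -horner_map isolate_quot //= isolateX eqxx -/(_ \Po 'X) comp_polyXr.
Qed.

Section Reduction.
Variable ka : Iseq.
Hypothesis le_deg : forall k, (node_count ka (ka @ k) k <= step_deg ka (ka @ k) k)%N.
Local Notation gen := (gen Q rk lam ka).
Local Notation gen_quot := (gen_quot Q rk lam ka).

(** Monic, because division with remainder is linear over the coefficients only for
    a monic divisor. *)
Definition monic_quot k : {poly S} :=
  C ((lead_coef (gen_quot k))@_0%MM)^-1 *: gen_quot k.

Lemma monic_quotP k : monic_quot k \is monic /\
  exists t, gen_quot k = C t *: monic_quot k.
Proof.
have [_ [t t0 lead]] := unit_lead_gen (le_deg k).
rewrite /monic_quot lead mpolyCK; split.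
  by rewrite monicE lead_coefZ lead -mpolyCM mulVf // mpolyC1.
by exists t; rewrite scalerA -mpolyCM mulfV // mpolyC1 scale1r.
Qed.

Definition reduce k f : S := (rmodp (isolate k f) (monic_quot k)).[X k].

Lemma reduce_zmod_morphism k : zmod_morphism (reduce k).
Proof.
move=> f g; have [mk _] := monic_quotP k.
by rewrite /reduce rmorphB rmodpB // hornerD hornerN.
Qed.

Lemma reduce0 k : reduce k 0 = 0.
Proof. by have := reduce_zmod_morphism k 0 0; rewrite !subrr. Qed.

Lemma reduceD k f g : reduce k (f + g) = reduce k f + reduce k g.
Proof.
have rN h : reduce k (- h) = - reduce k h.
  by have := reduce_zmod_morphism k 0 h; rewrite reduce0 !sub0r.
by have := reduce_zmod_morphism k f (- g); rewrite rN !opprK.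
Qed.

Lemma reduceM k f g : isolate k g = g%:P -> reduce k (f * g) = reduce k f * g.
Proof.
move=> gE; have [mk _] := monic_quotP k.
by rewrite /reduce rmorphM /= gE mulrC mul_polyC rmodpZ // hornerZ mulrC.
Qed.

Lemma reduce_gen k f : reduce k (f * gen k) = 0.
Proof.
have [mk [t tE]] := monic_quotP k.
rewrite /reduce rmorphM /= isolate_gen tE -scalerAr scalerAl rmodp_mull //.
by rewrite horner0.
Qed.

Lemma size_isolateX k (m : 'X_{1..n}) : (size (isolate k (mpolyX K m)) <= (m k).+1)%N.
Proof.
rewrite mpolyXE_id rmorph_prod (bigD1 k) //= rmorphXn /= isolateX eqxx.
have -> : \prod_(j < n | j != k) isolate k (X j ^+ m j)
    = (\prod_(j < n | j != k) X j ^+ m j)%:P.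
  rewrite rmorph_prod; apply: eq_bigr => j /negPf jk.
  by rewrite rmorphXn /= isolateX jk rmorphXn.
by rewrite mulrC mul_polyC (leq_trans (size_scale_leq _ _)) // size_polyXn.
Qed.

Lemma reduce_id k f :
  (forall m : 'X_{1..n}, m \in msupp f -> (m k < gen_deg ka k)%N) -> reduce k f = f.
Proof.
move=> bnd; have [mk [t tE]] := monic_quotP k.
have szq : size (monic_quot k) = (gen_deg ka k).+1.
  have [sz _] := unit_lead_gen (le_deg k); rewrite -sz tE.
  have t0 : C t != 0.
    by apply: contraTneq (unit_lead_neq0 (unit_lead_gen (le_deg k))); rewrite tE => ->;
      rewrite scale0r eqxx.
  by rewrite [RHS]size_scale.
rewrite /reduce rmodp_small ?isolate_horner // szq ltnS.
rewrite [f]mpolyE rmorph_sum /=; apply: leq_trans (size_sum _ _ _) _.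
rewrite big_seq; apply/bigmax_leqP_seq => m mf _.
rewrite -mul_mpolyC rmorphM /= isolateC mul_polyC.
by rewrite (leq_trans (size_scale_leq _ _)) // (leq_trans (size_isolateX _ _)) // bnd.
Qed.

(** The remainders are taken from the last variable to the first. The generator of
    index [j] involves only variables up to [j], so it is a constant for the
    reductions in the later variables and is killed by its own. *)
Lemma genid_normal f : genid Q rk lam ka f ->
  (forall (m : 'X_{1..n}) k, m \in msupp f -> (m k < gen_deg ka k)%N) -> f = 0.
Proof.
move=> [u fE] bnd; pose red s g := foldl (fun g k => reduce k g) g s.
have red0 s : red s 0 = 0 by elim: s => //= k s; rewrite /red /= reduce0.
have redD s g h : red s (g + h) = red s g + red s h.
  by elim: s g h => //= k s IH g h; rewrite /red /= reduceD; apply: IH.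
pose s := rev (enum 'I_n).
have sorted_s : sorted (fun i j : 'I_n => j < i)%N s.
  by rewrite /s rev_sorted; have := iota_ltn_sorted 0 n; rewrite -val_enum_ord sorted_map.
have red_gen j g : j \in s -> red s (g * gen j) = 0.
  elim: (s) sorted_s g => // k s' IH ord_s g.
  rewrite inE /red /=; have [->|jk] := eqVneq j k.
    by rewrite reduce_gen => _; apply: red0.
  move=> /= js; have lt_jk : (j < k)%N.
    have := order_path_min _ ord_s => /(_ _)/allP; apply => //.
    by move=> a b c ab bc; apply: ltn_trans bc ab.
  rewrite reduceM ?isolate_gen_lt //; apply: IH => //; exact: path_sorted ord_s.
have -> : f = red s f.
  by elim: (s) => //= k s' IH; rewrite /red /= reduce_id // => m; apply: bnd.
rewrite fE (big_morph (red s) (redD s) (red0 s)) big1 // => k _.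
by apply: red_gen; rewrite mem_rev mem_enum.
Qed.

End Reduction.
End NormalForms.

(** ** Existence of normal forms *)

Section NormalFormExists.
Variables (K : fieldType) (I : choiceType) (P : zmodType) (alpha : I -> P).
Variables (n : nat) (beta : P).
Variables (Q : I -> I -> {poly {poly K}}) (rk lam : I -> nat) (deg : I -> I -> nat).
Local Notation Iseq := (Iseq alpha n beta).
Local Notation S := (mpoly n K).
Local Notation X := (X K).
Local Notation C := (@mpolyC n K).
Local Notation "ka @ k" := (tnth (val ka) k) (at level 9).
Implicit Types (k : 'I_n) (f g : S) (m : 'X_{1..n}).

Hypothesis Qdeg : forall i j, i != j -> size (Q i j) = (deg i j).+1 /\
  (Q i j)`_(deg i j)`_0 != 0.
Hypothesis Qlead : forall i j l, i != j -> (0 < l)%N -> (Q i j)`_(deg i j)`_l = 0.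
Variable ka : Iseq.
Hypothesis le_deg : forall k,
  (node_count ka (ka @ k) k <= step_deg rk lam deg ka (ka @ k) k)%N.
Local Notation gen := (gen Q rk lam ka).
Local Notation gen_quot := (gen_quot Q rk lam ka).
Local Notation genid := (genid Q rk lam ka).
Local Notation d := (gen_deg rk lam deg ka).

(** If [f] is fixed by moving [X k] into a new variable, then setting that variable
    to 0 fixes [f] as well, and it kills all monomials that involve [X k]. *)
Lemma isolate_const k f : isolate K k f = f%:P ->
  forall m, m \in msupp f -> m k = 0%N.
Proof.
move=> fE m; rewrite mcoeff_msupp; apply: contraNeq => mk.
have -> : f = (isolate K k f).[0] by rewrite fE hornerC.
rewrite {1}[f]mpolyE rmorph_sum /= horner_sum raddf_sum big1 //= => m' _.
rewrite -mul_mpolyC rmorphM /= isolateC hornerM hornerC mul_mpolyC mcoeffZ.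
rewrite mpolyXE_id rmorph_prod /= horner_prod (bigD1 k) //= rmorphXn /= isolateX eqxx.
rewrite hornerXn; have [m'k|/negPf m'k] := eqVneq (m' k) 0%N; last first.
  by rewrite expr0n m'k mul0r mcoeff0 mulr0.
rewrite m'k expr0 mul1r.
have -> : \prod_(i < n | i != k) (isolate K k (X i ^+ m' i)).[0] = mpolyX K m'.
  rewrite [RHS]mpolyXE_id [RHS](bigD1 k) //= m'k expr0 mul1r; apply: eq_bigr => i /negPf ik.
  by rewrite rmorphXn /= isolateX ik horner_exp hornerC.
rewrite mcoeffX; case: eqP => [m'm|_]; last by rewrite mulr0.
by rewrite -m'm m'k eqxx in mk.
Qed.

Lemma gen_quot_coef k (j : 'I_n) i m : (k <= j)%N ->
  m \in msupp (gen_quot k)`_i -> m j = 0%N.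
Proof.
move=> kj; apply: isolate_const.
by rewrite -coef_map isolate_quot // coef_map.
Qed.

Definition bounded_from (l : nat) f :=
  forall m (j : 'I_n), m \in msupp f -> (l <= j)%N -> (m j < d j)%N.

Definition reducible l f := exists2 f', bounded_from l f' & genid (f - f').

Lemma reducible0 l : reducible l 0.
Proof.
exists 0; first by move=> m j; rewrite msupp0.
by rewrite subrr; case: (genid_ideal Q rk lam ka).
Qed.

Lemma reducibleD l f g : reducible l f -> reducible l g -> reducible l (f + g).
Proof.
move=> [f' bf Gf] [g' bg Gg]; exists (f' + g').
  move=> m j /msuppD_le; rewrite mem_cat => /orP[]; [exact: bf|exact: bg].
by rewrite opprD addrACA; apply: genidD.
Qed.

Lemma reducibleZ l c f : reducible l f -> reducible l (c *: f).
Proof.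
move=> [f' bf Gf]; exists (c *: f').
  by move=> m j /msuppZ_le; apply: bf.
by rewrite -scalerBr -mul_mpolyC; apply: genidM.
Qed.

Lemma reducible_sum l (T : eqType) (s : seq T) (G : T -> S) :
  (forall i, i \in s -> reducible l (G i)) -> reducible l (\sum_(i <- s) G i).
Proof.
move=> rG; rewrite big_seq; elim/big_ind: _ => [|f g|i /rG //]; first exact: reducible0.
exact: reducibleD.
Qed.

Lemma reducible_congr l f g : genid (f - g) -> reducible l g -> reducible l f.
Proof.
move=> Gfg [g' bg Gg]; exists g' => //.
by rewrite -(subrK g f) -addrA; apply: genidD.
Qed.

(** Dividing by the generator at [k] lowers the exponent of [X k] and does not
    change those of the later variables, as its coefficients involve only earlier
    ones. *)
Lemma reducible_mon k m : (forall j : 'I_n, (k < j)%N -> (m j < d j)%N) ->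
  reducible k (mpolyX K m).
Proof.
have [b] := ubnP (m k); elim: b m => // b IH m; rewrite ltnS => mb bnd.
have [small|big] := ltnP (m k) (d k).
  exists (mpolyX K m); last by rewrite subrr; case: (genid_ideal Q rk lam ka).
  move=> m' j; rewrite msuppX inE => /eqP->; rewrite leq_eqVlt => /orP[/eqP/ord_inj <- //|].
  exact: bnd.
have [sz [t t0 lead]] := unit_lead_gen Qdeg Qlead (le_deg k).
pose m' : 'X_{1..n} := (m - U_(k) *+ d k)%MM.
have mE : m = (m' + U_(k) *+ d k)%MM.
  apply/mnmP => j; rewrite mnmDE mnmBE subnK // mulmnE mnm1E.
  by case: eqP => [<-|_]; rewrite ?mul1n ?mul0n.
have XE i : mpolyX K (U_(k) *+ i)%MM = X k ^+ i by rewrite -mpolyXn.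
have genE : gen k = \sum_(i < d k) (gen_quot k)`_i * X k ^+ i + C t * X k ^+ d k.
  rewrite {1}/gen horner_coef sz big_ord_recr /=; congr (_ + _ * _).
  by rewrite -lead lead_coefE sz.
apply: (@reducible_congr _ _ (- t^-1 *: \sum_(i < d k) mpolyX K m' * (gen_quot k)`_i * X k ^+ i)).
  rewrite scaleNr opprK.
  have -> : mpolyX K m + t^-1 *: (\sum_(i < d k) mpolyX K m' * (gen_quot k)`_i * X k ^+ i)
      = (t^-1 *: mpolyX K m') * gen k.
    rewrite genE mulrDr addrC; congr (_ + _).
      rewrite scaler_sumr mulr_sumr; apply: eq_bigr => i _.
      by rewrite -mulrA scalerAl.
    by rewrite {1}mE mpolyXD XE mul_mpolyC -scalerAr -scalerAl scalerA mulfV // scale1r.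
  exact/genidM/genid_gen.
apply/reducibleZ/reducible_sum => i _.
rewrite [X in _ * X * _]mpolyE mulr_sumr mulr_suml; apply: reducible_sum => m'' m''c.
rewrite -scalerAr -scalerAl; apply: reducibleZ; rewrite -XE -!mpolyXD.
have m''0 (j : 'I_n) : (k <= j)%N -> m'' j = 0%N by move=> kj; apply: gen_quot_coef m''c.
apply: IH => [|j kj].
  rewrite !mnmDE mnmBE !mulmnE mnm1E eqxx !mul1n m''0 // addn0.
  by apply: leq_trans mb; have := ltn_ord i; lia.
rewrite !mnmDE mnmBE !mulmnE mnm1E m''0 ?(ltnW kj) //.
by rewrite -val_eqE /= (ltn_eqF kj) !mul0n subn0 !addn0 bnd.
Qed.

Lemma normal_form f : exists2 f', genid (f - f') &
  forall m k, m \in msupp f' -> (m k < d k)%N.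
Proof.
suff [l red] : exists2 l, l = 0%N & reducible l f.
  by rewrite red => -[f' bf Gf]; exists f' => // m k mf; apply: bf.
exists 0%N => //.
suff claim l : (l <= n)%N -> reducible (n - l) f by rewrite -(subnn n); apply: claim.
elim: l => [_|l IH lt].
  exists f; last by rewrite subrr; case: (genid_ideal Q rk lam ka).
  by move=> m j _; rewrite subn0 leqNgt ltn_ord.
have [f' bf Gf] := IH (ltnW lt).
apply: reducible_congr Gf _; rewrite [f']mpolyE; apply: reducible_sum => m mf.
apply: reducibleZ.
have lt_k : (n - l.+1 < n)%N by rewrite ltn_subrL; lia.
apply: (@reducible_mon (Ordinal lt_k)) => j /= lj; apply: bf => //.
by rewrite -subSn // subSS in lj.
Qed.

End NormalFormExists.

Section Vanishing.
Variables (K : fieldType) (I : choiceType) (P : zmodType) (alpha : I -> P).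
Variables (n : nat) (beta : P).
Variables (Q : I -> I -> {poly {poly K}}) (rk lam : I -> nat) (deg : I -> I -> nat).
Local Notation Iseq := (Iseq alpha n beta).
Local Notation "ka @ k" := (tnth (val ka) k) (at level 9).
Implicit Types (ka : Iseq) (c : I) (m : nat) (k : 'I_n).
Local Notation step_deg := (step_deg rk lam deg).

Hypothesis Qdeg : forall i j, i != j -> size (Q i j) = (deg i j).+1 /\
  (Q i j)`_(deg i j)`_0 != 0.
Hypothesis Qlead : forall i j l, i != j -> (0 < l)%N -> (Q i j)`_(deg i j)`_l = 0.

Lemma node_countS ka c k :
  node_count ka c k.+1 = ((ka @ k == c) + node_count ka c k)%N.
Proof.
rewrite /node_count (cardsD1 k) inE ltnSn /=; congr (_ + _)%N.
apply: eq_card => j; rewrite !inE ltnS andbA; congr (_ && _).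
by rewrite [RHS]ltn_neqAle -val_eqE.
Qed.

Lemma step_deg_mono ka c m1 m2 : (m1 <= m2)%N -> (step_deg ka c m1 <= step_deg ka c m2)%N.
Proof.
move=> le_m; rewrite leq_add2l big_mkcond [leqRHS]big_mkcond /=.
apply: leq_sum => j _; case: ifP => // /andP[jm ->].
by rewrite (leq_trans jm le_m).
Qed.

Lemma node_count_le_step ka c m : (m <= n)%N ->
  (forall j : 'I_n, (j < m)%N -> ka @ j = c -> (node_count ka c j < step_deg ka c j)%N) ->
  (node_count ka c m <= step_deg ka c m)%N.
Proof.
elim: m => [_ _|m IH lt_mn pos].
  by rewrite /node_count (eq_card0 (A := _)) // => j; rewrite inE.
have -> : m.+1 = (Ordinal lt_mn).+1 by []; rewrite node_countS.
apply: leq_trans (step_deg_mono ka c (leqnSn _)).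
case: eqP => [eq_c|_]; first exact: (pos (Ordinal lt_mn)).
by apply: IH => [|j jm]; [apply: ltnW | apply: pos; apply: ltnW].
Qed.

(** Between two consecutive positions of the same colour the degree of the
    generator drops by at most one, so it cannot become negative without
    having been zero before; a generator of degree zero is a scalar. *)
Lemma unit_gen ka k :
  (step_deg ka (ka @ k) k <= node_count ka (ka @ k) k)%N ->
  exists k' (t : K), t != 0 /\ gen Q rk lam ka k' = mpolyC n t.
Proof.
have [m] := ubnP k; elim: m => // m IH in k *; rewrite ltnS => km le_k.
have [[j [jk eq_j le_j]]|none] := pselect (exists j : 'I_n,
    [/\ (j < k)%N, ka @ j = ka @ k & (step_deg ka (ka @ j) j <= node_count ka (ka @ j) j)%N]).
  by apply: (IH j) => //; apply: leq_trans km.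
have ge_k : (node_count ka (ka @ k) k <= step_deg ka (ka @ k) k)%N.
  apply: node_count_le_step => [|j jk eq_j]; first exact: ltnW.
  by rewrite ltnNge; apply/negP => le_j; apply: none; exists j; split; rewrite ?eq_j.
have [] := unit_lead_gen Qdeg Qlead ge_k.
have -> : gen_deg rk lam deg ka k = 0%N by apply/eqP; rewrite subn_eq0.
move/eqP/size_poly1P => [c c0 cE] [t t0]; rewrite cE lead_coefC => ct.
by exists k, t; split=> //; rewrite /gen cE hornerC.
Qed.

End Vanishing.

(** * The polynomial representation *)

(** The operators on polynomials enter the braid relation only through two
    reflections of three elements and the divided differences along them. *)
Section NilBraid.
Variables (R : idomainType) (x y z : R) (sg ta : {rmorphism R -> R}).
Variables (d e : R -> R).
Hypotheses (sgx : sg x = y) (sgy : sg y = x) (sgz : sg z = z).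
Hypotheses (tax : ta x = x) (tay : ta y = z) (taz : ta z = y).
Hypotheses (xy : x - y != 0) (yz : y - z != 0) (xz : x - z != 0).
Hypotheses (dE : forall f, (x - y) * d f = f - sg f) (sgd : forall f, sg (d f) = d f).
Hypotheses (eE : forall f, (y - z) * e f = f - ta f) (tae : forall f, ta (e f) = e f).
Hypotheses (sgK : forall f, sg (sg f) = f) (taK : forall f, ta (ta f) = f).
Hypothesis braid : forall f, sg (ta (sg f)) = ta (sg (ta f)).

(** Both sides, multiplied by the three differences, are the antisymmetrization
    of [f]. *)
Lemma nil_braid f : d (e (d f)) = e (d (e f)).
Proof.
pose alt := f - sg f - ta f + ta (sg f) + sg (ta f) - ta (sg (ta f)).
have L : (x - y) * (y - z) * (x - z) * d (e (d f)) = alt.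
  set g := d f; have gE := dE f; rewrite -/g in gE.
  have sgg : sg g = g by apply: sgd.
  have e1 := eE g; have e2 := congr1 sg e1; have e3 := dE (e g).
  have e4 := congr1 ta gE; have e5 := congr1 sg e4.
  move: e2 e4 e5; rewrite !(rmorphM, rmorphB) /= braid !(sgx, sgy, sgz, tax, tay, taz) sgg.
  move=> e2 e4 e5.
  have -> : (x - y) * (y - z) * (x - z) * d (e g) =
    (y - z) * (x - z) * ((x - y) * d (e g)) by ring.
  rewrite e3 mulrBr.
  have -> : (y - z) * (x - z) * e g = (x - z) * ((y - z) * e g) by ring.
  have -> : (y - z) * (x - z) * sg (e g) = (y - z) * ((x - z) * sg (e g)) by ring.
  rewrite e1 e2 !mulrBr e4 e5.
  have -> : (x - z) * g = (x - y) * g + (y - z) * g by ring.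
  by rewrite gE /alt; ring.
have L' : (x - y) * (y - z) * (x - z) * e (d (e f)) = alt.
  set g := e f; have gE := eE f; rewrite -/g in gE.
  have tag : ta g = g by apply: tae.
  have e1 := dE g; have e2 := congr1 ta e1; have e3 := eE (d g).
  have e4 := congr1 sg gE; have e5 := congr1 ta e4.
  move: e2 e4 e5; rewrite !(rmorphM, rmorphB) /= !(sgx, sgy, sgz, tax, tay, taz) tag.
  move=> e2 e4 e5.
  have -> : (x - y) * (y - z) * (x - z) * e (d g) =
    (x - y) * (x - z) * ((y - z) * e (d g)) by ring.
  rewrite e3 mulrBr.
  have -> : (x - y) * (x - z) * d g = (x - z) * ((x - y) * d g) by ring.
  have -> : (x - y) * (x - z) * ta (d g) = (x - y) * ((x - z) * ta (d g)) by ring.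
  rewrite e1 e2 !mulrBr e4 e5.
  have -> : (x - z) * g = (x - y) * g + (y - z) * g by ring.
  by rewrite gE /alt; ring.
have nz : (x - y) * (y - z) * (x - z) != 0 by rewrite !mulf_neq0.
by apply: (mulfI nz); rewrite L L'.
Qed.

Let dM u f : sg u = u -> d (u * f) = u * d f.
Proof. by move=> su; apply: (mulfI xy); rewrite mulrCA !dE rmorphM /= su; ring. Qed.
Let eM u f : ta u = u -> e (u * f) = u * e f.
Proof. by move=> tu; apply: (mulfI yz); rewrite mulrCA !eE rmorphM /= tu; ring. Qed.

Let d_conj f : d (ta (sg f)) = ta (sg (e f)).
Proof.
apply: (mulfI xy); rewrite dE; have := congr1 ta (congr1 sg (eE f)).
by rewrite !(rmorphM, rmorphB) /= sgy sgz tax taz => ->; rewrite braid.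
Qed.
Let e_conj f : e (sg (ta f)) = sg (ta (d f)).
Proof.
apply: (mulfI yz); rewrite eE; have := congr1 sg (congr1 ta (dE f)).
by rewrite !(rmorphM, rmorphB) /= tax tay sgx sgz => ->; rewrite braid.
Qed.

Definition equivariant (p : R -> R -> R) :=
  (forall u v, sg (p u v) = p (sg u) (sg v)) /\ (forall u v, ta (p u v) = p (ta u) (ta v)).

Lemma nil_braidN f : - e (- d (- e f)) = - d (- e (- d f)).
Proof.
have dN g : d (- g) = - d g.
  by apply: (mulfI xy); rewrite mulrN !dE rmorphN; ring.
have eN g : e (- g) = - e g.
  by apply: (mulfI yz); rewrite mulrN !eE rmorphN; ring.
by rewrite !(dN, eN) !opprK nil_braid.
Qed.

Lemma braid_iij p f : equivariant p ->
  p y z * ta (p x y * sg (- e f)) = - d (p y z * ta (p x y * sg f)).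
Proof.
move=> [ps pt]; rewrite !rmorphM !rmorphN /= pt tax tay !mulrA dM ?d_conj; last first.
  by rewrite rmorphM /= !ps sgx sgy sgz mulrC.
by rewrite mulrN.
Qed.

Lemma braid_jii p f : equivariant p ->
  - e (p x y * sg (p y z * ta f)) = p x y * sg (p y z * ta (- d f)).
Proof.
move=> [ps pt]; rewrite !rmorphM !rmorphN /= ps sgy sgz !mulrA eM ?e_conj; last first.
  by rewrite rmorphM /= !pt tax tay taz mulrC.
by rewrite mulrN.
Qed.

Lemma braid_distinct p q w f : equivariant p -> equivariant q -> equivariant w ->
  p y z * ta (q x y * sg (w y z * ta f)) = w x y * sg (q y z * ta (p x y * sg f)).
Proof.
move=> [ps pt] [qs qt] [ws wt]; rewrite !(rmorphM, ps, pt, qs, qt, ws, wt) /=.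
by rewrite !(sgx, sgy, sgz, tax, tay, taz) braid; ring.
Qed.

Lemma braid_iji p q f : equivariant p -> equivariant q ->
  (x - z) * (p y z * ta (- d (q y z * ta f)) - q x y * sg (- e (p x y * sg f)))
  = (q x y * p y x - q z y * p y z) * f.
Proof.
move=> [ps pt] [qs qt].
set g := q y z * ta f; set k := p x y * sg f.
have := congr1 ta (dE g); have := congr1 sg (eE k).
rewrite /g /k !(rmorphM, rmorphB, ps, pt, qs, qt) /=.
rewrite !(sgx, sgy, sgz, tax, tay, taz).
rewrite sgK taK braid -/g -/k !rmorphN => ek eg.
have -> : (x - z) * (p y z * - ta (d g) - q x y * - sg (e k)) =
  - p y z * ((x - z) * ta (d g)) + q x y * ((x - z) * sg (e k)) by ring.
by rewrite ek eg; ring.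
Qed.

End NilBraid.

Section CrossingOperators.
Variables (K : fieldType) (n : nat) (I : eqType).
Variables (Q : I -> I -> {poly {poly K}}) (rk : I -> nat).
Local Notation S := (mpoly n K).
Local Notation X := (X K).
Local Notation dd := (@divdiff1 K n).
Implicit Types (f g u v : S) (a b c : I) (r s : 'I_n.-1).

Local Opaque msym divdiff1 mpolyX.

Hypothesis Qsym : forall i j, Q i j = swapXY (Q j i).
Hypothesis Qii : forall i, Q i i = 0.

(** The double crossing of two colours must act by [Q]. All of it is put on the
    crossings in one of the two orders of the colours, so that the crossings in the
    other order, which are those of a reduced word ending at the sorted sequence, act
    by plain reflections. *)
Definition cross_coef a b u v : S := if (rk b < rk a)%N then 1 else eval2 (Q a b) u v.

(** The sign comes from acting on the right: moving a polynomial to the right of a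
    crossing of equal colours produces minus its divided difference. *)
Definition cross r a b f : S :=
  if a == b then - dd r f
  else cross_coef a b (X (lo r)) (X (hi r)) * msym (sref r) f.

Lemma msym_eval2 (w : 'S_n) q u v :
  msym w (eval2 q u v) = eval2 q (msym w u) (msym w v).
Proof. by rewrite -!spec2_horner -horner_map /= map_spec2. Qed.

Lemma msym_coef (w : 'S_n) a b u v :
  msym w (cross_coef a b u v) = cross_coef a b (msym w u) (msym w v).
Proof. rewrite /cross_coef; case: (rk b < rk a)%N. exact: msym1. exact: msym_eval2. Qed.

Lemma cross_coefM a b u v : rk a != rk b ->
  cross_coef a b u v * cross_coef b a v u = eval2 (Q a b) u v.
Proof.
move=> ab; rewrite /cross_coef [X in _ * (if _ then _ else eval2 X _ _)]Qsym spec2_swap.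
by case: ltngtP ab => // _ _; rewrite ?mul1r ?mulr1.
Qed.

Lemma divdiff_0 u v f : divdiff 0 u v f = 0.
Proof. by rewrite /divdiff size_poly0 big_ord0. Qed.

Lemma crossD r a b f g : cross r a b (f + g) = cross r a b f + cross r a b g.
Proof. by rewrite /cross; case: ifP => _; rewrite ?divdiff1D ?opprD ?msymD ?mulrDr. Qed.

Lemma eval2_0 u v : eval2 0 u v = 0.
Proof. by rewrite /eval2 size_poly0 big_ord0. Qed.

Lemma crossM r a b f g : cross r a b (f * g) =
  msym (sref r) f * cross r a b g - (a == b)%:R * dd r f * g.
Proof.
rewrite /cross; case: ifP => _; last by rewrite msymM mul0r mul0r subr0 mulrCA.
by rewrite divdiff1M mul1r opprD addrC mulrN.
Qed.

Lemma cross_sq r a b f : (rk a == rk b) = (a == b) ->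
  cross r a b (cross r b a f) = eval2 (Q a b) (X (lo r)) (X (hi r)) * f.
Proof.
move=> ab; rewrite /cross [b == a]eq_sym; have [eq_ab|ne_ab] := eqVneq a b.
  by rewrite divdiff1N divdiff1_sym ?msym_divdiff1 // eq_ab Qii eval2_0 mul0r !oppr0.
by rewrite msymM msym_coef !msym_X sref_lo sref_hi msym_srefK mulrA cross_coefM // ab.
Qed.

Lemma divdiff1_msym_conj r (w : 'S_n) s f :
  (w^-1 * sref r * w)%g = sref s -> msym w (root_diff K r) = root_diff K s ->
  dd s (msym w f) = msym w (dd r f).
Proof.
move=> conj_w rd; apply: divdiff1_unique; rewrite -rd -msymM divdiff1P msymB.
congr (_ - _); rewrite -conj_w -!msymMm; congr (msym _ f).
by rewrite !mulgA mulgV mul1g.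
Qed.

Lemma msym_far r s f : (r.+1 < s)%N || (s.+1 < r)%N ->
  msym (sref r) (msym (sref s) f) = msym (sref s) (msym (sref r) f).
Proof. by move=> far; rewrite -!msymMm (sref_far far). Qed.

Lemma sref_fix_far r s : (r.+1 < s)%N || (s.+1 < r)%N ->
  sref r (lo s) = lo s /\ sref r (hi s) = hi s.
Proof. by move=> far; split; apply: sref_neq; rewrite -val_eqE /=; lia. Qed.

Lemma msym_divdiff1_far r s f : (r.+1 < s)%N || (s.+1 < r)%N ->
  msym (sref r) (dd s f) = dd s (msym (sref r) f).
Proof.
move=> far; have [l1 l2] := sref_fix_far far; apply/esym/divdiff1_msym_conj.
  by rewrite srefV (sref_far far) -mulgA sref2 mulg1.
by rewrite /root_diff msymB !msym_X l1 l2.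
Qed.

Lemma divdiff1_fixM r f g : msym (sref r) f = f -> dd r (f * g) = f * dd r g.
Proof. by move=> fixf; rewrite divdiff1M divdiff1_sym // fixf mul0r add0r. Qed.

Lemma divdiff1_far r s f : (r.+1 < s)%N || (s.+1 < r)%N ->
  dd r (dd s f) = dd s (dd r f).
Proof.
move=> far; have far' : (s.+1 < r)%N || (r.+1 < s)%N by rewrite orbC.
have [l1 l2] := sref_fix_far far'.
apply: divdiff1_unique; rewrite msym_divdiff1_far //.
rewrite -[- dd s _]divdiff1N -divdiff1D -divdiff1P divdiff1_fixM //.
by rewrite /root_diff msymB !msym_X l1 l2.
Qed.

Lemma cross_far r s a b c d f : (r.+1 < s)%N || (s.+1 < r)%N ->
  cross s c d (cross r a b f) = cross r a b (cross s c d f).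
Proof.
move=> far; have far' : (s.+1 < r)%N || (r.+1 < s)%N by rewrite orbC.
have fixc (t t' : 'I_n.-1) (u v : I) : (t.+1 < t')%N || (t'.+1 < t)%N ->
    msym (sref t) (cross_coef u v (X (lo t')) (X (hi t')))
      = cross_coef u v (X (lo t')) (X (hi t')).
  by move=> /sref_fix_far[e1 e2]; rewrite msym_coef !msym_X e1 e2.
rewrite /cross; case: (c == d); case: (a == b).
- by rewrite !divdiff1N divdiff1_far.
- by rewrite divdiff1_fixM ?fixc // msymN msym_divdiff1_far // mulrN.
- by rewrite divdiff1_fixM ?fixc // msymN msym_divdiff1_far // mulrN.
- rewrite !msymM (fixc _ _ _ _ far) (fixc _ _ _ _ far') (msym_far f far).
  exact: mulrCA.
Qed.

(** ** The braid relation *)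

Section Braid.
Variables r s : 'I_n.-1.
Hypothesis sE : s = r.+1 :> nat.
Let x : S := X (lo r).
Let y : S := X (hi r).
Let z : S := X (hi s).
Local Notation sg := (msym (sref r)).
Local Notation ta := (msym (sref s)).

Let loE : X (lo s) = y :> S. Proof. by rewrite -(hi_lo_adjacent sE). Qed.
Let sgx : sg x = y. Proof. by rewrite msym_X sref_lo. Qed.
Let sgy : sg y = x. Proof. by rewrite msym_X sref_hi. Qed.
Let sgz : sg z = z. Proof. by rewrite msym_X sref_hi_adjacent. Qed.
Let tax : ta x = x. Proof. by rewrite msym_X sref_lo_adjacent. Qed.
Let tay : ta y = z. Proof. by rewrite -loE msym_X sref_lo. Qed.
Let taz : ta z = y. Proof. by rewrite msym_X sref_hi loE. Qed.

Let sgK f : sg (sg f) = f. Proof. exact: msym_srefK. Qed.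
Let taK f : ta (ta f) = f. Proof. exact: msym_srefK. Qed.
Let brd f : sg (ta (sg f)) = ta (sg (ta f)).
Proof. by rewrite -!msymMm (sref_braid sE). Qed.

Let ddrE f : (x - y) * dd r f = f - sg f. Proof. exact: divdiff1P. Qed.
Let ddsE f : (y - z) * dd s f = f - ta f.
Proof. by rewrite -loE; exact: divdiff1P. Qed.

Let xz_neq0 : x - z != 0.
Proof. by rewrite subr_eq0 (inj_eq (@X_inj K n)) -val_eqE /= sE; lia. Qed.
Let xy_neq0 : x - y != 0. Proof. exact: root_diff_neq0. Qed.
Let yz_neq0 : y - z != 0. Proof. by rewrite -loE; exact: root_diff_neq0. Qed.

Lemma cross_braid a b c f : (rk a == rk b) = (a == b) -> (rk b == rk c) = (b == c) ->
  (rk a == rk c) = (a == c) ->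
  cross s b c (cross r a c (cross s a b f)) - cross r a b (cross s a c (cross r b c f))
  = (a == c)%:R * divdiff (Q a b) x y z * f.
Proof.
move=> ab bc ac.
have equiv i j : equivariant sg ta (cross_coef i j).
  by split=> u v; apply: msym_coef.
rewrite /cross loE -/x -/y -/z.
have [eq_ab|ne_ab] := eqVneq a b; have [eq_bc|ne_bc] := eqVneq b c.
- have eq_ac : a = c by rewrite eq_ab.
  rewrite eq_ac eqxx eq_bc Qii divdiff_0 mulr0 mul0r; apply/eqP; rewrite subr_eq0; apply/eqP.
  exact: (nil_braidN sgx sgy sgz tax tay taz xy_neq0 yz_neq0 xz_neq0 ddrE
    (@msym_divdiff1 _ _ r) ddsE (@msym_divdiff1 _ _ s) brd).
- have -> : a == c = false by rewrite eq_ab (negPf ne_bc).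
  rewrite mul0r mul0r; apply/eqP; rewrite subr_eq0; apply/eqP; rewrite eq_ab.
  exact: (braid_iij sgx sgy sgz tax tay taz xy_neq0 ddrE ddsE brd).
- have -> : a == c = false by rewrite -eq_bc (negPf ne_ab).
  rewrite mul0r mul0r; apply/eqP; rewrite subr_eq0; apply/eqP; rewrite -eq_bc.
  exact: (braid_jii sgx sgy sgz tax tay taz yz_neq0 ddrE ddsE brd).
have [eq_ac|ne_ac] := eqVneq a c; last first.
  rewrite mul0r mul0r; apply/eqP; rewrite subr_eq0; apply/eqP.
  exact: (braid_distinct sgx sgy sgz tax tay taz brd).
rewrite mul1r -eq_ac; apply: (mulfI xz_neq0); rewrite mulrA divdiffE.
have neq : rk a != rk b by rewrite ab.
rewrite -(cross_coefM x y neq) -(cross_coefM z y neq).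
exact: (braid_iji sgx sgy sgz tax tay taz ddrE ddsE sgK taK brd).
Qed.

End Braid.
End CrossingOperators.

(** ** Right modules over a free algebra *)

Section FreeAction.
Variables (K : fieldType) (V : lmodType K) (G : choiceType) (step : G -> V -> V).
Hypothesis step_linear : forall g, linear (step g).
Local Notation F := {malg K[{fmonom G}]}.
Implicit Types (y z : F) (v : V).

Definition ract_word (m : seq G) v : V := foldl (fun u g => step g u) v m.

Definition ract z v : V :=
  \sum_(m <- monalg.msupp z) monalg.mcoeff m z *: ract_word m v.

Lemma ract_word_linear m : linear (ract_word m).
Proof. elim: m => //= g m IH c u v; rewrite /ract_word /= step_linear; exact: IH. Qed.

Lemma ractEw (D : {fset {fmonom G}}) z v : (monalg.msupp z `<=` D)%fset ->
  ract z v = \sum_(m <- D) monalg.mcoeff m z *: ract_word m v.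
Proof.
move=> le; rewrite /ract (big_fset_incl _ le) => //= m _ /monalg.mcoeff_outdom ->.
by rewrite scale0r.
Qed.

Lemma ract_linear_l v : linear (ract^~ v).
Proof.
move=> c y z /=; pose D := (monalg.msupp y `|` monalg.msupp z)%fset.
rewrite (@ractEw D y) ?(@ractEw D z) ?(@ractEw D (c *: y + z)).
- rewrite scaler_sumr -big_split; apply: eq_bigr => m _ /=.
  by rewrite monalg.mcoeffD monalg.mcoeffZ scalerDl scalerA.
- apply: fsubset_trans (monalg.msuppD_le _ _) _.
  by rewrite fsetSU // monalg.msuppZ_le.
- exact: fsubsetUr.
- exact: fsubsetUl.
Qed.

Lemma ractD y z v : ract (y + z) v = ract y v + ract z v.
Proof. by have := ract_linear_l v 1 y z; rewrite !scale1r. Qed.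

Lemma ract0 v : ract 0 v = 0.
Proof. by apply: (addrI (ract 0 v)); rewrite -ractD !addr0. Qed.

Lemma ractZ c z v : ract (c *: z) v = c *: ract z v.
Proof. by have := ract_linear_l v c z 0; rewrite ract0 !addr0. Qed.

Lemma ractB y z v : ract (y - z) v = ract y v - ract z v.
Proof. by rewrite ractD -[- z]scaleN1r ractZ scaleN1r. Qed.

Lemma ract_sum (T : Type) (s : seq T) (Pr : pred T) (H : T -> F) v :
  ract (\sum_(i <- s | Pr i) H i) v = \sum_(i <- s | Pr i) ract (H i) v.
Proof. exact: (big_morph (ract^~ v) (fun y z => ractD y z v) (ract0 v)). Qed.

Lemma ractU c m v : ract << c *g m >> v = c *: ract_word m v.
Proof.
by rewrite (ractEw _ (monalg.msuppU_le)) big_seq_fset1 monalg.mcoeffUU.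
Qed.

Lemma ract_linear_r z : linear (ract z).
Proof.
move=> c u v; rewrite /ract scaler_sumr -big_split; apply: eq_bigr => m _ /=.
by rewrite ract_word_linear scalerDr !scalerA mulrC.
Qed.

Lemma ractDr z u v : ract z (u + v) = ract z u + ract z v.
Proof. by have := ract_linear_r z 1 u v; rewrite !scale1r. Qed.

Lemma ract0r z : ract z 0 = 0.
Proof. by apply: (addrI (ract z 0)); rewrite -ractDr !addr0. Qed.

Lemma ractZr c z v : ract z (c *: v) = c *: ract z v.
Proof. by have := ract_linear_r z c v 0; rewrite ract0r !addr0. Qed.

Lemma ractM y z v : ract (y * z) v = ract z (ract y v).
Proof.
transitivity (\sum_(m <- monalg.msupp y) ract z (monalg.mcoeff m y *: ract_word m v));
  last by apply/esym; exact: (big_morph (ract z) (ractDr z) (ract0r z)).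
rewrite malgME ract_sum.
apply: eq_bigr => m _; rewrite ract_sum ractZr [in RHS]/ract scaler_sumr.
apply: eq_bigr => m' _; rewrite ractU scalerA; congr (_ *: _).
by rewrite /ract_word fmM foldl_cat.
Qed.

Lemma ract1 v : ract 1 v = v.
Proof. by apply: etrans (ractU _ _ _) _; rewrite scale1r /ract_word fm1. Qed.

Lemma ract_gen g v : ract << fmu g >> v = step g v.
Proof. by rewrite ractU scale1r /ract_word fmU. Qed.

End FreeAction.

(** ** The action on polynomials and its cyclotomic submodule *)

Section PolynomialModule.
Variables (K : fieldType) (I : choiceType) (P : zmodType) (alpha : I -> P).
Variables (Q : I -> I -> {poly {poly K}}) (n : nat) (beta : P).
Variables (h : I -> {additive P -> int}) (Lambda : P) (rk : I -> nat).
Local Notation Iseq := (Iseq alpha n beta).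
Local Notation S := (mpoly n K).
Local Notation X := (X K).
Local Notation "ka @ k" := (tnth (val ka) k) (at level 9).
Local Notation F := (free_qh K alpha n beta).
Local Notation V := (Iseq -> S).
Local Notation psi := (@fpsi K I P alpha n beta).
Local Notation xx := (@fx K I P alpha n beta).
Local Notation ee := (@fe K I P alpha n beta).
Local Notation qh_of := (@qh_of K I P alpha Q n beta).
Local Notation cqh_of := (@cqh_of K I P alpha Q n beta h Lambda).
Local Notation lam := (fun i => absz (h i Lambda)).
Local Notation genid := (genid Q rk lam).
Local Notation cross := (cross Q rk).
Local Opaque msym divdiff1 mpolyX.
Implicit Types (ka : Iseq) (r s : 'I_n.-1) (k : 'I_n) (v : V) (z : F) (f : S).

Hypothesis Qsym : forall i j, Q i j = swapXY (Q j i).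
Hypothesis Qii : forall i, Q i i = 0.
Hypothesis rk_inj : forall ka i j, (rk (ka @ i) == rk (ka @ j)) = (ka @ i == ka @ j).
Hypothesis Iseq_finite : finite_set [set: Iseq].

(** Rows of polynomials indexed by colour sequences: the generators act on the
    right, so that [act z v ka] is the part of [v z] ending at [ka]. *)
Definition pol_step (g : 'I_n.-1 + 'I_n + Iseq) (v : V) : V :=
  match g with
  | inl (inl r) => fun ka => cross r (ka @ (lo r)) (ka @ (hi r)) (v (Iact (sref r) ka))
  | inl (inr k) => fun ka => X k * v ka
  | inr nu => fun ka => if ka == nu then v ka else 0
  end.

Lemma crossZ r i j (c : K) f : cross r i j (c *: f) = c *: cross r i j f.
Proof.
rewrite -!mul_mpolyC crossM msymC [divdiff1 r _]divdiff1_sym ?msymC //.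
by rewrite mulr0 mul0r subr0.
Qed.

Lemma pol_step_linear g : linear (pol_step g).
Proof.
move=> c u v; apply/funext => ka.
case: g => [[r|k]|nu] /=; rewrite !fctE /=.
- by rewrite crossD crossZ.
- by rewrite mulrDr scalerAr.
- by case: ifP => // _; rewrite scaler0 addr0.
Qed.

Local Notation act := (ract pol_step).
Let actM := ractM pol_step_linear.

Lemma act_psi r v : act (psi r) v =
  fun ka => cross r (ka @ (lo r)) (ka @ (hi r)) (v (Iact (sref r) ka)).
Proof. exact: ract_gen. Qed.

Lemma act_x k v : act (xx k) v = fun ka => X k * v ka.
Proof. exact: ract_gen. Qed.

Lemma act_e nu v : act (ee nu) v = fun ka => if ka == nu then v ka else 0.
Proof. exact: ract_gen. Qed.

Definition act_by z f := forall v, act z v = fun ka => f * v ka.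

Lemma act_by_x k : act_by (xx k) (X k). Proof. exact: act_x. Qed.
Lemma act_by0 : act_by 0 0.
Proof. by move=> v; rewrite ract0; apply/funext => ka; rewrite mul0r. Qed.
Lemma act_by1 : act_by 1 1.
Proof. by move=> v; rewrite ract1; apply/funext => ka; rewrite mul1r. Qed.
Lemma act_byD y z f g : act_by y f -> act_by z g -> act_by (y + z) (f + g).
Proof.
by move=> yf zg v; rewrite ractD yf zg; apply/funext => ka; rewrite mulrDl.
Qed.
Lemma act_byM y z f g : act_by y f -> act_by z g -> act_by (y * z) (f * g).
Proof.
by move=> yf zg v; rewrite actM zg yf; apply/funext => ka; rewrite mulrCA mulrA.
Qed.
Lemma act_byZ c z f : act_by z f -> act_by (c *: z) (c *: f).
Proof. by move=> zf v; rewrite ractZ zf; apply/funext => ka; rewrite fctE scalerAl. Qed.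
Lemma act_byX z f m : act_by z f -> act_by (z ^+ m) (f ^+ m).
Proof.
move=> zf; elim: m => [|m IH]; first by rewrite !expr0; apply: act_by1.
by rewrite !exprS; apply: act_byM.
Qed.
Lemma act_by_sum m (y : 'I_m -> F) (f : 'I_m -> S) :
  (forall i, act_by (y i) (f i)) -> act_by (\sum_i y i) (\sum_i f i).
Proof. by move=> yf; apply: big_ind2 => [|y1 f1 y2 f2|//]; [apply: act_by0|apply: act_byD]. Qed.

Lemma act_by_delta (t : bool) : act_by t%:R t%:R.
Proof. by case: t; [apply: act_by1|apply: act_by0]. Qed.

Lemma act_by_eval2 q k l :
  act_by (eval2 q (xx k : F) (xx l)) (eval2 q (X k) (X l)).
Proof.
rewrite /eval2; apply: act_by_sum => i; apply: act_by_sum => j.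
by apply/act_byZ/act_byM; apply/act_byX/act_by_x.
Qed.

Lemma act_by_divdiff q k l m :
  act_by (divdiff q (xx k : F) (xx l) (xx m)) (divdiff q (X k) (X l) (X m)).
Proof.
rewrite /divdiff; apply: act_by_sum => i; apply: act_by_sum => j.
apply/act_byZ/act_byM; last by apply/act_byX/act_by_x.
by apply: act_by_sum => t; apply/act_byM; apply/act_byX/act_by_x.
Qed.

Lemma divdiff1_lo r : divdiff1 r (X (lo r)) = 1.
Proof. by apply: divdiff1_unique; rewrite mulr1 msym_X sref_lo. Qed.

Lemma divdiff1_hi r : divdiff1 r (X (hi r)) = -1.
Proof. by apply: divdiff1_unique; rewrite mulrN1 msym_X sref_hi opprB. Qed.

Lemma cross0 r i j : cross r i j 0 = 0.
Proof. by have := crossZ r i j 0 0; rewrite !scale0r. Qed.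

Lemma cross_X r i j k f : cross r i j (X k * f) =
  X (sref r k) * cross r i j f - (i == j)%:R * divdiff1 r (X k) * f.
Proof. by rewrite crossM msym_X. Qed.

Local Opaque monalg.fgmul monalg.fgadd monalg.fgopp monalg.fgscale monalg.mkmalgU.
Local Opaque divdiff eval2 fpsi fx fe.

Lemma act_psi3 r s t v : act (psi r * psi s * psi t) v = act (psi t) (act (psi s) (act (psi r) v)).
Proof. by rewrite actM actM. Qed.

Lemma act_braid_diff r s nu v : (s = r.+1 :> nat)%N ->
  act (psi s * psi r * psi s - psi r * psi s * psi r) v nu =
  ((nu @ (lo r) == nu @ (hi s)) : bool)%:R
    * divdiff (Q (nu @ (lo r)) (nu @ (hi r))) (X (lo r)) (X (hi r)) (X (hi s)) * v nu.
Proof.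
move=> sE; apply: etrans (congr1 (@^~ nu) (ractB _ _ _ _)) _.
have e1 := congr1 (@^~ nu) (act_psi3 s r s v).
have e2 := congr1 (@^~ nu) (act_psi3 r s r v).
apply: etrans (congr2 (fun u w : S => u - w) e1 e2) _ => {e1 e2} /=.
rewrite !act_psi.
have hl := hi_lo_adjacent sE; have s1 := sref_lo_adjacent sE; have s2 := sref_hi_adjacent sE.
have t1 : sref r (lo s) = lo r by rewrite -hl sref_hi.
have t2 : sref r (lo r) = lo s by rewrite sref_lo.
have t3 : sref s (lo s) = hi s by rewrite sref_lo.
have t4 : sref s (hi s) = lo s by rewrite sref_hi.
have brd : Iact (sref s) (Iact (sref r) (Iact (sref s) nu)) =
    Iact (sref r) (Iact (sref s) (Iact (sref r) nu)).
  by rewrite !IactM (sref_braid sE).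
rewrite !tnth_sref hl !(t1, t2, t3, t4, s1, s2) brd.
have := cross_braid Qsym Qii sE (v (Iact (sref r) (Iact (sref s) (Iact (sref r) nu))))
  (rk_inj nu (lo r) (lo s)) (rk_inj nu (lo s) (hi s)) (rk_inj nu (lo r) (hi s)).
rewrite hl => B; apply: etrans B _.
case: eqP => [eq_nu|_]; last by rewrite !mul0r.
congr (_ * v _); apply/val_inj/eq_from_tnth => k; rewrite !tnth_sref.
have [->|k1] := eqVneq k (lo r); first by rewrite t2 t3 s2.
have [->|k2] := eqVneq k (lo s); first by rewrite t1 s1 t2.
have [->|k3] := eqVneq k (hi s); first by rewrite s2 t4 t1.
by rewrite (@sref_neq _ r k) ?hl // (@sref_neq _ s k) // (@sref_neq _ r k) ?hl.
Qed.

Lemma act_rel_braid r s nu v : (s = r.+1 :> nat)%N ->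
  act ((psi s * psi r * psi s - psi r * psi s * psi r) * ee nu) v =
  act (((nu @ (lo r) == nu @ (hi s)) : bool)%:R
        * divdiff (Q (nu @ (lo r)) (nu @ (hi r))) (xx (lo r)) (xx (hi r)) (xx (hi s))
        * ee nu) v.
Proof.
move=> sE; have R := act_byM (act_by_delta (nu @ (lo r) == nu @ (hi s)))
  (act_by_divdiff (Q (nu @ (lo r)) (nu @ (hi r))) (lo r) (hi r) (hi s)) v.
apply: etrans (actM _ _ _) (esym (etrans (actM _ _ _) _)).
rewrite !act_e; apply/funext => ka; case: eqP => // -> {ka}.
exact: etrans (congr1 (@^~ nu) R) (esym (act_braid_diff _ _ sE)).
Qed.

Definition acts z (T : V -> V) := forall v, act z v = T v.

Lemma actsM y z T U : acts y T -> acts z U -> acts (y * z) (U \o T).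
Proof. by move=> yT zU v; rewrite actM yT zU. Qed.

Lemma actsD y z T U : acts y T -> acts z U ->
  acts (y + z) (fun v ka => T v ka + U v ka).
Proof. by move=> yT zU v; rewrite ractD yT zU. Qed.

Lemma acts_eq y z T U : acts y T -> acts z U -> (forall v ka, T v ka = U v ka) ->
  forall v, act y v = act z v.
Proof. by move=> yT zU TU v; rewrite yT zU; apply/funext => ka. Qed.

Lemma act_rel_unit v : act (\sum_(nu \in [set: Iseq]) ee nu) v = act 1 v.
Proof.
rewrite ract1 fsbig_finite //= ract_sum; apply/funext => ka.
rewrite fct_sumE (bigD1_seq ka) ?in_fset_set ?inE ?fset_uniq //=.
rewrite act_e eqxx big1 ?addr0 // => nu ne.
by rewrite act_e eq_sym (negPf ne).
Qed.

Lemma act_rel y z : qh_rel Q y z -> forall v, act y v = act z v.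
Proof.
case=> [nu nu'||k nu|r nu|k l|r nu|r nu|r k kl kh|r s far|r nu|r s nu sE].
- apply: (acts_eq (actsM (act_e nu) (act_e nu'))
                  (actsM (act_by_delta _) (act_e nu))) => v ka /=.
  have [<-|ne] := eqVneq nu nu'; first by case: (ka == nu); rewrite ?mul1r.
  by rewrite mul0r if_same; case: eqP => // ->; rewrite [nu' == nu]eq_sym (negPf ne).
- exact: act_rel_unit.
- apply: (acts_eq (actsM (act_x k) (act_e nu)) (actsM (act_e nu) (act_x k))) => v ka /=.
  by case: (ka == nu); rewrite ?mulr0.
- apply: (acts_eq (actsM (act_psi r) (act_e nu))
                  (actsM (act_e (Iact (sref r) nu)) (act_psi r))) => v ka /=.
  rewrite (inj_eq (can_inj (Iact_srefK r))).
  by case: (ka == nu); rewrite ?cross0.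
- apply: (acts_eq (actsM (act_x k) (act_x l)) (actsM (act_x l) (act_x k))) => v ka /=.
  by rewrite mulrCA.
- apply: (acts_eq (actsM (actsM (act_psi r) (act_x (hi r))) (act_e nu))
    (actsM (actsD (actsM (act_x (lo r)) (act_psi r)) (act_by_delta _)) (act_e nu))) => v ka /=.
  case: eqP => // -> {ka}.
  rewrite cross_X divdiff1_lo sref_lo; case: eqP => [eq_nu|_].
    by rewrite (Iact_sref_id eq_nu) !mul1r subrK.
  by rewrite !mul0r subr0 addr0.
- apply: (acts_eq (actsM (actsM (act_x (hi r)) (act_psi r)) (act_e nu))
    (actsM (actsD (actsM (act_psi r) (act_x (lo r))) (act_by_delta _)) (act_e nu))) => v ka /=.
  case: eqP => // -> {ka}.
  rewrite cross_X divdiff1_hi sref_hi; case: eqP => [eq_nu|_].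
    by rewrite (Iact_sref_id eq_nu) mul1r mulN1r opprK mul1r.
  by rewrite !mul0r subr0 addr0.
- apply: (acts_eq (actsM (act_psi r) (act_x k)) (actsM (act_x k) (act_psi r))) => v ka /=.
  rewrite cross_X sref_neq // [divdiff1 r _]divdiff1_sym; last by rewrite msym_X sref_neq.
  by rewrite mulr0 mul0r subr0.
- apply: (acts_eq (actsM (act_psi r) (act_psi s)) (actsM (act_psi s) (act_psi r))) => v ka /=.
  have far' : (s.+1 < r)%N || (r.+1 < s)%N by rewrite orbC.
  have [l1 l2] := sref_fix_far far; have [l3 l4] := sref_fix_far far'.
  rewrite !tnth_sref l1 l2 l3 l4 !IactM (sref_far far).
  exact: cross_far.
- apply: (acts_eq (actsM (actsM (act_psi r) (act_psi r)) (act_e nu))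
    (actsM (act_by_eval2 _ _ _) (act_e nu))) => v ka /=.
  case: eqP => // -> {ka}; rewrite !tnth_sref sref_lo sref_hi Iact_srefK.
  by apply: cross_sq => //; apply: rk_inj.
by move=> v; apply: act_rel_braid.
Qed.

(** The sum of the ideals [genid] is a submodule, and it contains the image of the
    cyclotomic relation, which is the generator at position 0. So the polynomials
    modulo these ideals are a module over the cyclotomic algebra. *)
Definition in_genid v := forall ka, genid ka (v ka).

Lemma in_genidD u v : in_genid u -> in_genid v -> in_genid (fun ka => u ka + v ka).
Proof. by move=> Gu Gv ka; apply: genidD. Qed.

Lemma pol_step_genid g v : in_genid v -> in_genid (pol_step g v).
Proof.
move=> Gv; case: g => [[r|k]|nu] ka /=; last 2 first.
- exact: genidM.
- by case: (ka == nu) => //; case: (genid_ideal Q rk lam ka).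
rewrite /cross; have [eq_ka|ne] := eqVneq (ka @ (lo r)) (ka @ (hi r)).
  rewrite -mulN1r; apply: genidM; apply: genid_divdiff1 => //.
  by rewrite (Iact_sref_id eq_ka).
set ka' := Iact (sref r) ka.
have kaE : ka = Iact (sref r) ka' by rewrite Iact_srefK.
have lo' : ka' @ (lo r) = ka @ (hi r) by rewrite tnth_sref sref_lo.
have hi' : ka' @ (hi r) = ka @ (lo r) by rewrite tnth_sref sref_hi.
rewrite /cross_coef; case: ltnP => [lt|le].
  by rewrite mul1r kaE; apply: genid_up; rewrite ?lo' ?hi'.
have lt : (rk (ka' @ (hi r)) < rk (ka' @ (lo r)))%N.
  by rewrite lo' hi' ltn_neqAle le rk_inj ne.
have := genid_down Qsym lt (Gv ka').
by rewrite -kaE lo' hi'.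
Qed.

Lemma act_genid z v : in_genid v -> in_genid (act z v).
Proof.
move=> Gv ka; rewrite /ract fct_sumE; apply: (is_ideal_sum (genid_ideal Q rk lam ka)).
move=> m _; rewrite fctE -mul_mpolyC; apply: genidM.
elim: (fmonom_val m) v Gv => [|g s IH] v Gv //; exact/IH/pol_step_genid.
Qed.

Local Notation rels := [set z : F | exists y y', qh_rel Q y y' /\ z = y - y'].

Lemma qh_zero_act z : gen_ideal rels z -> forall v, act z v = 0.
Proof.
pose J : set F := [set z | forall v, act z v = 0].
move=> /(_ J); apply; split.
  split=> [v|y y' Jy Jy' v|y y' y'' Jy v]; first exact: ract0.
    by rewrite ractD Jy Jy' addr0.
  rewrite actM; apply: etrans (congr1 (act y'') _) (ract0r pol_step_linear _).
  by rewrite actM Jy.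
move=> _ [y [y' [yy' ->]]] v; rewrite ractB (act_rel yy') subrr //.
Qed.

(** The elements that map all polynomials into the submodule form a two-sided ideal;
    it contains the defining ideals of both quotients. *)
Lemma cqh_zero_act z : cqh_of (qh_of z) = 0 -> forall v, in_genid (act z v).
Proof.
rewrite -(rmorph0 cqh_of) => /quo_eqP; rewrite subr0.
pose J : set (qhecke alpha Q n beta) :=
  [set w | forall z, qh_of z = w -> forall v, in_genid (act z v)].
have qh_surj (w : qhecke alpha Q n beta) : exists z, qh_of z = w.
  by exists (generic_quotient.repr w); apply: generic_quotient.reprK.
have act_eq (z1 z2 : F) : qh_of z1 = qh_of z2 -> forall v, act z1 v = act z2 v.
  move/quo_eqP/qh_zero_act => z12 v; apply/eqP; rewrite -subr_eq0; apply/eqP.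
  by rewrite -ractB.
move=> /(_ J) cqh0; apply: (cqh0 _ z erefl); split.
  split.
  - move=> y y0 v ka.
    rewrite (act_eq y 0) ?ract0 ?rmorph0 //; by case: (genid_ideal Q rk lam ka).
  - move=> w1 w2 J1 J2 y yE v.
    have [y1 y1E] := qh_surj w1; have [y2 y2E] := qh_surj w2.
    rewrite (act_eq y (y1 + y2)); last by rewrite rmorphD y1E y2E.
    by rewrite ractD; apply: in_genidD; [apply: J1|apply: J2].
  - move=> w1 w2 w3 J2 y yE v.
    have [y1 y1E] := qh_surj w1; have [y2 y2E] := qh_surj w2; have [y3 y3E] := qh_surj w3.
    rewrite (act_eq y (y1 * y2 * y3)); last by rewrite !rmorphM y1E y2E y3E.
    by rewrite actM; apply: act_genid; rewrite actM; apply: J2.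
move=> _ [k [nu [k0 ->]]] y yE v.
have yE' : qh_of y = qh_of (xx k ^+ lam (nu @ k) * ee nu) by rewrite rmorphM rmorphXn.
rewrite (act_eq _ _ yE') => ka.
apply: eq_ind (esym (congr1 (@^~ ka) (actsM (act_byX (lam (nu @ k)) (act_by_x k)) (act_e nu) v))).
move=> /=; case: eqP => [->|_]; last by case: (genid_ideal Q rk lam ka).
rewrite mulrC; apply: genidM; rewrite -(gen0 Q rk lam) //; exact: genid_gen.
Qed.

End PolynomialModule.

(** * Free algebras *)

Section FreeAlgebra.
Variables (K : fieldType) (G : choiceType).
Local Notation F := {malg K[{fmonom G}]}.
Local Notation U := (@monalg.mkmalgU {fmonom G} K).
Implicit Types (a c : K) (z : F) (m : {fmonom G}).

Lemma scaleU c a m : c *: U m a = U m (c * a).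
Proof.
apply/malgP => m'; apply: etrans (monalg.mcoeffZ _ _ _) _.
apply: etrans (congr1 ( *%R c) (mcoeffU m a m')) _.
exact: etrans (mulrnAr _ _ _) (esym (mcoeffU m (c * a) m')).
Qed.

Lemma malgC_central c z : z * c%:A = c *: z.
Proof.
have cU : c%:A = U (fmone G) c :> F.
  by rewrite -[RHS]/(monalg.malgC c) -mul_malgC mulr1.
rewrite cU [in LHS](monalgE z) mulr_suml [in RHS](monalgE z) scaler_sumr.
apply: eq_bigr => m _; rewrite malgM_def fgmulUU mulm1 mulrC.
exact/esym/scaleU.
Qed.

Lemma free_ind (T : F -> Prop) : T 1 ->
  (forall y z, T y -> T z -> T (y + z)) -> (forall c z, T z -> T (c *: z)) ->
  (forall z g, T z -> T (z * << fmu g >>)) -> forall z, T z.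
Proof.
move=> T1 TD TZ TM z.
rewrite (monalgE z); apply: (big_ind T) => // [|m _].
  by rewrite -(scale0r 1); apply: TZ.
rewrite -[monalg.mcoeff _ _]mulr1 -scaleU.
apply: TZ; case: m => s; elim/last_ind: s => [|s g IH].
  by have := T1; rewrite -[1]/(U (fmone G) 1) fmoneE.
rewrite (_ : U _ _ = U (FMonom s) 1 * << fmu g >>); first exact: TM.
rewrite malgM_def fgmulUU mulr1; congr U.
by apply/esym; rewrite -[LHS]/(fmmul (FMonom s) (fmu g)) fmmulE fmuE /= cats1.
Qed.

End FreeAlgebra.

(** * The cyclotomic algebra as an algebra of crossings *)

Section Evaluation.
Variables (K : fieldType) (n : nat) (F : lalgType K) (A : pzRingType).
Variables (t : {rmorphism F -> A}) (x : 'I_n -> F).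
Local Notation S := (mpoly n K).
Local Notation X := (X K).
Hypothesis x_comm : forall k l, t (x k) * t (x l) = t (x l) * t (x k).
Hypothesis scalar_comm : forall (c : K) z, t c%:A * z = z * t c%:A.

(** Evaluation passes through the free algebra, in which the variables do not
    commute; it becomes a ring morphism only after the map [t]. *)
Definition evaluate (f : S) : A := t (mpoly.mmap (in_alg F) x f).

Lemma evaluateC c : evaluate (mpolyC n c) = t c%:A.
Proof. by rewrite /evaluate mmapC. Qed.

Lemma evaluate_mon m : evaluate (mpolyX K m) = \prod_k t (x k) ^+ m k.
Proof.
rewrite /evaluate mmapX /mmap1 rmorph_prod.
by apply: eq_bigr => k _; rewrite rmorphXn.
Qed.

Lemma evaluateX k : evaluate (X k) = t (x k).
Proof. by rewrite /evaluate mmapX mmap1U. Qed.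

Lemma evaluateZ c f : evaluate (c *: f) = t c%:A * evaluate f.
Proof. by rewrite /evaluate mmapZ rmorphM. Qed.

Lemma evaluate_is_additive : zmod_morphism evaluate.
Proof. by move=> f g; rewrite /evaluate mmapB rmorphB. Qed.
HB.instance Definition _ := GRing.isZmodMorphism.Build S A evaluate
  evaluate_is_additive.

Lemma evaluateD f g : evaluate (f + g) = evaluate f + evaluate g.
Proof. exact: raddfD. Qed.

Lemma evaluate_XM k f : evaluate (X k * f) = t (x k) * evaluate f.
Proof.
elim/mpolyind: f => [|c m f _ _ IH]; first by rewrite mulr0 raddf0 mulr0.
rewrite mulrDr !evaluateD mulrDr IH; congr (_ + _).
rewrite -scalerAr !evaluateZ /X -mpolyXD !evaluate_mon mulrA -scalar_comm -mulrA.
congr (_ * _); rewrite -evaluateX evaluate_mon -prodrM_comm.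
  by apply: eq_bigr => l _; rewrite mnmDE exprD.
move=> i j _ _; apply/commrX/commr_sym/commrX; exact: x_comm.
Qed.

Lemma evaluate_is_multiplicative : monoid_morphism evaluate.
Proof.
split; first by rewrite -(mpolyC1 n K) evaluateC scale1r rmorph1.
elim/mpoly_gen_ind => [c|k|f1 f2 IH1 IH2|f1 f2 IH1 IH2] g.
- by rewrite mul_mpolyC evaluateZ evaluateC.
- by rewrite evaluate_XM evaluateX.
- by rewrite mulrDl !evaluateD mulrDl IH1 IH2.
- by rewrite -mulrA !IH1 IH2 mulrA.
Qed.
HB.instance Definition _ := GRing.isMonoidMorphism.Build S A evaluate
  evaluate_is_multiplicative.

Definition evaluation : {rmorphism S -> A} := evaluate.

Lemma evaluate_eval2 q k l :
  evaluate (eval2 q (X k) (X l)) = t (eval2 q (x k) (x l)).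
Proof.
rewrite /eval2 (raddf_sum evaluate) (rmorph_sum t); apply: eq_bigr => i _.
rewrite (raddf_sum evaluate) (rmorph_sum t); apply: eq_bigr => j _.
apply: etrans (evaluateZ _ _) _.
rewrite -[q`_i`_j *: _ in RHS]mulr_algl (rmorphM t) (rmorphM t) !(rmorphXn t).
congr (_ * _); rewrite -!evaluateX.
apply: etrans (rmorphM evaluate _ _) _.
by congr (_ * _); apply: (rmorphXn evaluate).
Qed.

End Evaluation.

Lemma mpoly_image_comm (K : fieldType) (n : nat) (A : pzRingType)
    (ev : {rmorphism mpoly n K -> A}) (e : A) :
  (forall c, ev (mpolyC n c) * e = e * ev (mpolyC n c)) ->
  (forall k, ev (X K k) * e = e * ev (X K k)) -> forall f, ev f * e = e * ev f.
Proof.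
move=> eC eX; elim/mpoly_gen_ind=> // f g Hf Hg.
  by rewrite (rmorphD ev) mulrDl mulrDr Hf Hg.
by rewrite (rmorphM ev) -mulrA Hg mulrA Hf mulrA.
Qed.

Section CrossingPastPolynomial.
Local Opaque divdiff1 msym.
Variables (K : fieldType) (n : nat) (A : pzRingType).
Local Notation S := (mpoly n K).
Local Notation X := (X K).
Variables (ev : {rmorphism S -> A}) (r : 'I_n.-1) (e p : A) (b : bool).
Hypothesis ev_e : forall f, ev f * e = e * ev f.
Hypothesis evC : forall c, ev (mpolyC n c) * p = p * ev (mpolyC n c).
Hypothesis p_hi : p * ev (X (hi r)) * e = (ev (X (lo r)) * p + b%:R) * e.
Hypothesis hi_p : ev (X (hi r)) * p * e = (p * ev (X (lo r)) + b%:R) * e.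
Hypothesis far_p : forall k, k != lo r -> k != hi r -> p * ev (X k) = ev (X k) * p.

(** The relations between a crossing and the variables extend to all polynomials,
    because the divided difference is a twisted derivation. *)
Lemma crossing_past_polynomial f :
  ev f * p * e = (p * ev (msym (sref r) f) - b%:R * ev (divdiff1 r f)) * e.
Proof.
elim/mpoly_gen_ind: f => [c|k|f g IHf IHg|f g IHf IHg].
- by rewrite msymC divdiff1_sym ?msymC // rmorph0 mulr0 subr0 evC.
- rewrite msym_X; have [->|kl] := eqVneq k (lo r).
    by rewrite sref_lo divdiff1_lo rmorph1 mulr1 mulrBl p_hi mulrDl addrK.
  have [->|kh] := eqVneq k (hi r).
    by rewrite sref_hi divdiff1_hi rmorphN1 mulrN1 opprK hi_p.
  by rewrite sref_neq // divdiff1_sym ?msym_X ?sref_neq // rmorph0 mulr0 subr0 far_p.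
- rewrite msymD divdiff1D !(rmorphD ev) (mulrDl (ev f)) mulrDl IHf IHg -mulrDl.
  by rewrite (mulrDr p) (mulrDr b%:R) opprD addrACA.
rewrite msymM divdiff1M [f * g]mulrC (rmorphM ev g f) -2!mulrA [ev f * _]mulrA IHf.
rewrite mulrBl mulrBr.
have -> : ev g * (p * ev (msym (sref r) f) * e) = ev g * p * e * ev (msym (sref r) f).
  by rewrite -[in RHS]mulrA -ev_e !mulrA.
rewrite IHg -(mulrA _ e) -ev_e mulrA [ev g * _]mulrA -mulrBl; congr (_ * e).
rewrite mulrBl -addrA -opprD [msym _ f * msym _ g]mulrC !(rmorphM ev) (rmorphD ev).
rewrite !(rmorphM ev) mulrA; congr (_ - _); first by rewrite !mulrA.
have bC : ev g * b%:R = b%:R * ev g by rewrite mulr_natr mulr_natl.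
rewrite bC mulrDr -!mulrA addrC.
have cm (u v : S) : ev u * ev v = ev v * ev u.
  by apply: etrans (esym (rmorphM ev u v)) (etrans _ (rmorphM ev v u)); rewrite mulrC.
by congr (_ * _ + _ * _); apply: cm.
Qed.

End CrossingPastPolynomial.

Section CyclotomicRelations.
Variables (K : fieldType) (I : choiceType) (P : zmodType) (alpha : I -> P).
Variables (Q : I -> I -> {poly {poly K}}) (n : nat) (beta : P).
Variables (h : I -> {additive P -> int}) (Lambda : P).
Local Notation Iseq := (Iseq alpha n beta).
Local Notation S := (mpoly n K).
Local Notation X := (X K).
Local Notation "ka @ k" := (tnth (val ka) k) (at level 9).
Local Notation F := (free_qh K alpha n beta).
Local Notation A := (cqhecke alpha Q n beta h Lambda).
Local Notation psi := (@fpsi K I P alpha n beta).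
Local Notation xx := (@fx K I P alpha n beta).
Local Notation ee := (@fe K I P alpha n beta).
Implicit Types (ka nu : Iseq) (r s : 'I_n.-1) (k l : 'I_n) (y z : F) (f : S).

Definition to_cqh : {rmorphism F -> A} :=
  @cqh_of K I P alpha Q n beta h Lambda \o @qh_of K I P alpha Q n beta.

Lemma to_cqh_rel y z : qh_rel Q y z -> to_cqh y = to_cqh z.
Proof.
move=> yz; apply: (congr1 (@cqh_of K I P alpha Q n beta h Lambda)).
by apply/quo_eqP => J [_]; apply; exists y, z.
Qed.

Lemma to_cqh_ind (T : A -> Prop) : (forall z, T (to_cqh z)) -> forall a, T a.
Proof.
move=> Tz a; rewrite -(generic_quotient.reprK a).
set b := generic_quotient.repr a; rewrite -(generic_quotient.reprK b).
exact: Tz.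
Qed.

Local Opaque fpsi fx fe.

Lemma to_cqh_x_comm k l : to_cqh (xx k) * to_cqh (xx l) = to_cqh (xx l) * to_cqh (xx k).
Proof. by rewrite -!(rmorphM to_cqh); apply/to_cqh_rel/qh_xx. Qed.

Lemma to_cqh_scalar_comm (c : K) (a : A) : to_cqh c%:A * a = a * to_cqh c%:A.
Proof.
elim/to_cqh_ind: a => z; rewrite -!(rmorphM to_cqh).
by rewrite mulr_algl; apply: (congr1 to_cqh); apply/esym/malgC_central.
Qed.

Definition pol_in : {rmorphism S -> A} :=
  evaluation to_cqh_x_comm to_cqh_scalar_comm.

Lemma pol_in_X k : pol_in (X k) = to_cqh (xx k).
Proof. exact: evaluateX. Qed.

Lemma pol_in_C c : pol_in (mpolyC n c) = to_cqh c%:A.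
Proof. exact: evaluateC. Qed.

Lemma pol_in_eval2 q k l :
  pol_in (eval2 q (X k) (X l)) = to_cqh (eval2 q (xx k) (xx l)).
Proof. exact: (evaluate_eval2 to_cqh_x_comm to_cqh_scalar_comm). Qed.

Local Opaque pol_in.
Local Notation e ka := (to_cqh (ee ka)).
Local Notation p r := (to_cqh (psi r)).
Let M y z : to_cqh (y * z) = to_cqh y * to_cqh z. Proof. exact: rmorphM. Qed.
Let D y z : to_cqh (y + z) = to_cqh y + to_cqh z. Proof. exact: rmorphD. Qed.
Let B y z : to_cqh (y - z) = to_cqh y - to_cqh z. Proof. exact: rmorphB. Qed.
Let del (b : bool) : to_cqh b%:R = b%:R. Proof. exact: rmorph_nat. Qed.

Let M3 y z w : to_cqh (y * z * w) = to_cqh y * to_cqh z * to_cqh w.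
Proof. by apply: etrans (M _ _) _; apply: (congr1 ( *%R^~ (to_cqh w))); apply: M. Qed.
Let MD y z (b : bool) w :
  to_cqh ((y * z + b%:R) * w) = (to_cqh y * to_cqh z + b%:R) * to_cqh w.
Proof.
apply: etrans (M _ _) _; apply: (congr1 ( *%R^~ (to_cqh w))).
by apply: etrans (D _ _) _; apply: (congr2 +%R); [apply: M|apply: del].
Qed.

Let MB y y' y'' z z' z'' w : to_cqh ((y * y' * y'' - z * z' * z'') * w) =
  to_cqh y * to_cqh y' * to_cqh y'' * to_cqh w - to_cqh z * to_cqh z' * to_cqh z'' * to_cqh w.
Proof.
apply: etrans (M _ _) (etrans _ (mulrBl _ _ _)); apply: (congr1 ( *%R^~ (to_cqh w))).
by apply: etrans (B _ _) _; apply: (congr2 (fun a b => a - b)); apply: M3.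
Qed.

Lemma ce_orth ka ka' : e ka * e ka' = (ka == ka')%:R * e ka.
Proof. apply: etrans (esym (M _ _)) (etrans (to_cqh_rel (qh_idem Q ka ka')) _).
by apply: etrans (M _ _) (congr1 ( *%R^~ (e ka)) (del _)). Qed.

Lemma cpsi_e r ka : p r * e ka = e (Iact (sref r) ka) * p r.
Proof. exact: etrans (esym (M _ _)) (etrans (to_cqh_rel (qh_psie Q r ka)) (M _ _)). Qed.

Lemma cx_e k ka : to_cqh (xx k) * e ka = e ka * to_cqh (xx k).
Proof. exact: etrans (esym (M _ _)) (etrans (to_cqh_rel (qh_xe Q k ka)) (M _ _)). Qed.

Lemma pol_in_e f ka : pol_in f * e ka = e ka * pol_in f.
Proof.
move: f; apply: (@mpoly_image_comm _ _ _ pol_in (e ka)) => [c|k].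
- by rewrite pol_in_C; apply: to_cqh_scalar_comm.
- by rewrite pol_in_X; apply: cx_e.
Qed.

Lemma cpsi_far r s : (r.+1 < s)%N || (s.+1 < r)%N -> p r * p s = p s * p r.
Proof. by move=> far; exact: etrans (esym (M _ _)) (etrans (to_cqh_rel (@qh_psipsi K I P alpha Q n beta r s far)) (M _ _)). Qed.

Lemma cpsi_sq r ka : p r * p r * e ka =
  pol_in (eval2 (Q (ka @ (lo r)) (ka @ (hi r))) (X (lo r)) (X (hi r))) * e ka.
Proof. rewrite pol_in_eval2; exact: etrans (esym (M3 _ _ _)) (etrans (to_cqh_rel (qh_psi2 Q r ka)) (M _ _)). Qed.

Lemma pol_in_psi f r ka : pol_in f * p r * e ka = (p r * pol_in (msym (sref r) f)
     - (ka @ (lo r) == ka @ (hi r))%:R * pol_in (divdiff1 r f)) * e ka.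
Proof.
move: f; apply: (@crossing_past_polynomial _ _ _ pol_in r (e ka) (p r) _) => [g|c|||k kl kh].
- exact: pol_in_e.
- by rewrite pol_in_C; apply: to_cqh_scalar_comm.
- rewrite !pol_in_X; exact: etrans (esym (M3 _ _ _)) (etrans (to_cqh_rel (qh_psix_hi Q r ka)) (MD _ _ _ _)).
- rewrite !pol_in_X; exact: etrans (esym (M3 _ _ _)) (etrans (to_cqh_rel (qh_xpsi_hi Q r ka)) (MD _ _ _ _)).
- rewrite pol_in_X; exact: etrans (esym (M _ _)) (etrans (to_cqh_rel (@qh_psix K I P alpha Q n beta r k kl kh)) (M _ _)).
Qed.

Hypothesis Qii : forall i, Q i i = 0.

(** In these two cases the right hand side of the braid relation vanishes: either the
    outer colours differ, or the polynomial [Q] is that of two equal colours. *)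
Lemma cpsi_braid r s ka : (s = r.+1 :> nat)%N ->
  ka @ (lo r) != ka @ (hi s) \/ ka @ (lo r) = ka @ (hi r) ->
  p s * p r * p s * e ka = p r * p s * p r * e ka.
Proof.
move=> sE no; apply: subr0_eq.
apply: etrans (esym (MB _ _ _ _ _ _ _)) _.
apply: etrans (to_cqh_rel (@qh_braid K I P alpha Q n beta r s ka sE)) _.
apply: etrans (M3 _ _ _) _.
suff R : to_cqh ((ka @ (lo r) == ka @ (hi s)) : bool)%:R = 0 \/
    divdiff (Q (ka @ (lo r)) (ka @ (hi r))) (xx (lo r)) (xx (hi r)) (xx (hi s)) = 0.
  apply: etrans (congr1 ( *%R^~ (e ka)) (_ : _ = 0)) (mul0r _).
  case: R => [R|R]; first exact: etrans (congr1 ( *%R^~ _) R) (mul0r _).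
  by rewrite R rmorph0 mulr0.
case: no => [/negPf no|eqr].
  by left; apply: etrans (del _) _; rewrite no.
by right; rewrite [X in Q X _]eqr Qii /divdiff size_poly0 big_ord0.
Qed.

Lemma cqh_ind (T : A -> Prop) : T 1 ->
  (forall a b, T a -> T b -> T (a + b)) ->
  (forall a f, T a -> T (a * pol_in f)) -> (forall a r, T a -> T (a * p r)) ->
  (forall a ka, T a -> T (a * e ka)) -> forall a, T a.
Proof.
move=> T1 TD Tf Tp Te; elim/to_cqh_ind; elim/free_ind => [|y z Ty Tz|c z Tz|z g Tz].
- by rewrite rmorph1.
- by apply: eq_ind (esym (D _ _)); apply: TD.
- have -> : to_cqh (c *: z) = to_cqh z * pol_in (mpolyC n c).
    rewrite pol_in_C; apply: etrans (congr1 to_cqh (esym (mulr_algl _ _))) _.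
    exact: etrans (M _ _) (to_cqh_scalar_comm _ _).
  exact: Tf.
apply: eq_ind (esym (M _ _)); case: g => [[r|k]|ka]; [exact: Tp| |exact: Te].
have := Tf _ (X k) Tz; rewrite pol_in_X; exact.
Qed.

End CyclotomicRelations.

(** * The longest words act on a test monomial by a sign *)

Section TopWord.
Variables (K : fieldType) (I : choiceType) (P : zmodType) (alpha : I -> P).
Variables (Q : I -> I -> {poly {poly K}}) (n : nat) (beta : P) (rk : I -> nat).
Local Notation Iseq := (Iseq alpha n beta).
Local Notation S := (mpoly n K).
Local Notation X := (X K).
Local Notation "ka @ k" := (tnth (val ka) k) (at level 9).
Local Notation V := (Iseq -> S).
Local Notation cross := (cross Q rk).
Local Opaque msym divdiff1 mpolyX.
Implicit Types (ka mu : Iseq) (r s t : 'I_n.-1) (w : 'S_n) (v : V) (f : S).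
Variable nut : Iseq.
Hypothesis nut_sorted : forall i j : 'I_n,
  (i <= j)%N -> (rk (nut @ i) <= rk (nut @ j))%N.
Hypothesis rk_inj : forall i j : 'I_n,
  rk (nut @ i) = rk (nut @ j) -> nut @ i = nut @ j.

Definition cross_fam r (v : V) : V :=
  fun ka => cross r (ka @ (lo r)) (ka @ (hi r)) (v (Iact (sref r) ka)).

Definition word_fam (u : seq 'I_n.-1) (v : V) : V := foldl (fun v r => cross_fam r v) v u.

(** If [w] preserves the order of the positions of each colour, then each
    crossing in a reduced word of [w] exchanges two colours in the order for
    which it acts by the coefficient 1. *)
Lemma word_fam_increasing (w : 'S_n) mu u (b : nat) v :
  (forall j k : 'I_n, (j < k)%N -> mu @ j = mu @ k -> (w j < w k)%N) ->
  Iact w mu = nut -> reduced_expr w u -> v nut = (-1) ^+ b ->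
  word_fam u v mu = (-1) ^+ b.
Proof.
move=> + + + vE; elim/last_ind: u w mu => [|u r IH] w mu inc wmu red.
  have w1 : w = 1%g by case: red => <- _; apply: word_perm_nil.
  by rewrite /= -vE -wmu w1 Iact1.
have [dr red'] := reduced_expr_rcons red.
have ne : mu @ (lo r) != mu @ (hi r).
  by apply/eqP => /(inc (lo r) (hi r) (ltnSn _)); rewrite ltnNge ltnW.
have lt_rk : (rk (mu @ (hi r)) < rk (mu @ (lo r)))%N.
  have := nut_sorted (ltnW dr); rewrite -wmu !tnth_Iact leq_eqVlt => /orP[/eqP eq_rk|//].
  have := @rk_inj (w (hi r)) (w (lo r)); rewrite -wmu !tnth_Iact => /(_ eq_rk) eq_mu.
  by rewrite eq_mu eqxx in ne.
have step : word_fam u v (Iact (sref r) mu) = (-1) ^+ b.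
  apply: (IH (sref r * w)%g) => //; last by rewrite Iact_srefM.
  move=> j k jk; rewrite !tnth_sref !permM.
  have [[-> ->]|/(sref_lt jk)] := eqVneq (j, k) (lo r, hi r); last exact: inc.
  by rewrite sref_lo sref_hi => eq_mu; rewrite eq_mu eqxx in ne.
rewrite /word_fam foldl_rcons -/(word_fam u v) /cross_fam step /cross (negPf ne).
rewrite /cross_coef lt_rk mul1r.
exact: etrans (rmorphXn (msym (sref r)) b (-1)) (congr1 (fun f : S => f ^+ b) (rmorphN1 _)).
Qed.

(** The exponents are the inversion numbers inside the blocks of [nut]. *)
Definition test_exp (w : 'S_n) (k : 'I_n) : nat :=
  #|[set l : 'I_n | [&& (k < l)%N, nut @ l == nut @ k & ((w^-1)%g l < (w^-1)%g k)%N]]%SET|.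

Definition test_mon (w : 'S_n) : S := \prod_k X k ^+ test_exp w k.

(** The inverse of [w] avoids the pattern 312 in each block. The longest permutation
    avoids it, and the condition is inherited when the first descent inside a block
    is undone. *)
Definition avoiding (w : 'S_n) := forall a b c : 'I_n,
  (a < b)%N -> (b < c)%N -> nut @ a = nut @ c ->
  ~ (((w^-1)%g b < (w^-1)%g c)%N && ((w^-1)%g c < (w^-1)%g a)%N).

Section FirstDescent.
Variables (w : 'S_n) (t : 'I_n.-1).
Local Notation v := (w^-1)%g.
Local Notation w1 := (w * sref t)%g.
Hypothesis eq_t : nut @ (lo t) = nut @ (hi t).
Hypothesis desc_t : descent v t.
Hypothesis first_t : forall t' : 'I_n.-1, (t' < t)%N ->
  nut @ (lo t') = nut @ (hi t') -> ~~ descent v t'.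
Hypothesis avoid : avoiding w.

Let v1E k : (w1^-1)%g k = v (sref t k).
Proof. by rewrite invMg srefV permM. Qed.

Lemma increasing_before (a b : 'I_n) : (a < b)%N -> (b <= t)%N -> nut @ a = nut @ b ->
  (v a < v b)%N.
Proof.
move=> ab bt eq_ab.
(* Beyond [t] the values are replaced by increasing ones, so that only the
   descents before [t] have to be excluded. *)
pose g (i : 'I_n) := (if i <= t then v i : nat else n + i)%N.
suff : (g a < g b)%N by rewrite /g bt (leq_trans (ltnW ab) bt).
apply: (@block_mono _ _ _ _ _ nut rk nut_sorted rk_inj (fun x y => x < y)%N) => //.
  by move=> y x z; apply: ltn_trans.
move=> t' eq_t'; rewrite /g /=; have [lt|le] := ltnP t' t.
  rewrite (ltnW lt) ltn_neqAle [(_ <= _)%N]leqNgt (first_t lt eq_t') andbT.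
  by rewrite (inj_eq (@ord_inj _)) (inj_eq perm_inj) lo_hi_neq.
case: ifP => [_|_]; last by rewrite ltn_add2l.
exact: leq_trans (ltn_ord _) (leq_addr _ _).
Qed.

Let nut_sref k : nut @ (sref t k) = nut @ k.
Proof. by rewrite /sref; case: tpermP => // ->. Qed.

(** A forbidden pattern that is created must use both positions of the descent;
    as it is the first one, the entries before it increase, and this rules out the
    remaining case. *)
Lemma avoiding_step : avoiding w1.
Proof.
move=> a b c ab bc eq_ac; rewrite !v1E => /andP[vbc vca].
have eq_ab : nut @ a = nut @ b.
  apply: (rk_inj (i := a)); apply/eqP; rewrite eqn_leq nut_sorted ?(ltnW ab) //=.
  by rewrite eq_ac nut_sorted // ltnW.
have [[aE bE]|ne_ab] := eqVneq (a, b) (lo t, hi t).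
  move: (ltn_trans vbc vca); rewrite aE bE sref_lo sref_hi.
  by move/ltnW; rewrite leqNgt -/(descent v t) desc_t.
have lt_ab := sref_lt ab ne_ab.
have [[bE cE]|ne_bc] := eqVneq (b, c) (lo t, hi t).
  move: vca; rewrite cE sref_hi sref_neq; last 2 first.
  - by rewrite -bE neq_ltn ab.
  - by rewrite -cE neq_ltn (ltn_trans ab bc).
  have := @increasing_before a (lo t); rewrite -bE ab => /(_ isT) => inc.
  by move/ltnW; rewrite leqNgt inc // bE /=.
have lt_bc := sref_lt bc ne_bc.
by apply: (avoid lt_ab lt_bc); rewrite ?nut_sref // vbc vca.
Qed.

Let gt_sref (l : 'I_n) : (hi t < l)%N -> sref t l = l.
Proof. by move=> lt; apply: sref_neq; rewrite neq_ltn; apply/orP; right; [exact: ltnW|]. Qed.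

Lemma test_exp_far k : k != lo t -> k != hi t -> test_exp w1 k = test_exp w k.
Proof.
move=> kl kh; rewrite /test_exp -(card_imset _ (@perm_inj _ (sref t))).
apply: eq_card => l; rewrite -[l in LHS](srefK t) mem_imset; last exact: perm_inj.
rewrite !inE !v1E srefK nut_sref [sref t k]sref_neq //; congr (_ && _).
have {}kl : k != t :> nat by [].
have {}kh : k != t.+1 :> nat by [].
by rewrite /sref; case: tpermP => [->|->|//] /=; lia.
Qed.

Lemma test_exp_hi : test_exp w (hi t) = test_exp w1 (lo t).
Proof.
apply: eq_card => l; rewrite !inE !v1E sref_lo eq_t.
have [lt|] := ltnP (hi t) l; first by rewrite gt_sref // (ltn_trans _ lt) /=.
rewrite leq_eqVlt => /orP[/eqP/ord_inj ->|le].
  by rewrite sref_hi ltnn [(v (lo t) < _)%N]ltnNge (ltnW desc_t) !andbF.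
by rewrite [(lo t < l)%N]ltnNge (le : l <= lo t)%N.
Qed.

Lemma test_exp_lo : test_exp w (lo t) = (test_exp w1 (hi t)).+1.
Proof.
rewrite /test_exp (cardsD1 (hi t)) inE ltnSn eq_t eqxx -/(descent v t) desc_t.
congr _.+1; apply: eq_card => l; rewrite !inE !v1E sref_hi.
have [lt|] := ltnP (hi t) l.
  by rewrite gt_sref // (ltn_trans _ lt) //= neq_ltn lt orbT.
rewrite leq_eqVlt => /orP[/eqP/ord_inj ->|le]; first by rewrite eqxx.
by rewrite [(lo t < l)%N]ltnNge (le : l <= lo t)%N andbF.
Qed.

(** No later entry lies between the two entries of the descent, since these three
    would form the forbidden pattern. *)
Lemma test_exp_eq : test_exp w1 (lo t) = test_exp w1 (hi t).
Proof.
apply: eq_card => l; rewrite !inE !v1E sref_lo sref_hi eq_t.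
have [lt|] := ltnP (hi t) l; last first.
  rewrite leq_eqVlt => /orP[/eqP/ord_inj ->|le].
    by rewrite sref_hi [(v (lo t) < _)%N]ltnNge (ltnW desc_t) !andbF.
  by rewrite [(lo t < l)%N]ltnNge (le : l <= lo t)%N.
rewrite gt_sref // (ltn_trans _ lt) //=; case: eqP => //= eq_l.
apply/idP/idP => [lt_l|lt_l]; first exact: ltn_trans lt_l desc_t.
rewrite ltnNge leq_eqVlt; apply/negP => /orP[/eqP/ord_inj/perm_inj hl|gt_l].
  by rewrite -hl ltnn in lt.
by apply: (avoid (ltnSn _ : (lo t < hi t)%N) lt); rewrite ?eq_t ?eq_l // gt_l lt_l.
Qed.

Let test_mon_split w' : test_mon w' =
  X (lo t) ^+ test_exp w' (lo t) * (X (hi t) ^+ test_exp w' (hi t) *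
    \prod_(k | (k != lo t) && (k != hi t)) X k ^+ test_exp w' k).
Proof.
rewrite /test_mon (bigD1 (lo t)) //=; congr (_ * _).
by rewrite (bigD1 (hi t)) 1?eq_sym ?lo_hi_neq.
Qed.

(** Undoing the descent removes one variable and leaves a monomial that is symmetric
    in the two variables, so the divided difference acts without remainder. *)
Lemma test_mon_step : test_mon w = X (lo t) * test_mon w1.
Proof.
rewrite !test_mon_split test_exp_lo test_exp_hi exprS test_exp_eq -mulrA.
congr (_ * (_ * (_ * _))); apply: eq_bigr => k /andP[kl kh].
by rewrite test_exp_far.
Qed.

Lemma test_mon_sym : msym (sref t) (test_mon w1) = test_mon w1.
Proof.
rewrite /test_mon rmorph_prod [RHS](reindex_inj (@perm_inj _ (sref t))) /=.
apply: eq_bigr => k _; rewrite rmorphXn /= msym_X; congr (_ ^+ _).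
rewrite /sref; case: tpermP => [->|->|//]; first by rewrite test_exp_eq.
by rewrite test_exp_eq.
Qed.

Lemma divdiff1_test_mon : divdiff1 t (test_mon w) = test_mon w1.
Proof.
rewrite test_mon_step divdiff1M divdiff1_lo mul1r.
by rewrite [divdiff1 t (test_mon _)]divdiff1_sym ?mulr0 ?addr0 ?test_mon_sym.
Qed.

End FirstDescent.

(** The word first undoes the descents inside the blocks, each by a divided
    difference of the test monomial, and then permutes the colours increasingly. *)
Lemma word_fam_test w mu : Iact w mu = nut -> avoiding w -> exists2 u,
  reduced_expr w u & forall v (b : nat), v nut = (-1) ^+ b * test_mon w ->
    exists b' : nat, word_fam u v mu = (-1) ^+ b'.
Proof.
have [m] := ubnP (perm_len w); elim: m w mu => // m IH w mu lt_m wmu avoid.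
pose desc (j : nat) := [exists t : 'I_n.-1,
  [&& t == j :> nat, nut @ (lo t) == nut @ (hi t) & descent w^-1%g t]].
have [ex_desc|no_desc] := pselect (exists j, desc j).
  have [j /existsP[t /and3P[/eqP tj /eqP eq_t desc_t]] min_j] := ex_minnP ex_desc.
  have first_t t' : (t' < t)%N -> nut @ (lo t') = nut @ (hi t') -> ~~ descent w^-1%g t'.
    move=> lt_t eq_t'; apply/negP => desc_t'.
    have : (j <= t')%N by apply: min_j; apply/existsP; exists t'; rewrite eqxx eq_t' eqxx.
    by rewrite leqNgt -tj lt_t.
  have lenE : perm_len w = (perm_len (w * sref t)%g).+1.
    by rewrite -perm_lenV (perm_len_desc desc_t) -(perm_lenV (w * _)%g) invMg srefV.
  have [|||u red_u uE] := IH (w * sref t)%g mu.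
  - by rewrite -lenE.
  - by rewrite -IactM wmu Iact_sref_id.
  - exact: avoiding_step.
  exists (t :: u).
    case: red_u => wE sz; split; first by rewrite word_perm_consM wE -mulgA sref2 mulg1.
    by rewrite lenE /= sz.
  move=> v b vE; apply: (uE _ b.+1).
  rewrite /cross_fam Iact_sref_id // vE /cross eq_t eqxx divdiff1M.
  rewrite (@divdiff1_sym _ _ t ((-1) ^+ b)); last first.
    exact: etrans (rmorphXn (msym (sref t)) b (-1)) (congr1 (fun f : S => f ^+ b) (rmorphN1 _)).
  rewrite mul0r add0r divdiff1_test_mon // exprS mulN1r mulNr; congr (- (_ * _)).
  exact: etrans (rmorphXn (msym (sref t)) b (-1)) (congr1 (fun f : S => f ^+ b) (rmorphN1 _)).
have asc t : nut @ (lo t) = nut @ (hi t) -> (w^-1%g (lo t) < w^-1%g (hi t))%N.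
  move=> eq_t; rewrite ltn_neqAle (inj_eq (@ord_inj _)) (inj_eq perm_inj) lo_hi_neq.
  rewrite [(_ <= _)%N]leqNgt; apply/negP => desc_t; apply: no_desc; exists t.
  by apply/existsP; exists t; rewrite eqxx eq_t eqxx.
have inc := @block_mono _ _ _ _ _ nut rk nut_sorted rk_inj (fun x y => x < y)%N
  (fun i => w^-1%g i : nat) (fun y x z => @ltn_trans y x z) asc.
have mon1 : test_mon w = 1.
  rewrite /test_mon big1 // => k _; rewrite /test_exp (_ : [set l | _]%SET = finset.set0) ?cards0 //.
  apply/setP => l; rewrite !inE; apply/negP => /and3P[kl /eqP eq_l].
  by rewrite ltnNge ltnW // inc.
have [u red_u] := reduced_expr_exists w; exists u => // v b; rewrite mon1 mulr1 => vE.
exists b; apply: (word_fam_increasing (w := w)) => // j k jk eq_jk.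
rewrite ltnNge leq_eqVlt; apply/negP => /orP[/eqP/ord_inj/perm_inj kj|gt].
  by rewrite kj ltnn in jk.
have := inc _ _ gt; rewrite !permK -wmu !tnth_Iact => /(_ (esym eq_jk)).
by rewrite ltnNge ltnW.
Qed.

End TopWord.

Section TopRelation.
Variables (K : fieldType) (I : choiceType) (P : zmodType) (alpha : I -> P).
Variables (Q : I -> I -> {poly {poly K}}) (n : nat) (beta : P).
Variables (h : I -> {additive P -> int}) (Lambda : P) (rk : I -> nat).
Local Notation Iseq := (Iseq alpha n beta).
Local Notation S := (mpoly n K).
Local Notation X := (X K).
Local Notation "ka @ k" := (tnth (val ka) k) (at level 9).
Local Notation F := (free_qh K alpha n beta).
Local Notation A := (cqhecke alpha Q n beta h Lambda).
Local Notation psi := (@fpsi K I P alpha n beta).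
Local Notation xx := (@fx K I P alpha n beta).
Local Notation ee := (@fe K I P alpha n beta).
Local Notation lam := (fun i => absz (h i Lambda)).
Local Notation genid := (genid Q rk lam).
Local Notation V := (Iseq -> S).
Local Notation act := (ract (@pol_step K I P alpha Q n beta rk)).
Local Notation to_cqh := (@to_cqh K I P alpha Q n beta h Lambda).
Local Notation word_fam := (@word_fam K I P alpha Q n beta rk).
Implicit Types (ka mu : Iseq) (v : V) (w : 'S_n) (f : S).

Hypothesis Qsym : forall i j, Q i j = swapXY (Q j i).
Hypothesis Qii : forall i, Q i i = 0.
Hypothesis rk_inj : forall ka i j, (rk (ka @ i) == rk (ka @ j)) = (ka @ i == ka @ j).
Hypothesis Iseq_finite : finite_set [set: Iseq].
Variable nut : Iseq.
Hypothesis nut_sorted : forall i j : 'I_n,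
  (i <= j)%N -> (rk (nut @ i) <= rk (nut @ j))%N.

Local Opaque fpsi fx fe.
Let step_lin := @pol_step_linear K I P alpha Q n beta rk.
Let actM := ractM step_lin.

Definition fword (u : seq 'I_n.-1) : F := foldr (fun r z => psi r * z) 1 u.

Lemma act_fword u v : act (fword u) v = word_fam u v.
Proof.
elim: u v => [|r u IH] v; first exact: ract1.
apply: etrans (actM _ _ _) _; apply: etrans (IH _) _.
by apply: (congr1 (word_fam u)); apply: act_psi.
Qed.

Lemma to_cqh_fword u :
  to_cqh (fword u) = \prod_(r <- u) to_cqh (psi r).
Proof.
elim: u => [|r u IH]; first by rewrite big_nil; apply: rmorph1.
rewrite big_cons; apply: etrans (rmorphM to_cqh _ _) _.
exact: (congr1 ( *%R _) IH).
Qed.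

Lemma act_by_mmap f : act_by Q rk (mpoly.mmap (in_alg F) xx f) f.
Proof.
rewrite {2}(mpolyE f) /mmap.
elim: (mpoly.msupp f) => [|m s IH]; first by rewrite !big_nil; apply: act_by0.
rewrite !big_cons; apply: act_byD => //.
rewrite mulr_algl; apply: act_byZ; rewrite mpolyXE_id /mmap1.
apply: (big_ind2 (fun z g => act_by Q rk z g)) => [|z1 g1 z2 g2|k _].
- exact: act_by1.
- exact: act_byM.
- exact/act_byX/act_by_x.
Qed.

(** The module over the cyclotomic algebra is applied to the test monomial: the
    longest word sends it to a sign, so the coefficient itself lies in the ideal. *)
Lemma top_word_genid w mu : Iact w mu = nut -> avoiding nut w -> exists2 u,
  reduced_expr w u & forall f,
    (\prod_(r <- u) to_cqh (psi r)) * pol_in alpha Q n beta h Lambda f * to_cqh (ee mu) = 0 ->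
    genid mu f.
Proof.
move=> wmu avoid.
have nut_inj i j : rk (nut @ i) = rk (nut @ j) -> nut @ i = nut @ j.
  by move/eqP; rewrite rk_inj => /eqP.
have [u red_u uE] := word_fam_test Q nut_sorted nut_inj wmu avoid.
exists u => // f; pose z := fword u * mpoly.mmap (in_alg F) xx f * ee mu.
have zE : to_cqh z = (\prod_(r <- u) to_cqh (psi r))
    * pol_in alpha Q n beta h Lambda f * to_cqh (ee mu).
  apply: etrans (rmorphM to_cqh _ _) _; apply: (congr1 ( *%R^~ _)).
  apply: etrans (rmorphM to_cqh _ _) _; apply: (congr1 ( *%R^~ _)).
  exact: to_cqh_fword.
move=> z0; pose v : V := fun ka => if ka == nut then test_mon K nut w else 0.
have vE : v nut = (-1) ^+ 0 * test_mon K nut w by rewrite /v eqxx expr0 mul1r.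
have [b bE] := uE v 0%N vE.
have := cqh_zero_act Qsym Qii rk_inj Iseq_finite (etrans zE z0) v mu.
have -> : act z v mu = f * word_fam u v mu.
  apply: etrans (congr1 (@^~ mu) (actM _ _ _)) _.
  apply: etrans (congr1 (@^~ mu) (act_e _ _ _ _)) _; rewrite eqxx.
  apply: etrans (congr1 (@^~ mu) (actM _ _ _)) _.
  apply: etrans (congr1 (@^~ mu) (act_by_mmap _ _)) _.
  by rewrite act_fword.
move=> Gf; have := genidM ((-1) ^+ b) Gf.
by rewrite bE mulrCA -exprMn mulrNN mul1r expr1n mulr1.
Qed.

End TopRelation.

(** * Normal forms in the corner *)

Section CornerNormalForm.
Variables (K : fieldType) (I : choiceType) (P : zmodType) (alpha : I -> P).
Variables (n : nat) (beta : P).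
Variables (Q : I -> I -> {poly {poly K}}) (rk lam : I -> nat) (deg : I -> I -> nat).
Local Notation Iseq := (Iseq alpha n beta).
Local Notation S := (mpoly n K).
Local Notation X := (X K).
Local Notation "ka @ k" := (tnth (val ka) k) (at level 9).
Variables (A : pzRingType) (ev : {rmorphism S -> A}).
Variables (e : Iseq -> A) (psi : 'I_n.-1 -> A).
Implicit Types (ka mu : Iseq) (w : 'S_n) (r s : 'I_n.-1) (k : 'I_n) (f : S).

Hypothesis e_orth : forall ka ka', e ka * e ka' = (ka == ka')%:R * e ka.
Hypothesis ev_e : forall f ka, ev f * e ka = e ka * ev f.
Hypothesis psi_e : forall r ka, psi r * e ka = e (Iact (sref r) ka) * psi r.
Hypothesis ev_psi : forall f r ka,
  ev f * psi r * e ka = (psi r * ev (msym (sref r) f)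
     - (ka @ (lo r) == ka @ (hi r))%:R * ev (divdiff1 r f)) * e ka.
Hypothesis psi_far : forall r s, (r.+1 < s)%N || (s.+1 < r)%N ->
  psi r * psi s = psi s * psi r.
Hypothesis psi_sq : forall r ka, psi r * psi r * e ka =
  ev (eval2 (Q (ka @ (lo r)) (ka @ (hi r))) (X (lo r)) (X (hi r))) * e ka.
Hypothesis psi_braid : forall r s ka, (s = r.+1 :> nat)%N ->
  ka @ (lo r) != ka @ (hi s) \/ ka @ (lo r) = ka @ (hi r) ->
  psi s * psi r * psi s * e ka = psi r * psi s * psi r * e ka.
Hypothesis A_ind : forall T : A -> Prop, T 1 ->
  (forall y z, T y -> T z -> T (y + z)) ->
  (forall z f, T z -> T (z * ev f)) -> (forall z r, T z -> T (z * psi r)) ->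
  (forall z ka, T z -> T (z * e ka)) -> forall z, T z.
Hypothesis cyclotomic : forall ka k, k = 0%N :> nat ->
  ev (X k ^+ lam (ka @ k)) * e ka = 0.

Hypothesis Qsym : forall i j, Q i j = swapXY (Q j i).
Hypothesis Qii : forall i, Q i i = 0.
Hypothesis Qdeg : forall i j : I, i != j -> size (Q i j) = (deg i j).+1 /\
  (Q i j)`_(deg i j)`_0 != 0.
Hypothesis Qlead : forall (i j : I) l, i != j -> (0 < l)%N -> (Q i j)`_(deg i j)`_l = 0.

Variable nut : Iseq.
Hypothesis nut_sorted : forall i j : 'I_n,
  (i <= j)%N -> (rk (nut @ i) <= rk (nut @ j))%N.
Hypothesis rk_inj : forall ka (i j : 'I_n), rk (ka @ i) = rk (ka @ j) -> ka @ i = ka @ j.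
Local Notation Psi := (Psi psi).
Local Notation annih := (annih ev e nut).
Local Notation genid := (genid Q rk lam).
Let nut_inj i j := @rk_inj nut i j.

Let Qp_eq0 r ka : ka @ (lo r) = ka @ (hi r) ->
  eval2 (Q (ka @ (lo r)) (ka @ (hi r))) (X (lo r)) (X (hi r)) = 0.
Proof. by move=> ->; rewrite Qii; apply: eval2_0. Qed.

Let annihE mu f : annih mu f -> forall w, Iact w mu = nut -> Psi w * ev f * e mu = 0.
Proof.
by move=> /(annihP e_orth ev_e psi_e ev_psi psi_far psi_sq psi_braid
  nut_sorted nut_inj A_ind).
Qed.

Lemma annih_ideal mu : is_ideal (annih mu).
Proof.
split; first by move=> z; rewrite rmorph0 mul0r mulr0.
  by move=> f g; apply: annihD.
by move=> f g; apply: annihM.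
Qed.

(** The relations of the corner are closed under the operations that generate
    [genid] from the cyclotomic relation. *)
Lemma genid_annih mu f : genid mu f -> annih mu f.
Proof.
move=> [u ->]; apply: (is_ideal_sum (annih_ideal mu)) => k _; apply: annihM.
move: mu k; apply: gen_in_family => //.
- exact: annih_ideal.
- by move=> ka k k0 z; rewrite cyclotomic ?mulr0.
- by move=> r ka g; apply: (annih_divdiff1 psi_e ev_psi psi_sq Qp_eq0).
- move=> r ka g; exact: (annih_up e_orth ev_e psi_e ev_psi psi_far psi_sq psi_braid
    nut_sorted nut_inj A_ind).
move=> r ka g lt_rk.
have ne : ka @ (lo r) != ka @ (hi r) by apply: contraTneq lt_rk => ->; rewrite ltnn.
move=> /(annih_down psi_e ev_psi psi_sq ne).
by rewrite !tnth_sref sref_lo sref_hi.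
Qed.

(** Some generator is then a nonzero scalar, and it annihilates the corner. *)
Lemma corner_eq0 mu k :
  (step_deg rk lam deg mu (mu @ k) k <= node_count mu (mu @ k) k)%N ->
  forall z, e nut * z * e mu = 0.
Proof.
move=> le_k z; have [k' [t [t0 genE]]] := unit_gen (Q := Q) Qdeg Qlead le_k.
have A1 : annih mu 1.
  have := annihM (mpolyC n t^-1) (genid_annih (genid_gen Q rk lam mu k')).
  by rewrite genE -mpolyCM mulVf // mpolyC1.
by have := A1 z; rewrite rmorph1 mul1r.
Qed.

Section Bounded.
Variable mu : Iseq.
Hypothesis le_deg : forall k,
  (node_count mu (mu @ k) k <= step_deg rk lam deg mu (mu @ k) k)%N.

Definition normal (f : S) :=
  forall m k, m \in msupp f -> (m k < gen_deg rk lam deg mu k)%N.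

Lemma corner_normal_span z : exists2 p : 'S_n -> S,
  e nut * z * e mu = \sum_(w | Iact w mu == nut) Psi w * ev (p w) * e mu &
  forall w, normal (p w).
Proof.
have [p pE] := corner_span e_orth ev_e psi_e ev_psi psi_far psi_sq psi_braid
  nut_sorted nut_inj A_ind mu z.
have /choice[q qP] : forall w, exists g, genid mu (p w - g) /\ normal g.
  by move=> w; have [g Gg ng] := normal_form Qdeg Qlead le_deg (p w); exists g.
exists q => [|w]; last by case: (qP w).
rewrite pE; apply: eq_bigr => w /eqP wmu; apply/eqP.
rewrite -subr_eq0 -mulrBl -mulrBr -rmorphB; apply/eqP.
apply: annihE wmu.
by apply: genid_annih; case: (qP w).
Qed.

Lemma top_perm_exists w : Iact w mu = nut ->
  exists2 v, Iact v mu = nut & top_perm nut v.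
Proof.
move=> wmu; have wP : Iact w mu == nut by apply/eqP.
case: (@arg_maxnP _ w (fun v => Iact v mu == nut) (@perm_len n) wP) => v /eqP vmu vmax; exists v => // t eq_t.
apply: contraT => asc; have := vmax (v * sref t)%g.
rewrite -IactM vmu Iact_sref_id // eqxx => /(_ isT); rewrite /geq /=.
by rewrite -(perm_lenV (v * _)%g) invMg srefV perm_len_asc // perm_lenV ltnn.
Qed.

Hypothesis top_genid : forall w f, Iact w mu = nut -> top_perm nut w ->
  Psi w * ev f * e mu = 0 -> genid mu f.

(** All coefficients of a relation annihilate the corner; by the longest word they
    then lie in [genid], where a normal form vanishes. *)
Lemma corner_normal_indep (p : 'S_n -> S) : (forall w, normal (p w)) ->
  \sum_(w | Iact w mu == nut) Psi w * ev (p w) * e mu = 0 ->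
  forall w, Iact w mu = nut -> p w = 0.
Proof.
move=> np rel w wmu.
have ann : annih mu (p w).
  apply: (annih_of_relation e_orth ev_e psi_e ev_psi psi_far psi_sq Qp_eq0 psi_braid
    nut_sorted nut_inj A_ind _ rel) => // v f vmu topv /(top_genid vmu topv).
  exact: genid_annih.
have [v vmu topv] := top_perm_exists wmu.
apply: (genid_normal Qdeg Qlead le_deg _ (np w)).
exact: (top_genid vmu topv) (annihE ann vmu).
Qed.

Variables (x : 'I_n -> A) (word : 'S_n -> seq 'I_n.-1).
Hypothesis ev_X : forall k, ev (X k) = x k.
Hypothesis word_red : forall w, Iact w mu = nut -> reduced_expr w (word w).
Local Notation index := ('S_n * {ffun 'I_n -> nat})%type.
Implicit Types (j : index) (ix : seq index).
Local Notation mnm_of r := [multinom (r : {ffun 'I_n -> nat}) i | i < n].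

Definition basis_elt j := (\prod_(r <- word j.1) psi r) * (\prod_k x k ^+ j.2 k) * e mu.

Definition basis_index j :=
  Iact j.1 mu = nut /\ forall k, (j.2 k < gen_deg rk lam deg mu k)%N.

Lemma mnm_ofK (m : 'X_{1..n}) : mnm_of [ffun i => m i] = m.
Proof. by apply/mnmP => i; rewrite mnmE ffunE. Qed.

Lemma mnm_of_inj : injective (fun r : {ffun 'I_n -> nat} => mnm_of r).
Proof.
move=> r r' eq_r; apply/ffunP => k.
by have := congr1 (fun m : 'X_{1..n} => m k) eq_r; rewrite !mnmE.
Qed.

Lemma basis_eltE (c : K) j : Iact j.1 mu = nut ->
  basis_elt j * ev (mpolyC n c) = Psi j.1 * ev (c *: mpolyX K (mnm_of j.2)) * e mu.
Proof.
move=> jmu; have monE : \prod_k x k ^+ j.2 k = ev (mpolyX K (mnm_of j.2)).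
  rewrite [mpolyX K _]mpolyXE_id rmorph_prod; apply: eq_bigr => k _.
  by rewrite mnmE rmorphXn -ev_X.
have PsiE := PsiE psi_e psi_far psi_braid nut_sorted nut_inj jmu (word_red jmu).
rewrite /basis_elt monE -!mulrA -ev_e (mulrA (ev _)) -rmorphM ev_e mulrA.
rewrite -/(psi_word psi (word j.1)) PsiE -mulrA -ev_e mulrC mul_mpolyC.
by [].
Qed.

Lemma basis_sumE ix (c : index -> K) :
  (forall j, j \in ix -> Iact j.1 mu = nut) ->
  \sum_(j <- ix) basis_elt j * ev (mpolyC n (c j)) =
  \sum_(w | Iact w mu == nut)
    Psi w * ev (\sum_(j <- ix | j.1 == w) c j *: mpolyX K (mnm_of j.2)) * e mu.
Proof.
move=> sP; rewrite big_seq (partition_big (fun j => j.1) (fun w => Iact w mu == nut)) /=.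
  apply: eq_bigr => w _; rewrite raddf_sum mulr_sumr mulr_suml [RHS]big_seq_cond.
  by apply: eq_bigr => j /andP[js /eqP <-]; rewrite basis_eltE ?sP.
by move=> j /sP ->.
Qed.

Lemma basis_indep ix (c : index -> K) : uniq ix ->
  (forall j, j \in ix -> basis_index j) ->
  \sum_(j <- ix) basis_elt j * ev (mpolyC n (c j)) = 0 ->
  forall j, j \in ix -> c j = 0.
Proof.
move=> us sP; rewrite basis_sumE; last by move=> j /sP[].
move/corner_normal_indep => p0 j js; have [jmu _] := sP j js.
have {}p0 : \sum_(i <- ix | i.1 == j.1) c i *: mpolyX K (mnm_of i.2) = 0.
  apply: p0 jmu => w m k; move/msupp_sum_le/flattenP => [l /mapP[i + ->]].
  rewrite mem_filter => /andP[_ i_s] /msuppZ_le; rewrite msuppX inE => /eqP->.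
  by rewrite mnmE; case: (sP i i_s).
have := congr1 (mcoeff (mnm_of j.2)) p0; rewrite mcoeff0 raddf_sum /= => <-.
rewrite -big_filter (bigD1_seq j) /=; last 2 first.
- by rewrite mem_filter eqxx js.
- exact: filter_uniq.
rewrite mcoeffZ mcoeffX eqxx mulr1 big_seq_cond big1 ?addr0 // => i.
rewrite mem_filter => /andP[/andP[/eqP eq1 _] ne].
rewrite mcoeffZ mcoeffX; case: eqP => [/mnm_of_inj eq2|]; last by rewrite mulr0.
by case/eqP: ne; case: i j eq1 eq2 {js jmu p0} => [? ?] [? ?] /= -> ->.
Qed.

Lemma basis_span z : exists ix (c : index -> K),
  (forall j, j \in ix -> basis_index j) /\
  e nut * z * e mu = \sum_(j <- ix) basis_elt j * ev (mpolyC n (c j)).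
Proof.
have [p -> np] := corner_normal_span z.
exists [seq (w, [ffun i => (m : 'X_{1..n}) i]) | w <- enum [pred w | Iact w mu == nut],
  m <- msupp (p w)], (fun j => mcoeff (mnm_of j.2) (p j.1)); split.
  move=> j /allpairsPdep[w [m [wP mp ->]]]; split=> [|k] /=.
    by apply/eqP; move: wP; rewrite mem_enum inE.
  by rewrite ffunE; apply: np mp.
rewrite big_allpairs_dep big_enum /=; apply: eq_bigr => w /eqP wmu.
rewrite {1}[p w]mpolyE raddf_sum mulr_sumr mulr_suml; apply: eq_bigr => m _.
by rewrite basis_eltE //= mnm_ofK.
Qed.

Lemma basis_elt_corner j : Iact j.1 mu = nut -> e nut * basis_elt j * e mu = basis_elt j.
Proof.
move=> jmu; have := basis_eltE 1 jmu; rewrite mpolyC1 rmorph1 mulr1 => ->.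
set g := ev _; have gE : Psi j.1 * g * e mu = e nut * (Psi j.1 * g).
  by rewrite -mulrA ev_e mulrA (Psi_e psi_e jmu) mulrA.
by rewrite -mulrA -(mulrA _ (e mu)) e_orth eqxx mul1r gE mulrA e_orth eqxx mul1r.
Qed.

End Bounded.
End CornerNormalForm.

(** * Colour sequences of a given weight *)

Section Weights.
Variables (I : choiceType) (P : zmodType) (alpha : I -> P) (n : nat) (beta : P).
Local Notation Iseq := (Iseq alpha n beta).
Implicit Types (ka mu : Iseq) (w : 'S_n).
Hypothesis indep : lin_indep (V := zmodule P) setT alpha.

Lemma sum_count (s t : seq I) : uniq s -> {subset t <= s} ->
  \sum_(i <- t) alpha i = \sum_(i <- s) alpha i *+ count_mem i t.
Proof.
move=> us ts; transitivity (\sum_(i <- t) \sum_(j <- s | j == i) alpha j).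
  rewrite big_seq [RHS]big_seq; apply: eq_bigr => i /ts i_s.
  by rewrite -big_filter filter_pred1_uniq // big_seq1.
rewrite (exchange_big_dep predT) //=; apply: eq_bigr => j _.
rewrite big_const_seq iter_addr addr0; congr (_ *+ _).
by apply: eq_count => i /=; rewrite eq_sym.
Qed.

(** As the simple roots are independent, the weight determines how often each
    colour occurs. *)
Lemma Iseq_perm ka mu : exists w, Iact w ka = mu.
Proof.
have [w wE] : exists w, Iact w mu = ka; last first.
  by exists w^-1%g; rewrite -wE IactM mulgV Iact1.
suff /tuple_permP[w wE] : perm_eq (val ka) (val mu).
  exists w^-1%g; apply/val_inj/eq_from_tnth => k; rewrite tnth_mktuple invgK.
  by have /val_inj -> := wE; rewrite tnth_mktuple.
pose s := undup (val ka ++ val mu : seq I).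
have us : uniq s by apply: undup_uniq.
have ka_s : {subset val ka <= s} by move=> i i_ka; rewrite mem_undup mem_cat i_ka.
have mu_s : {subset val mu <= s} by move=> i i_mu; rewrite mem_undup mem_cat i_mu orbT.
have sumE ka' : \sum_(i <- val ka') alpha i = beta.
  by rewrite big_tuple; apply/eqP; apply: (valP ka').
pose c i : int := (count_mem i (val ka))%:Z - (count_mem i (val mu))%:Z.
have c0 : forall i, i \in s -> c i = 0.
  apply: (indep us) => //.
  rewrite (_ : \sum_(j <- s) _ = \sum_(i <- val ka) alpha i - \sum_(i <- val mu) alpha i).
    by rewrite !sumE subrr.
  rewrite (sum_count us ka_s) (sum_count us mu_s) -sumrB; apply: eq_bigr => i _.
  exact: (mulrzBr (alpha i) (count_mem i (val ka))%:Z (count_mem i (val mu))%:Z).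
apply/allP => i i_s /=; apply/eqP; have := c0 i; rewrite mem_undup => /(_ i_s)/eqP.
by rewrite subr_eq0 => /eqP[].
Qed.

Lemma Iseq_finite ka : finite_set [set: Iseq].
Proof.
apply: (@sub_finite_set _ _ ((fun w => Iact w ka) @` [set: 'S_n])).
  by move=> mu _; have [w wE] := Iseq_perm ka mu; exists w.
exact/finite_image/finite_finset.
Qed.

End Weights.

(** * The blocks of the sorted sequence and the numbers of the theorem *)

Lemma nth_blocks (J T : eqType) (b : J -> nat) (c : J -> T) (x0 : T) (s : seq J) k :
  (k < sumn (map b s))%N -> exists2 l, (l < size s)%N &
    (sumn (map b (take l s)) <= k < sumn (map b (take l.+1 s)))%N /\
    forall j0, nth x0 (flatten [seq nseq (b i) (c i) | i <- s]) k = c (nth j0 s l).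
Proof.
elim: s k => //= j s IH k; have [small _|big lt] := ltnP k (b j).
  exists 0%N; rewrite //= take0 /= addn0 small; split=> // j0.
  by rewrite nth_cat size_nseq small nth_nseq small.
have [|l ls [kl nthE]] := IH (k - b j)%N; first by lia.
exists l.+1 => //=; split=> [|j0]; first by move: kl; rewrite /=; lia.
by rewrite nth_cat size_nseq ltnNge big /=; apply: nthE.
Qed.

Lemma psumE p (b : 'I_p -> nat) l : psum b l = sumn (map b (take l (enum 'I_p))).
Proof.
have -> : take l (enum 'I_p) = [seq i : 'I_p <- enum 'I_p | (i < l)%N].
  apply: (inj_map val_inj); rewrite map_take.
  rewrite -(filter_map val (fun i => i < l)%N) val_enum_ord take_iota.
  have [lt|le] := ltnP l p; first by rewrite -(filter_iota_ltn 0 (ltnW lt)).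
  by apply/esym/all_filterP/allP => i; rewrite mem_iota => /andP[_ ip]; apply: leq_trans ip le.
by rewrite sumnE big_map big_filter big_enum_cond.
Qed.

Lemma psum_mono p (b : 'I_p -> nat) l m : (l <= m)%N -> (psum b l <= psum b m)%N.
Proof.
move=> lm; rewrite /psum [leqLHS]big_mkcond [leqRHS]big_mkcond.
by apply: leq_sum => i _; case: ltnP => // il; rewrite (leq_trans il lm).
Qed.

Section Blocks.
Variables (I : choiceType) (P : zmodType) (alpha : I -> P) (n : nat) (beta : P).
Variables (p : nat) (b : 'I_p -> nat) (nu : 'I_p -> I).
Local Notation Iseq := (Iseq alpha n beta).
Local Notation "ka @ k" := (tnth (val ka) k) (at level 9).
Hypothesis b_sum : (\sum_(i < p) b i)%N = n.
Hypothesis nu_inj : injective nu.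
Variable nut : Iseq.
Hypothesis nutE : val nut = flatten [seq nseq (b i) (nu i) | i <- enum 'I_p] :> seq I.

Definition rank (c : I) := index c (codom nu).

Lemma rank_nu i : rank (nu i) = i.
Proof. by rewrite /rank index_map // index_enum_ord. Qed.

Lemma block_of (k : 'I_n) : exists2 i : 'I_p,
  nut @ k = nu i & (psum b i <= k < psum b i.+1)%N.
Proof.
have lt : (k < sumn (map b (enum 'I_p)))%N.
  by rewrite sumnE big_map big_enum /= b_sum.
have [l] := nth_blocks nu (nut @ k) lt; rewrite size_enum_ord => lp [kl nthE].
exists (Ordinal lp); last by rewrite !psumE.
rewrite (tnth_nth (nut @ k)) nutE (nthE (Ordinal lp)); congr nu.
exact: (nth_ord_enum (Ordinal lp) (Ordinal lp)).
Qed.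

Lemma ltn_psum (k : 'I_n) l : (k < psum b l)%N = (rank (nut @ k) < l)%N.
Proof.
have [i -> /andP[ge lt]] := block_of k; rewrite rank_nu.
apply/idP/idP => [lt_l|il]; last exact: leq_trans lt (psum_mono b il).
by rewrite ltnNge; apply/negP => /(psum_mono b); rewrite leqNgt (leq_ltn_trans ge lt_l).
Qed.

Lemma in_block (k : 'I_n) i : (psum b i <= k < psum b i.+1)%N = (rank (nut @ k) == i).
Proof. by rewrite leqNgt !ltn_psum ltnS -leqNgt eqn_leq andbC. Qed.

Lemma rank_sorted (i j : 'I_n) : (i <= j)%N -> (rank (nut @ i) <= rank (nut @ j))%N.
Proof.
by move=> ij; rewrite -ltnS -ltn_psum; apply: leq_ltn_trans ij _; rewrite ltn_psum.
Qed.

Lemma rank_inj (ka : Iseq) i j : (exists w, Iact w ka = nut) ->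
  rank (ka @ i) = rank (ka @ j) -> ka @ i = ka @ j.
Proof.
move=> [w wka]; rewrite -!(tnth_Iact w ka) wka.
have [a -> _] := block_of (w i); have [a' -> _] := block_of (w j).
by rewrite !rank_nu => /ord_inj ->.
Qed.

Lemma young_nut w : w \in young n b -> Iact w nut = nut.
Proof.
rewrite inE => /forallP wP; apply/Iact_eqP => k.
have [i ik /[dup] bk] := block_of k.
have /forallP/(_ k)/implyP wk := wP i; move=> /wk; rewrite in_block.
have [j jk _] := block_of (w k); rewrite ik jk rank_nu => /eqP/ord_inj -> //.
Qed.

Lemma sref_young t : nut @ (lo t) = nut @ (hi t) -> sref t \in young n b.
Proof.
move=> eq_t; rewrite inE; apply/forallP => i; apply/forallP => k; apply/implyP.
by rewrite !in_block -tnth_sref Iact_sref_id.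
Qed.

Section MinimalRepresentative.
Variable mu : Iseq.
Hypothesis ex_w : exists w, Iact w mu = nut.
Local Notation d := (d_min b (val nut) (val mu)).

(** A shortest representative has no descent inside a block, since exchanging the
    two positions would give a shorter one in the same coset. *)
Lemma d_minP : Iact d mu = nut /\
  forall t, nut @ (lo t) = nut @ (hi t) -> ~~ descent d^-1%g t.
Proof.
rewrite /d_min; case: pickP => [v /andP[/eqP vmu /forallP vmin]|none] /=.
  split=> [|t eq_t]; first exact: val_inj.
  apply/negP => dt.
  have /implyP/(_ (sref_young eq_t)) := vmin (sref t).
  by rewrite -perm_lenV (perm_len_desc dt) -(perm_lenV (v * _)%g) invMg srefV ltnn.
have [w /eqP wmu] := ex_w.
case: (@arg_minnP _ w (fun v => Iact v mu == nut) (@perm_len n) wmu) => v vmu vmin.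
case/negP: (negbT (none v)); apply/andP; split; first by rewrite -(inj_eq val_inj) in vmu.
apply/forallP => y; apply/implyP => yP; apply: vmin.
by rewrite -IactM (eqP vmu) young_nut.
Qed.

Lemma d_min_lt (j k : 'I_n) : (j < k)%N ->
  (d j < d k)%N = (rank (mu @ j) <= rank (mu @ k))%N.
Proof.
have := d_minP; move: (d) => v [dmu asc] jk.
have nutd i : nut @ (v i) = mu @ i by rewrite -[in LHS]dmu tnth_Iact.
have nut_inj i i' : rank (nut @ i) = rank (nut @ i') -> nut @ i = nut @ i'.
  by apply: rank_inj; exists 1%g; apply: Iact1.
have inc := @block_mono _ _ _ _ _ nut rank rank_sorted nut_inj (fun x y => x < y)%N
  (fun i => v^-1%g i : nat) (fun y x z => @ltn_trans y x z).
apply/idP/idP => [/ltnW/rank_sorted|le_rk]; first by rewrite !nutd.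
have [//|] := ltnP (v j) (v k); rewrite leq_eqVlt => /orP[/eqP/ord_inj/perm_inj kj|lt].
  by rewrite kj ltnn in jk.
have := rank_sorted (ltnW lt); rewrite !nutd => ge_rk.
have eq_jk : nut @ (v k) = nut @ (v j).
  by apply: nut_inj; rewrite !nutd; apply/eqP; rewrite eqn_leq le_rk ge_rk.
have asc' t : nut @ (lo t) = nut @ (hi t) -> (v^-1%g (lo t) < v^-1%g (hi t))%N.
  move=> /asc; rewrite /descent -leqNgt leq_eqVlt => /orP[|//].
  by rewrite (inj_eq (@ord_inj _)) (inj_eq perm_inj) (negPf (lo_hi_neq t)).
by have := inc asc' _ _ lt eq_jk; rewrite !permK ltnNge ltnW.
Qed.

Variables (a : I -> I -> int) (h : I -> {additive P -> int}) (Lambda : P).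
Hypothesis gcm : is_gcm a.
Hypothesis h_alpha : forall i j, h i (alpha j) = a i j.
Hypothesis dominant : Pplus h Lambda.

(** By [d_min_lt] the sum in [Nw] runs over the earlier positions of smaller rank
    and over those of the same colour; each of the latter contributes 2, of which the
    correction term in [Nmu] gives back 1. *)
Lemma NmuE k : Nmu alpha h Lambda b (val nut) (val mu) k =
  (step_deg rank (fun i => absz (h i Lambda)) (fun i j => absz (- a i j)) mu (mu @ k) k)%:Z
  - (node_count mu (mu @ k) k)%:Z.
Proof.
have [a_diag a_off _] := gcm.
rewrite /Nmu /Nw raddfB raddf_sum /=.
under eq_bigr do rewrite h_alpha.
rewrite (eq_bigl (fun j : 'I_n => (j < k)%N && (rank (mu @ j) <= rank (mu @ k))%N)); last first.
  by move=> j; case: (ltnP j k) => //= jk; rewrite d_min_lt.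
rewrite (bigID (fun j : 'I_n => mu @ j == mu @ k)) /=.
rewrite (eq_bigl (fun j : 'I_n => (j < k)%N && (mu @ j == mu @ k))); last first.
  by move=> j; rewrite -andbA; case: eqP => [->|_]; rewrite ?leqnn ?andbF.
have -> : \sum_(j < n | (j < k)%N && (mu @ j == mu @ k)) a (mu @ k) (mu @ j) =
    2 * (node_count mu (mu @ k) k)%:Z.
  rewrite /node_count -[X in 2 * X]natz mulr_natr -sumr_const.
  apply: eq_big => [j|j /andP[_ /eqP->]]; first by rewrite inE.
  exact: a_diag.
rewrite /step_deg PoszD gez0_abs ?dominant // (big_morph Posz PoszD (erefl 0%:Z)).
set c := (node_count _ _ _)%:Z.
suff -> : \sum_(j < n | (j < k)%N && (rank (mu @ j) < rank (mu @ k))%N)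
      (absz (- a (mu @ k) (mu @ j)))%:Z =
    - \sum_(j < n | [&& (j < k)%N, (rank (mu @ j) <= rank (mu @ k))%N & mu @ j != mu @ k])
        a (mu @ k) (mu @ j).
  under [in LHS]eq_bigl do rewrite -andbA.
  set u := \sum_(j < n | _) _.
  transitivity (h (mu @ k) Lambda - (2 * c + u) + c); last by ring.
  congr (_ - (_ + _) + _); rewrite /c /node_count; congr Posz.
  apply: eq_card => j; rewrite [RHS]inE.
  by apply/idP/idP => [/set_mem|H]; last exact: mem_set.
rewrite -sumrN; apply: eq_big => [j|j /andP[_ lt]].
  congr (_ && _); rewrite ltn_neqAle andbC; congr (_ && ~~ _).
  by apply/eqP/eqP => [/(rank_inj ex_w)|->].
rewrite gez0_abs // oppr_ge0 a_off //.
by apply: contraTneq lt => ->; rewrite ltnn.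
Qed.

End MinimalRepresentative.
End Blocks.

Section QPolynomials.
Variables (I : choiceType) (a : I -> I -> int) (d : I -> nat).
Variables (P : zmodType) (alpha : I -> P) (h : I -> {additive P -> int}).
Variables (form : P -> P -> rat) (K : fieldType) (Q : I -> I -> {poly {poly K}}).
Hypothesis gcm : is_gcm a.
Hypothesis sym : symmetrizes d a.
Hypothesis pairing : is_pairing a d alpha h form.
Hypothesis qpolys : is_qpolys a alpha form Q.
Local Notation deg i j := (absz (- a i j)).

(** The homogeneity condition, divided by 2. *)
Lemma Q_exponents (i j : I) l m : i != j -> (Q i j)`_l`_m != 0 ->
  ((d i * l + d j * m = d i * deg i j)%N).
Proof.
move=> ij nz; have [a_diag a_off _] := gcm; have [_ _ fE _] := pairing.
have [_ /(_ i j l m ij nz) + _ _] := qpolys.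
have -> : form (alpha i) (alpha j) = ((d i)%:Z * a i j)%:~R.
  by have [fC _ _ _] := pairing; rewrite fC fE.
rewrite !fE !a_diag => R.
have {R} : (l%:Z * ((d i)%:Z * 2) + m%:Z * ((d j)%:Z * 2) + 2 * ((d i)%:Z * a i j))%:~R = 0 :> rat.
  by rewrite -R !rmorphD !rmorphM.
move/eqP; rewrite intr_eq0 => /eqP E.
have aE : a i j = - (deg i j)%:Z by rewrite gez0_abs ?opprK // oppr_ge0 a_off.
by move: E; rewrite aE; nia.
Qed.

Lemma Q_deg (i j : I) : i != j -> size (Q i j) = (deg i j).+1 /\ (Q i j)`_(deg i j)`_0 != 0.
Proof.
move=> ij; have [_ _ lead _] := qpolys; have {}lead := lead i j ij; split=> //.
have [d_gt0 _] := sym; have := d_gt0 i => di.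
apply/eqP; rewrite eqn_leq; apply/andP; split; last first.
  rewrite ltnNge; apply/negP => le.
  by rewrite (nth_default _ le) coef0 eqxx in lead.
apply/leq_sizeP => l lt; apply/polyP => m; rewrite coef0; apply/eqP.
by apply: contraLR lt => /(Q_exponents ij); rewrite -leqNgt; nia.
Qed.

Lemma Q_lead (i j : I) m : i != j -> (0 < m)%N -> (Q i j)`_(deg i j)`_m = 0.
Proof.
move=> ij m0; apply/eqP; apply: contraLR m0 => /(Q_exponents ij).
by have [d_gt0 _] := sym; have := d_gt0 j; rewrite -leqNgt; nia.
Qed.

End QPolynomials.

(** * The basis of the corner *)

Lemma mul_past (A : pzRingType) (x x' y z : A) :
  y * z = z * y -> x * z = x' * z -> x * y * z = x' * y * z.
Proof. by move=> yz xz; rewrite -!mulrA yz !mulrA xz. Qed.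

Section CyclotomicCorner.
Variables (I : choiceType) (a : I -> I -> int) (d : I -> nat) (P : zmodType).
Variables (alpha : I -> P) (h : I -> {additive P -> int}) (form : P -> P -> rat).
Variables (K : fieldType) (Q : I -> I -> {poly {poly K}}) (Lambda : P).
Variables (n : nat) (beta : P) (p : nat) (b : 'I_p -> nat) (nu : 'I_p -> I).
Local Notation Iseq := (Iseq alpha n beta).
Local Notation S := (mpoly n K).
Local Notation "ka @ k" := (tnth (val ka) k) (at level 9).
Variables nut mu : Iseq.
Hypothesis gcm : is_gcm a.
Hypothesis sym : symmetrizes d a.
Hypothesis real : is_realization a alpha h.
Hypothesis pairing : is_pairing a d alpha h form.
Hypothesis qpolys : is_qpolys a alpha form Q.
Hypothesis dominant : Pplus h Lambda.
Hypothesis b_sum : (\sum_(i < p) b i)%N = n.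
Hypothesis nu_inj : injective nu.
Hypothesis nutE : val nut = flatten [seq nseq (b i) (nu i) | i <- enum 'I_p] :> seq I.
Local Notation deg := (fun i j => absz (- a i j)).
Local Notation lam := (fun i => absz (h i Lambda)).
Local Notation rk := (rank nu).
Local Notation A := (cqhecke alpha Q n beta h Lambda).
Local Notation to_cqh := (@to_cqh K I P alpha Q n beta h Lambda).
Local Notation ev := (@pol_in K I P alpha Q n beta h Lambda).
Local Notation e := (fun ka : Iseq => to_cqh (fe K ka)).
Local Notation psi := (fun r => to_cqh (fpsi K alpha beta r)).
Local Notation N k := (Nmu alpha h Lambda b (val nut) (val mu) k).

Let indep : lin_indep (V := zmodule P) setT alpha. Proof. by case: real. Qed.
Let h_alpha i j : h i (alpha j) = a i j. Proof. by case: real. Qed.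
Let Qii i : Q i i = 0. Proof. by case: qpolys. Qed.
Let Qsym i j : Q i j = swapXY (Q j i). Proof. by case: qpolys. Qed.
Let Qdeg (i j : I) (ij : i != j) := Q_deg gcm sym pairing qpolys ij.
Let Qlead (i j : I) l (ij : i != j) := @Q_lead _ _ _ _ _ _ _ _ _ gcm sym pairing qpolys i j l ij.
Let nut_sorted := rank_sorted b_sum nu_inj nutE.
Let rk_inj (ka : Iseq) (i j : 'I_n) : rk (ka @ i) = rk (ka @ j) -> ka @ i = ka @ j.
Proof. exact: (rank_inj b_sum nu_inj nutE (Iseq_perm indep ka nut)). Qed.
Let rk_eq (ka : Iseq) (i j : 'I_n) : (rk (ka @ i) == rk (ka @ j)) = (ka @ i == ka @ j).
Proof. by apply/eqP/eqP => [/rk_inj|->]. Qed.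
Let nut_inj (i j : 'I_n) := @rk_inj nut i j.

(** The integers of the theorem are the degrees of the generators, as soon as these
    are not negative. *)
Lemma corner_degree k : N k = (step_deg rk lam deg mu (mu @ k) k)%:Z
  - (node_count mu (mu @ k) k)%:Z.
Proof.
exact: (NmuE b_sum nu_inj nutE (Iseq_perm indep mu nut) gcm h_alpha dominant).
Qed.

Lemma top_perm_avoiding w : top_perm nut w -> avoiding nut w.
Proof.
move=> top i j k ij jk eq_ik /andP[lt1 _].
have eq_jk : nut @ j = nut @ k.
  by rewrite -eq_ik; apply: (nut_convex nut_sorted nut_inj _ eq_ik); rewrite (ltnW ij) ltnW.
have := @block_mono _ _ _ _ _ nut rk nut_sorted nut_inj (fun x y => y < x)%N
  (fun i => w^-1%g i : nat) (fun y x z H1 H2 => @ltn_trans y z x H2 H1) top j k jk eq_jk.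
by rewrite ltnNge ltnW.
Qed.

Let psi_e := @cpsi_e K I P alpha Q n beta h Lambda.
Let psi_far := @cpsi_far K I P alpha Q n beta h Lambda.
Let psi_braid := @cpsi_braid K I P alpha Q n beta h Lambda Qii.
Let e_orth := @ce_orth K I P alpha Q n beta h Lambda.
Let ev_e := @pol_in_e K I P alpha Q n beta h Lambda.
Let ev_psi := @pol_in_psi K I P alpha Q n beta h Lambda.
Let psi_sq := @cpsi_sq K I P alpha Q n beta h Lambda.
Let A_ind := @cqh_ind K I P alpha Q n beta h Lambda.

Lemma top_genid w (f : S) : Iact w mu = nut -> top_perm nut w ->
  Psi psi w * ev f * e mu = 0 -> genid Q rk lam mu f.
Proof.
move=> wmu top rel.
have [u red_u] := top_word_genid h Lambda Qsym Qii rk_eq (Iseq_finite indep nut) nut_sorted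
  wmu (top_perm_avoiding top).
apply; refine (etrans (@mul_past A _ _ _ _ (ev_e f mu) _) rel).
exact: (PsiE psi_e psi_far psi_braid nut_sorted nut_inj wmu red_u).
Qed.

Lemma cyclotomic_relation (ka : Iseq) (k : 'I_n) : k = 0%N :> nat ->
  ev (X K k ^+ lam (ka @ k)) * e ka = 0.
Proof.
move=> k0.
apply: etrans (congr1 ( *%R^~ _) (rmorphXn ev _ _)) _.
rewrite pol_in_X.
have R : @cqh_of K I P alpha Q n beta h Lambda (@qh_of K I P alpha Q n beta (fx K alpha beta k)
      ^+ lam (ka @ k) * @qh_of K I P alpha Q n beta (fe K ka)) =
    @cqh_of K I P alpha Q n beta h Lambda 0.
  by apply/quo_eqP; rewrite subr0 => J [_]; apply; exists k, ka.
apply: etrans (etrans R (rmorph0 _)).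
apply: etrans _ (esym (rmorphM _ _ _)); apply: (congr1 ( *%R^~ _)).
exact: (esym (rmorphXn (@cqh_of K I P alpha Q n beta h Lambda) _
  (@qh_of K I P alpha Q n beta (fx K alpha beta k)))).
Qed.

Lemma corner_vanish k : N k <= 0 -> forall z, e nut * z * e mu = 0.
Proof.
rewrite corner_degree subr_le0 lez_nat => le_k.
exact: (corner_eq0 e_orth ev_e psi_e ev_psi psi_far psi_sq psi_braid A_ind
  cyclotomic_relation Qsym Qii Qdeg Qlead nut_sorted rk_inj le_k).
Qed.

Section Positive.
Hypothesis N_gt0 : forall k, 0 < N k.
Variable word : 'S_n -> seq 'I_n.-1.
Hypothesis word_red : forall w, Iact w mu = nut -> reduced_expr w (word w).
Local Notation x := (fun k : 'I_n => to_cqh (fx K alpha beta k)).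
Local Notation index := ('S_n * {ffun 'I_n -> nat})%type.

Let le_deg k : (node_count mu (mu @ k) k <= step_deg rk lam deg mu (mu @ k) k)%N.
Proof. by have := N_gt0 k; rewrite corner_degree subr_gt0 ltz_nat => /ltnW. Qed.

Let degE k (m : nat) : (m < gen_deg rk lam deg mu k)%N = (m%:Z < N k).
Proof. by rewrite corner_degree subzn ?ltz_nat. Qed.

Let ev_X k : ev (X K k) = x k. Proof. exact: pol_in_X. Qed.

Local Notation elt := (basis_elt e psi mu x word).

Lemma corner_indep (ix : seq index) (c : index -> K) : uniq ix ->
  (forall j, j \in ix -> Iact j.1 mu = nut /\ forall k, (j.2 k)%:Z < N k) ->
  \sum_(j <- ix) elt j * ev (mpolyC n (c j)) = 0 -> forall j, j \in ix -> c j = 0.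
Proof.
move=> us sP; apply: (basis_indep e_orth ev_e psi_e ev_psi psi_far psi_sq psi_braid A_ind
  cyclotomic_relation Qsym Qii Qdeg Qlead nut_sorted rk_inj le_deg top_genid ev_X word_red us).
by move=> j /sP[jmu jN]; split=> // k; rewrite degE.
Qed.

Lemma corner_span_basis z : exists (ix : seq index) (c : index -> K),
  (forall j, j \in ix -> Iact j.1 mu = nut /\ forall k, (j.2 k)%:Z < N k) /\
  e nut * z * e mu = \sum_(j <- ix) elt j * ev (mpolyC n (c j)).
Proof.
have [ix [c [ixP zE]]] := basis_span e_orth ev_e psi_e ev_psi psi_far psi_sq psi_braid A_ind
  cyclotomic_relation Qsym Qii Qdeg Qlead nut_sorted rk_inj le_deg ev_X word_red z.
exists ix, c; split; last exact: zE.
by move=> j /ixP[jmu jN]; split=> // k; rewrite -degE.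
Qed.

Lemma elt_corner (j : index) : Iact j.1 mu = nut -> e nut * elt j * e mu = elt j.
Proof.
exact: (basis_elt_corner e_orth ev_e psi_e psi_far psi_braid nut_sorted rk_inj ev_X word_red).
Qed.

Let scaleE (c : K) (y : A) : c *: y = y * ev (mpolyC n c).
Proof.
rewrite pol_in_C; exact: to_cqh_scalar_comm.
Qed.

Lemma corner_basis : is_basis (R := K) (corner Q h Lambda nut mu)
  [set wr : index | Iact wr.1 mu = nut /\ forall k, (wr.2 k)%:Z < N k] elt.
Proof.
split.
- by move=> j [jmu _]; exists (elt j); [|exact: elt_corner jmu].
- move=> ix c us ixD sum0; apply: (corner_indep us) => [j j_ix|]; first exact: ixD.
  by apply: etrans sum0; apply: eq_bigr => j _; rewrite scaleE.
move=> _ [y _ <-]; have [ix [c [ixP yE]]] := corner_span_basis y.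
exists ix, c; split; first exact: ixP.
by apply: etrans yE _; apply: eq_bigr => j _; rewrite scaleE.
Qed.

Lemma corner_neq0 : corner Q h Lambda nut mu <> [set 0].
Proof.
have [w wmu] := Iseq_perm indep mu nut; pose j0 : index := (w, [ffun=> 0%N]).
have j0P : Iact j0.1 mu = nut /\ forall k, (j0.2 k)%:Z < N k.
  by split=> // k; rewrite ffunE.
move=> cE; have [inU indepU _] := corner_basis.
have elt0 : elt j0 = 0 by have := inU j0 j0P; rewrite cE.
have one0 : 1 = 0 :> K; last by have := oner_neq0 K; rewrite one0 eqxx.
apply: (indepU [:: j0] (fun=> 1) isT _ _ j0 (mem_head _ _)).
  by move=> j; rewrite /= inE => /eqP->.
by rewrite big_seq1 elt0 scaler0.
Qed.

End Positive.

End CyclotomicCorner.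

Theorem theorem1p5 (I : choiceType) (a : I -> I -> int) (d : I -> nat)
    (P : zmodType) (alpha : I -> P) (h : I -> {additive P -> int})
    (form : P -> P -> rat) (K : fieldType) (Q : I -> I -> {poly {poly K}})
    (Lambda : P) (n : nat) (beta : P)
    (p : nat) (b : 'I_p -> nat) (nu : 'I_p -> I)
    (nut mu : Iseq alpha n beta) :
  is_gcm a -> symmetrizes d a ->
  is_realization a alpha h -> is_pairing a d alpha h form ->
  is_qpolys a alpha form Q ->
  Pplus h Lambda -> Qplus alpha n beta ->
  (\sum_(i < p) b i)%N = n -> injective nu ->
  val nut = flatten [seq nseq (b i) (nu i) | i <- enum 'I_p] :> seq I ->
  let N (k : 'I_n) := Nmu alpha h Lambda b (val nut) (val mu) k in
  (corner Q h Lambda nut mu <> [set 0] <-> forall k, 0 < N k) /\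
  ((forall k, 0 < N k) ->
   forall word : 'S_n -> seq 'I_n.-1,
   (forall w, Iact w mu = nut -> reduced_expr w (word w)) ->
   is_basis (R := K) (corner Q h Lambda nut mu)
     [set wr : 'S_n * {ffun 'I_n -> nat} |
        Iact wr.1 mu = nut /\ forall k, (wr.2 k)%:Z < N k]
     (fun wr => cpsi_word alpha Q beta h Lambda (word wr.1)
        * (\prod_(k < n) cx alpha Q beta h Lambda k ^+ wr.2 k)
        * ce Q h Lambda mu)).
Proof.
move=> gcm sym real pairing qpolys dominant _ b_sum nu_inj nutE N.
have basis := corner_basis gcm sym real pairing qpolys dominant b_sum nu_inj nutE.
split; last by move=> N_gt0 word; apply: basis.
split=> [nz k|N_gt0].
  rewrite ltNge; apply/negP => N_le0; apply: nz.
  have c0 := corner_vanish gcm sym real pairing qpolys dominant b_sum nu_inj nutE N_le0.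
  rewrite eqEsubset; split=> [_ [y _ <-]|_ ->]; first exact: c0.
  by exists 0; last exact: c0.
have /choice[word word_red] := @reduced_expr_exists n.
exact: (corner_neq0 gcm sym real pairing qpolys dominant b_sum nu_inj nutE N_gt0
  (word := word) (fun w _ => word_red w)).
Qed.
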